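(* Let $f_1(s)=s^{-1}1_{[1,\infty)}(s)$ for $s\geqslant0$. Suppose that $\mu\in ID(\mathbb{R}^d)$ satisfies $\mu\in\mathfrak{D}(\Phi_{f_1})$ and that the L\'evy measure $\nu$ of $\mu$ satisfies $$\left|\int_{|x|>s}x_j\,\nu(dx)\right|\sim\frac{c}{\log s}\quad\text{as }s\to\infty$$ for some $j\in\{1,\ldots,d\}$ and $c>0$. Then there is a nonrandom set $D\subset[1,\infty)$, open in $[1,\infty)$, such that $\mu\notin\mathfrak{D}_{\mathrm{c}}(\Phi_{f_2})$ for $f_2(s)=f_1(s)1_D(s)$.
   Context: $x_j$ denotes the $j$th coordinate of $x\in\mathbb{R}^d$; $g(s)\sim h(s)$ means $g(s)/h(s)\to1$. (It is known that $\mu\in\mathfrak{D}(\Phi_{f_1})$ for this $f_1$ implies $\int_{|x|>1}|x|\,\nu(dx)<\infty$, so the integrals above are well defined.) $ID(\mathbb{R}^d)$ is the class of infinitely divisible distributions on $\mathbb{R}^d$. For $\mu\in ID(\mathbb{R}^d)$, $X^{(\mu)}=\{X^{(\mu)}_t,\,t\geqslant0\}$ is a L\'evy process on $\mathbb{R}^d$ whose distribution at time $1$ is $\mu$. All integrands $f$ are nonrandom real-valued measurable functions on $[0,\infty)$. L\'evy measure: $\mu\in ID(\mathbb{R}^d)$ has $\widehat\mu(z)=e^{C_\mu(z)}$ with $$C_\mu(z)=-\tfrac12\langle z,Az\rangle+\int_{\mathbb{R}^d}\Big(e^{i\langle z,x\rangle}-1-\frac{i\langle z,x\rangle}{1+|x|^2}\Big)\nu(dx)+i\langle\gamma,z\rangle,$$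 where $A$ is a $d\times d$ symmetric nonnegative-definite matrix, $\nu$ is a measure on $\mathbb{R}^d$ (the L\'evy measure) with $\nu(\{0\})=0$ and $\int(|x|^2\wedge1)\,\nu(dx)<\infty$, and $\gamma\in\mathbb{R}^d$. Stochastic integral (in the sense of Urbanik--Woyczy\'nski, Rajput--Rosinski, Kwapie\'n--Woyczy\'nski, Sato): let $M$ be the $\mathbb{R}^d$-valued independently scattered random measure on bounded Borel subsets of $[0,\infty)$ induced by $X^{(\mu)}$ (values on disjoint sets are independent, $M$ is a.s. countably additive on disjoint sequences with bounded union, $M((s,t])=X^{(\mu)}_t-X^{(\mu)}_s$ a.s., $M(\{0\})=0$ a.s.). For a simple function $g=\sum_{j=1}^n a_j1_{B_j}$ ($a_j\in\mathbb{R}$, $B_j$ disjoint Borel sets) and a bounded Borel set $B$, $\int_B g(s)\,dX^{(\mu)}_s=\sum_j a_jM(B\cap B_j)$. A measurable $f$ is locally $X^{(\mu)}$-integrable, written $f\in\mathbf{L}(X^{(\mu)})$, if there are simple functions $f_n$ with $f_n\to f$ Lebesgue-a.e. such that for every bounded Borel $B\subset[0,\infty)$ the sequence $\int_B f_n(s)\,dX^{(\mu)}_s$ converges in probability; the limit (independent of the choice of $f_n$) is $\int_B f(s)\,dX^{(\mu)}_s$. Write $\int_0^t f(s)\,dX^{(\mu)}_s=\int_{[0,t]}f(s)\,dX^{(\mu)}_s$. The improper integral $\int_0^{\infty-}f(s)\,dX^{(\mu)}_s$ is definable if $f\in\mathbf{L}(X^{(\mu)})$ and $\int_0^tf(s)\,dX^{(\mu)}_s$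 converges in probability in $\mathbb{R}^d$ as $t\to\infty$; $\mathfrak{D}(\Phi_f)$ is the set of $\mu\in ID(\mathbb{R}^d)$ for which it is definable. The compensated improper integral of $f$ with respect to $X^{(\mu)}$ is definable if $f\in\mathbf{L}(X^{(\mu)})$ and there is $q\in\mathbb{R}^d$ such that $\int_0^{\infty-}f(s)\,dX^{(\mu*\delta_{-q})}_s$ is definable ($\delta_{-q}$ is the point mass at $-q$); $\mathfrak{D}_{\mathrm{c}}(\Phi_f)$ is the set of $\mu\in ID(\mathbb{R}^d)$ for which this holds. *)

(* Defs.v *)
From HB Require Import structures.
From mathcomp Require Import all_boot all_order all_algebra.
From mathcomp Require Import complex.
From mathcomp Require Import all_classical all_reals all_analysis.
From mathcomp Require Import measurable_realfun.

Set Implicit Arguments.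
Unset Strict Implicit.
Unset Printing Implicit Defensive.

Import Order.TTheory GRing.Theory Num.Theory numFieldNormedType.Exports.
Import HBSimple.

Local Open Scope classical_set_scope.
Local Open Scope ring_scope.

(* Matrices over R, hence R^d = 'rV[R]_d, carry their Borel sigma-algebra. *)
HB.instance Definition _ (R : realType) (m n : nat) :=
  @isMeasurable.Build (sigma_display (@open 'M[R]_(m, n))) 'M[R]_(m, n)
    <<s open >> (@sigma_algebra0 _ setT open) (@sigma_algebraC _ open)
    (@sigma_algebra_bigcup _ setT open).

Section BorelVectors.
Context {R : realType}.

Lemma measurable_coord m n (i : 'I_m) (j : 'I_n) :
  measurable_fun [set: 'M[R]_(m, n)] (fun x => x i j).
Proof.
apply: (measurability _ (RGenOpens.measurableE R)) => _ [_ [a [b ->] <-]].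
rewrite setTI; apply: sub_sigma_algebra.
by apply: open_comp => [x _|]; [exact: coord_continuous|exact: interval_open].
Qed.

Lemma measurable_fun_mx d (T : measurableType d) m n (f : T -> 'M[R]_(m, n)) :
  (forall i j, measurable_fun [set: T] (fun x => f x i j)) ->
  measurable_fun [set: T] f.
Proof.
move=> mf; apply: (@measurability _ _ _ _ _ _ (@open 'M[R]_(m, n))) => //.
move=> _ [U oU <-]; rewrite setTI.
pose B (cr : 'M[rat]_(m, n) * rat) : set 'M[R]_(m, n) :=
  [set x | forall i j, ball (ratr (cr.1 i j) : R) (ratr cr.2) (x i j)].
have -> : U = \bigcup_(cr in [set cr | B cr `<=` U]) B cr.
  apply/seteqP; split=> [x Ux|x [cr crU /crU//]].
  have /nbhs_ballP[e /= e0 eU] : nbhs x U by exact: open_nbhs_nbhs.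
  have e40 : 0 < e / 4 by rewrite divr_gt0.
  have [r] : exists q : rat, ratr q \in `](e / 4), (e / 2)[.
    by apply: rat_in_itvoo; rewrite ltr_pM2l// ltf_pV2 ?posrE// ltr_nat.
  rewrite in_itv/= => /andP[r1 r2].
  have /choice[c Hc] : forall ij : 'I_m * 'I_n, exists q : rat,
      ratr q \in `](x ij.1 ij.2 - e / 4), (x ij.1 ij.2 + e / 4)[.
    by move=> ij; apply: rat_in_itvoo; rewrite ltrBlDr -addrA ltrDl addr_gt0.
  have cx i j : `|ratr (c (i, j)) - x i j| < e / 4.
    by have := Hc (i, j); rewrite in_itv/= ltr_distl.
  exists (\matrix_(i, j) c (i, j), r) => /=.
    move=> y By; apply: eU; split => // i j.
    have := By i j; rewrite mxE /ball/= => cy.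
    rewrite -(subrK (ratr (c (i, j))) (x i j)) -addrA.
    rewrite (le_lt_trans (ler_normD _ _))// (splitr e) ltrD//.
      rewrite distrC (lt_le_trans (cx i j))// ltW//; exact: lt_trans r1 r2.
    exact: lt_trans cy r2.
  move=> i j; rewrite mxE /ball/=.
  exact: lt_trans (cx i j) r1.
rewrite bigcup_mkcond preimage_bigcup; apply: countable_bigcupT_measurable.
  exact: countableP.
move=> cr; case: ifPn => _; last by rewrite preimage_set0.
rewrite (_ : _ @^-1` _ = \bigcap_(ij in [set: 'I_m * 'I_n])
    (fun x => f x ij.1 ij.2) @^-1` ball (ratr (cr.1 ij.1 ij.2) : R) (ratr cr.2)).
  apply: fin_bigcap_measurable => // ij _.
  rewrite -[X in measurable X]setTI; apply: mf => //.
  by apply: open_measurable; apply: ball_open.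
by apply/seteqP; split=> [x Bx [i j] _|x Bx i j]; [exact: Bx|exact: (Bx (i, j))].
Qed.

Definition vadd d (p : 'rV[R]_d * 'rV[R]_d) : 'rV[R]_d := p.1 + p.2.

Lemma measurable_vadd d : measurable_fun setT (@vadd d).
Proof.
apply: measurable_fun_mx => i j; rewrite /vadd.
under eq_fun do rewrite mxE.
by apply: measurable_funD; apply: measurableT_comp (measurable_coord i j) _.
Qed.

HB.instance Definition _ d :=
  isMeasurableFun.Build _ _ _ _ (@vadd d) (@measurable_vadd d).

End BorelVectors.

Section InfinitelyDivisible.
Context {R : realType} {d : nat}.
Implicit Types (mu : probability 'rV[R]_d R) (x y z : 'rV[R]_d).

Definition inner x y : R := \sum_(i < d) x 0 i * y 0 i.

(* The library norm on 'rV[R]_d is the maximum norm; |x| is Euclidean. *)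
Definition enorm x : R := Num.sqrt (inner x x).

Definition convolution (mu1 mu2 : probability 'rV[R]_d R) :
    probability 'rV[R]_d R :=
  distribution (mu1 \x mu2)%E (@vadd R d).

Definition convolution_power mu n : probability 'rV[R]_d R :=
  iter n (convolution mu) (dirac (0 : 'rV[R]_d)).

Definition infinitely_divisible mu : Prop :=
  forall n, (0 < n)%N ->
    exists mu_n : probability 'rV[R]_d R,
      forall A, measurable A -> mu A = convolution_power mu_n n A.

Local Open Scope complex_scope.

Definition cexp (w : R[i]) : R[i] :=
  (expR (complex.Re w))%:C * (cos (complex.Im w) +i* sin (complex.Im w)).

Definition cintegral (m : {measure set 'rV[R]_d -> \bar R})
    (g : 'rV[R]_d -> R[i]) : R[i] :=
  (\int[m]_x complex.Re (g x)) +i* (\int[m]_x complex.Im (g x)).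

Definition char_fun mu z : R[i] :=
  cintegral mu (fun x => cexp ('i%C * (inner z x)%:C)).

Definition levy_exponent (A : 'M[R]_d) (nu : {measure set 'rV[R]_d -> \bar R})
    (gamma z : 'rV[R]_d) : R[i] :=
  - (2^-1 * inner z (z *m A^T))%:C
  + cintegral nu (fun x => cexp ('i%C * (inner z x)%:C) - 1
                           - 'i%C * (inner z x / (1 + enorm x ^+ 2))%:C)
  + 'i%C * (inner gamma z)%:C.

Local Close Scope complex_scope.

Definition has_levy_triplet mu (A : 'M[R]_d)
    (nu : {measure set 'rV[R]_d -> \bar R}) (gamma : 'rV[R]_d) : Prop :=
  [/\ A^T = A /\ (forall z, 0 <= inner z (z *m A^T)),
      nu [set 0] = 0%E,
      (\int[nu]_x (Num.min (enorm x ^+ 2) 1)%:E < +oo)%E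
    & forall z, char_fun mu z = cexp (levy_exponent A nu gamma z)].

Definition is_levy_measure mu (nu : {measure set 'rV[R]_d -> \bar R}) : Prop :=
  exists (A : 'M[R]_d) (gamma : 'rV[R]_d), has_levy_triplet mu A nu gamma.

End InfinitelyDivisible.

Section StochasticIntegral.
Context {R : realType} {d : nat}.
Context {dO : measure_display} {Omega : measurableType dO}.
Variable P : probability Omega R.

Definition mutually_independent n (Y : 'I_n -> Omega -> 'rV[R]_d) : Prop :=
  forall A : 'I_n -> set 'rV[R]_d, (forall i, measurable (A i)) ->
    P (\bigcap_i (Y i @^-1` A i)) = (\prod_(i < n) P (Y i @^-1` A i))%E.

Definition cvg_in_probability (I : Type) (F : set_system I)
    (Y : I -> Omega -> 'rV[R]_d) (Z : Omega -> 'rV[R]_d) : Prop :=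
  forall e : R, 0 < e ->
    (fun i => P [set w | e < enorm (Y i w - Z w)]) @ F --> 0%E.

(* Time is R; only X t with 0 <= t is constrained. *)
Definition is_levy_process (X : R -> {RV P >-> 'rV[R]_d}) : Prop :=
  [/\ {ae P, forall w, X 0 w = 0},
      forall (n : nat) (t : nat -> R), 0 <= t 0%N ->
        (forall i, (i < n)%N -> t i < t i.+1) ->
        mutually_independent (fun (i : 'I_n) w => X (t i.+1) w - X (t i) w),
      forall s t : R, 0 <= s -> 0 <= t -> forall A, measurable A ->
        P [set w | A (X (s + t) w - X s w)] = P [set w | A (X t w)],
      forall t : R, 0 <= t ->
        cvg_in_probability (within [set s | 0 <= s] (nbhs t)) X (X t)
    & {ae P, forall w, forall t : R,
        (0 <= t -> X s w @[s --> t^'+] --> X t w) /\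
        (0 < t -> cvg (X s w @[s --> t^'-]))}].

Definition bounded_borel (B : set R) : Prop :=
  [/\ measurable B, B `<=` `[0, +oo[ & bounded_set B].

(* Only M B with B bounded Borel is constrained. *)
Definition is_induced_measure (X : R -> {RV P >-> 'rV[R]_d})
    (M : set R -> {RV P >-> 'rV[R]_d}) : Prop :=
  [/\ forall (n : nat) (B : 'I_n -> set R), (forall i, bounded_borel (B i)) ->
        trivIset setT B -> mutually_independent (fun i => M (B i)),
      forall B : (set R)^nat, (forall k, bounded_borel (B k)) ->
        trivIset setT B -> bounded_borel (\bigcup_k B k) ->
        {ae P, forall w,
          series (fun k => M (B k) w) @ \oo --> M (\bigcup_k B k) w},
      forall s t : R, 0 <= s -> s < t ->
        {ae P, forall w, M `]s, t]%classic w = X t w - X s w}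
    & {ae P, forall w, M [set 0] w = 0}].

Definition simple_integral (M : set R -> {RV P >-> 'rV[R]_d})
    (g : {sfun R >-> R}) (B : set R) (w : Omega) : 'rV[R]_d :=
  \sum_(a \in range g) a *: M (B `&` g @^-1` [set a]) w.

(* J B is the integral of f over B, for every bounded Borel B. *)
Definition is_stochastic_integral (M : set R -> {RV P >-> 'rV[R]_d})
    (f : R -> R) (J : set R -> {RV P >-> 'rV[R]_d}) : Prop :=
  measurable_fun (`[0, +oo[%classic : set R) f /\
  exists f_ : {sfun R >-> R}^nat,
    {ae lebesgue_measure, forall s : R, 0 <= s ->
       (f_ n s @[n --> \oo] --> f s)} /\
    forall B, bounded_borel B ->
      cvg_in_probability \oo (fun n => simple_integral M (f_ n) B) (J B).

End StochasticIntegral.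

Section Domains.
Context {R : realType} {d : nat}.
Implicit Types (f : R -> R) (mu : probability 'rV[R]_d R).

(* The next two properties depend on X^(mu) through its law only, so they are
   stated for some realisation of X^(mu), of M and of the integral. *)
Definition locally_integrable_levy f mu : Prop :=
  exists (dO : measure_display) (Omega : measurableType dO)
    (P : probability Omega R) (X : R -> {RV P >-> 'rV[R]_d})
    (M J : set R -> {RV P >-> 'rV[R]_d}),
    [/\ is_levy_process X,
        forall A, measurable A -> distribution P (X 1) A = mu A,
        is_induced_measure X M
      & is_stochastic_integral M f J].

Definition improper_integral_definable f mu : Prop :=
  exists (dO : measure_display) (Omega : measurableType dO)
    (P : probability Omega R) (X : R -> {RV P >-> 'rV[R]_d})
    (M J : set R -> {RV P >-> 'rV[R]_d}) (Y : {RV P >-> 'rV[R]_d}),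
    [/\ is_levy_process X,
        forall A, measurable A -> distribution P (X 1) A = mu A,
        is_induced_measure X M,
        is_stochastic_integral M f J
      & cvg_in_probability P (pinfty_nbhs R) (fun t => J `[0, t]%classic) Y].

Definition dom_Phi f : set (probability 'rV[R]_d R) :=
  [set mu | infinitely_divisible mu /\ improper_integral_definable f mu].

Definition dom_Phi_c f : set (probability 'rV[R]_d R) :=
  [set mu | [/\ infinitely_divisible mu, locally_integrable_levy f mu
    & exists q : 'rV[R]_d,
        improper_integral_definable f (convolution mu (dirac (- q)))]].

End Domains.

Definition f1 {R : realType} (s : R) : R :=
  s^-1 * \1_(`[1, +oo[%classic : set R) s.

(* Main.v *)
Require Import Defs.
From mathcomp Require Import all_boot all_order all_algebra.
From mathcomp Require Import finmap complex.
From mathcomp Require Import all_classical all_reals all_analysis.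
From mathcomp Require Import measurable_realfun ring lra.

(** Fix the coordinate direction j and write exp (a v + i b v) for the characteristic
    function of the j-th coordinate of mu. For a bounded f, the integral of f over a
    bounded set B has j-th coordinate with characteristic function
      exp (int_B a (v f s) ds + i int_B b (v f s) ds)
    at v (charf_stochastic_integral). If the improper integral is definable for mu
    shifted by q, then exp (A t + i B t) converges as t tends to infinity, where A t
    and B t are the integrals over [0, t] of a (v f s) and b (v f s) + v f s q_j
    (definable_charf). The theorem is proved by making this fail for f = f2, v = 1.

    Definability for f1 first bounds int (- a (v / s)) ds over s >= 1 for some v > 0.
    Since int (1 - cos (y / s)) ds over y <= s <= 2 y is of order y, Tonelli turns
    this into a first moment of nu on |x| > 1 (integrable_coord_tail). Hence the tail
    moment h s = int_{|x| > s} x_j nu(dx) is a true integral, and expanding cosine and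
    sine (lev_re_le_Gtail, lev_im_le_Gtail) shows that a (1 / s) and
    b (1 / s) + q_j / s - (beta - h s) / s are integrable at infinity, for a constant
    beta that depends on q. So for f2 = f1 1_D the modulus exp (A t) is
    bounded from below, and
      B t = int_{D, s <= t} (beta - h s) / s ds + O(1).

    By hypothesis |h s| is of order 1 / log s, so int |h s| / s ds diverges like
    log log, and over one of the sets { h >= 0 }, { h < 0 } it is infinite. Let D be an
    open set that contains this set and exceeds it by measure at most 1. Whatever beta
    is, B t then tends to +oo or to -oo (choice_of_set): either h and beta push in the
    same direction, or beta wins because h tends to 0 while int_D ds / s diverges. As
    B is continuous, exp (A t + i B t) keeps turning around 0 and cannot converge
    (phase_divergence).

    The delicate step is the formula for the integral of f: by definition it is a limit
    in probability of integrals of simple functions f_n tending to f almost everywhere,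
    without any domination. On the sets where the f_n are uniformly bounded dominated
    convergence applies; that the remainder, of small measure, does not matter in the
    limit follows from convergence over all Borel subsets by a gliding hump
    (mult_limit_tail), as in the Vitali-Hahn-Saks theorem. *)

Set Implicit Arguments.
Unset Strict Implicit.
Unset Printing Implicit Defensive.

Import Order.TTheory GRing.Theory Num.Theory numFieldNormedType.Exports.
Import HBSimple.

Local Open Scope classical_set_scope.
Local Open Scope ring_scope.
Local Open Scope complex_scope.

(** * Complex exponentials and characteristic functions *)

Section ComplexExponential.
Context {R : realType}.
Implicit Types (x y : R) (w z : R[i]).

Lemma cexpD w z : cexp (w + z) = cexp w * cexp z.
Proof.
case: w => a b; case: z => c d; rewrite /cexp/= expRD cosD sinD.
by simpc; congr (_ +i* _); ring.
Qed.

Lemma cexp0 : cexp 0 = 1 :> R[i].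
Proof. by rewrite /cexp/= expR0 cos0 sin0 mul1r. Qed.

Lemma cexp_sum (I : Type) (s : seq I) (w : I -> R[i]) :
  cexp (\sum_(i <- s) w i) = \prod_(i <- s) cexp (w i).
Proof.
elim: s => [|i s ih]; first by rewrite !big_nil cexp0.
by rewrite !big_cons cexpD ih.
Qed.

Lemma normc_cexp w : Normc.normc (cexp w) = expR (complex.Re w).
Proof.
rewrite /cexp; case: w => a b /=; rewrite !mul0r subr0 addr0.
rewrite !exprMn -mulrDr cos2Dsin2 mulr1 sqrtr_sqr ger0_norm//; exact: expR_ge0.
Qed.

Lemma cexp_neq0 w : cexp w != 0.
Proof.
apply/eqP => /(congr1 (@Normc.normc R)); rewrite normc_cexp Normc.normc0.
by move=> h; have := expR_gt0 (complex.Re w); rewrite h ltxx.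
Qed.

Lemma lipschitz_derive1 (f df : R -> R) :
    (forall x, is_derive x 1 f (df x)) -> (forall x, `|df x| <= 1) ->
  forall x y, `|f x - f y| <= `|x - y|.
Proof.
move=> fdf df1 x y; wlog yx : x y / y <= x.
  move=> h; have [|/ltW] := leP y x; first exact: h.
  by rewrite distrC (distrC x); exact: h.
have cf : {within `[y, x], continuous f}.
  apply: derivable_within_continuous => u _.
  by have [] := fdf u.
have [c _ ->] := @MVT_segment R f df y x yx (fun u _ => fdf u) cf.
by rewrite normrM ler_piMl.
Qed.

Lemma cos_lipschitz x y : `|cos x - cos y| <= `|x - y|.
Proof.
apply: (@lipschitz_derive1 cos (fun t => - sin t)) => t.
by rewrite normrN sin_max.
Qed.

Lemma sin_lipschitz x y : `|sin x - sin y| <= `|x - y|.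
Proof. apply: (@lipschitz_derive1 sin cos) => t; exact: cos_max. Qed.

Lemma measurable_cos : measurable_fun [set: R] (@cos R).
Proof. apply: continuous_measurable_fun; exact: continuous_cos. Qed.

Lemma measurable_sin : measurable_fun [set: R] (@sin R).
Proof. apply: continuous_measurable_fun; exact: continuous_sin. Qed.

End ComplexExponential.

Definition ccvg {R : realType} (I : Type) (F : set_system I) (z : I -> R[i])
    (l : R[i]) : Prop :=
  complex.Re (z i) @[i --> F] --> complex.Re l /\
  complex.Im (z i) @[i --> F] --> complex.Im l.

Section ComplexConvergence.
Context {R : realType} {I : Type} {F : set_system I}.
Implicit Types (z : I -> R[i]) (l : R[i]).

Lemma ccvg_unique {PF : ProperFilter F} z l l' :
  ccvg F z l -> ccvg F z l' -> l = l'.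
Proof.
case: l => a b; case: l' => c d [/= h1 h2] [/= h3 h4].
by congr (_ +i* _); [exact: (cvg_unique _ h1 h3)|exact: (cvg_unique _ h2 h4)].
Qed.

Lemma ccvgM {FF : Filter F} z z' l l' : ccvg F z l -> ccvg F z' l' ->
  ccvg F (fun i => z i * z' i) (l * l').
Proof.
move=> [h1 h2] [h3 h4].
have e (u v : R[i]) : u * v = (complex.Re u * complex.Re v - complex.Im u * complex.Im v)
    +i* (complex.Re u * complex.Im v + complex.Im u * complex.Re v).
  by case: u => a b; case: v => c d.
rewrite /ccvg e/=; split.
  by under eq_fun do rewrite e/=; apply: cvgB; exact: cvgM.
by under eq_fun do rewrite e/=; apply: cvgD; exact: cvgM.
Qed.

Lemma ccvg_cst {FF : Filter F} l : ccvg F (fun=> l) l.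
Proof. by split; exact: cvg_cst. Qed.

Lemma eq_ccvg z z' l : z =1 z' -> ccvg F z l -> ccvg F z' l.
Proof. by move/funext => ->. Qed.

Lemma ccvg_cexp {FF : Filter F} (a b : I -> R) (a0 b0 : R) :
  a i @[i --> F] --> a0 -> b i @[i --> F] --> b0 ->
  ccvg F (fun i => cexp (a i +i* b i)) (cexp (a0 +i* b0)).
Proof.
move=> aa bb; have e (x y : R) :
    cexp (x +i* y) = (expR x * cos y) +i* (expR x * sin y).
  by rewrite /cexp/=; simpc.
rewrite e; apply: (@eq_ccvg (fun i =>
    (expR (a i) * cos (b i)) +i* (expR (a i) * sin (b i)))) => [i|].
  by rewrite e.
split => /=.
  apply: cvgM; first exact: (continuous_cvg _ (@continuous_expR R _) aa).
  exact: (continuous_cvg _ (@continuous_cos R _) bb).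
apply: cvgM; first exact: (continuous_cvg _ (@continuous_expR R _) aa).
exact: (continuous_cvg _ (@continuous_sin R _) bb).
Qed.

Lemma normc_le l : Normc.normc l <= `|complex.Re l| + `|complex.Im l|.
Proof.
case: l => a b /=; rewrite -(@ler_pXn2r _ 2)// ?nnegrE ?sqrtr_ge0 ?addr_ge0//.
rewrite sqr_sqrtr ?addr_ge0 ?sqr_ge0// sqrrD !real_normK ?num_real//.
by rewrite lerD2r lerDl mulrn_wge0// mulr_ge0.
Qed.

Lemma Re_le_normc l : `|complex.Re l| <= Normc.normc l.
Proof.
case: l => a b /=; rewrite -sqrtr_sqr ler_wsqrtr// lerDl sqr_ge0//.
Qed.

Lemma Im_le_normc l : `|complex.Im l| <= Normc.normc l.
Proof.
case: l => a b /=; rewrite -sqrtr_sqr ler_wsqrtr// lerDr sqr_ge0//.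
Qed.

Lemma complexBE (u v : R[i]) : u - v =
  (complex.Re u - complex.Re v) +i* (complex.Im u - complex.Im v).
Proof. by case: u => a b; case: v. Qed.

Lemma ccvg_normcP {FF : Filter F} z l : ccvg F z l <->
  forall e : R, 0 < e -> \forall i \near F, Normc.normc (z i - l) <= e.
Proof.
split => [[h1 h2] e e0|h].
  have e20 : 0 < e / 2 by rewrite divr_gt0.
  move/cvgrPdist_le : h1 => /(_ _ e20) h1; move/cvgrPdist_le : h2 => /(_ _ e20) h2.
  near=> i; rewrite (le_trans (normc_le _))// complexBE/= (splitr e).
  by apply: lerD; rewrite distrC; near: i.
split; apply/cvgrPdist_le => e /h; apply: filterS => i; apply: le_trans.
  by rewrite distrC (le_trans _ (Re_le_normc _))// complexBE.
by rewrite distrC (le_trans _ (Im_le_normc _))// complexBE.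
Unshelve. all: by end_near. Qed.

End ComplexConvergence.

Definition charf {R : realType} {dO : measure_display} {Omega : measurableType dO}
    (P : probability Omega R) (Y : Omega -> R) : R[i] :=
  (\int[P]_w cos (Y w)) +i* (\int[P]_w sin (Y w)).

Section CharacteristicFunction.
Context {R : realType} {dO : measure_display} {Omega : measurableType dO}.
Variable P : probability Omega R.
Implicit Types (Y Z : Omega -> R).

Lemma integrable_bounded_by (A : set Omega) (f : Omega -> R) (K : R) :
  measurable A -> measurable_fun setT f -> (forall w, `|f w| <= K) ->
  P.-integrable A (EFin \o f).
Proof.
move=> mA mf fK; apply: measurable_bounded_integrable => //.
- by rewrite (le_lt_trans (probability_le1 P mA))// ltry.
- exact: measurable_funTS.
- exists K; split; first exact: num_real.
  by move=> x Kx w _ /=; rewrite (le_trans (fK w))// ltW.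
Qed.

Lemma measurable_cosf Y : measurable_fun setT Y ->
  measurable_fun setT (fun w => cos (Y w)).
Proof. by move=> mY; apply: measurableT_comp mY; exact: measurable_cos. Qed.

Lemma measurable_sinf Y : measurable_fun setT Y ->
  measurable_fun setT (fun w => sin (Y w)).
Proof. by move=> mY; apply: measurableT_comp mY; exact: measurable_sin. Qed.

Lemma integrable_cos A Y : measurable A -> measurable_fun setT Y ->
  P.-integrable A (EFin \o (fun w => cos (Y w))).
Proof.
move=> mA mY; apply: (@integrable_bounded_by _ _ 1) => //.
  exact: measurable_cosf.
by move=> w; exact: cos_max.
Qed.

Lemma integrable_sin A Y : measurable A -> measurable_fun setT Y ->
  P.-integrable A (EFin \o (fun w => sin (Y w))).
Proof.
move=> mA mY; apply: (@integrable_bounded_by _ _ 1) => //.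
  exact: measurable_sinf.
by move=> w; exact: sin_max.
Qed.

Lemma Rintegral_probT (k : R) : \int[P]_w k = k.
Proof. by rewrite Rintegral_cst//= probability_setT/= mulr1. Qed.

Lemma charf_cst0 : charf P (fun=> 0) = 1.
Proof. by rewrite /charf cos0 sin0 !Rintegral_probT. Qed.

Lemma ae_eq_charf Y Z : measurable_fun setT Y -> measurable_fun setT Z ->
  {ae P, forall w, Y w = Z w} -> charf P Y = charf P Z.
Proof.
move=> mY mZ YZ.
have h (g : R -> R) : measurable_fun setT g ->
    \int[P]_w g (Y w) = \int[P]_w g (Z w).
  move=> mg; congr fine; apply: ae_eq_integral => //.
  - by apply/measurable_EFinP; exact: measurableT_comp.
  - by apply/measurable_EFinP; exact: measurableT_comp.
  - by apply: filterS YZ => w /= -> _.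
rewrite /charf (h cos) ?(h sin)//; [exact: measurable_sin|exact: measurable_cos].
Qed.

(** Off the event e < |Y - Z| the integrands differ by at most e, and on it by at
    most 2. *)
Let expectation_dist (g : R -> R) Y Z (e : R) : 0 < e ->
  (forall x y, `|g x - g y| <= `|x - y|) -> (forall x, `|g x| <= 1) ->
  measurable_fun setT g -> measurable_fun setT Y -> measurable_fun setT Z ->
  `|\int[P]_w g (Y w) - \int[P]_w g (Z w)| <=
    e + 2 * fine (P [set w | e < `|Y w - Z w|]).
Proof.
move=> e0 gl g1 mg mY mZ.
have ig X : measurable_fun setT X -> P.-integrable setT (EFin \o (fun w => g (X w))).
  move=> mX; apply: (@integrable_bounded_by _ _ 1) => //.
  exact: measurableT_comp.
rewrite -RintegralB//; [|exact: ig|exact: ig].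
set E := [set w | _].
have mE : measurable E.
  rewrite /E -[X in measurable X]setTI.
  have mYZ : measurable_fun setT (fun w => `|Y w - Z w|).
    by apply: measurableT_comp => //; exact: measurable_funB.
  have := mYZ measurableT `]e, +oo[%classic (measurable_itv _).
  by congr (measurable (_ `&` _)); apply/seteqP; split => w /=; rewrite in_itv/= andbT.
have ih : P.-integrable setT (EFin \o (fun w => g (Y w) - g (Z w))).
  apply: (@integrable_bounded_by _ _ 2) => //.
    by apply: measurable_funB; exact: measurableT_comp.
  by move=> w; rewrite (le_trans (ler_normB _ _))// -[leRHS]/(1+1) lerD.
rewrite (le_trans (le_normr_Rintegral _ _))//.
have iE : P.-integrable setT (EFin \o (fun w => 2 * \1_E w : R)).
  apply: (@integrable_bounded_by _ _ 2) => //.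
    by apply: measurable_funM => //; exact: measurable_indic.
  move=> w; rewrite normrM ger0_norm// ler_piMr// indicE.
  by case: (_ \in _); rewrite ?normr1 ?normr0.
have ie : P.-integrable setT (EFin \o (fun _ : Omega => e : R)).
  exact: (finite_measure_integrable_cst P e measurableT).
rewrite (@le_trans _ _ (\int[P]_w (e + 2 * \1_E w)))//.
  apply: le_Rintegral => //.
  - exact: integrable_norm.
  - by have := integrableD measurableT ie iE; apply: eq_integrable.
  move=> w _; rewrite indicE; have [wE|wE] := boolP (w \in E).
    rewrite mulr1 (le_trans (ler_normB _ _))//.
    have := g1 (Y w); have := g1 (Z w); have := e0; lra.
  rewrite mulr0 addr0 (le_trans (gl _ _))// leNgt.
  by apply/negP => h; move/negP: wE; apply; rewrite inE.
rewrite RintegralD//= Rintegral_probT lerD2l RintegralZl//.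
  by rewrite /Rintegral integral_indic// setIT.
apply: (@integrable_bounded_by _ _ 1) => //.
by move=> w; rewrite indicE; case: (_ \in _); rewrite ?normr1 ?normr0.
Qed.

Lemma charf_cvg_prob (I : Type) (F : set_system I) {FF : Filter F}
    (Y : I -> Omega -> R) Z :
    (forall i, measurable_fun setT (Y i)) -> measurable_fun setT Z ->
    (forall e : R, 0 < e -> P [set w | e < `|Y i w - Z w|] @[i --> F] --> 0%E) ->
  ccvg F (fun i => charf P (Y i)) (charf P Z).
Proof.
move=> mY mZ YZ.
have h (g : R -> R) : (forall x y, `|g x - g y| <= `|x - y|) ->
    (forall x, `|g x| <= 1) -> measurable_fun setT g ->
    \int[P]_w g (Y i w) @[i --> F] --> \int[P]_w g (Z w).
  move=> gl g1 mg; apply/cvgrPdist_le => e e0.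
  have e40 : 0 < e / 4 by rewrite divr_gt0.
  have /fine_cvgP[fP] := YZ _ e40.
  move/cvgrPdist_le => /(_ _ e40); apply: filterS => i /=.
  rewrite sub0r normrN ger0_norm ?fine_ge0// => Pi.
  rewrite distrC (le_trans (expectation_dist e40 gl g1 mg (mY i) mZ))//.
  by lra.
split; apply: h.
- exact: cos_lipschitz.
- exact: cos_max.
- exact: measurable_cos.
- exact: sin_lipschitz.
- exact: sin_max.
- exact: measurable_sin.
Qed.

Lemma charf_cvg_ae (Y : nat -> Omega -> R) Z :
    (forall i, measurable_fun setT (Y i)) -> measurable_fun setT Z ->
    {ae P, forall w, Y n w @[n --> \oo] --> Z w} ->
  ccvg \oo (fun i => charf P (Y i)) (charf P Z).
Proof.
move=> mY mZ YZ.
have h (g : R -> R) : continuous g ->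
    (forall x, `|g x| <= 1) -> measurable_fun setT g ->
    \int[P]_w g (Y i w) @[i --> \oo] --> \int[P]_w g (Z w).
  move=> cg g1 mg; apply: fine_cvg.
  have ig X : measurable_fun setT X -> P.-integrable setT (EFin \o (fun w => g (X w))).
    move=> mX; apply: (@integrable_bounded_by _ _ 1) => //.
    exact: measurableT_comp.
  rewrite fineK; last by apply: integrable_fin_num => //; exact: ig.
  have [] := @dominated_convergence _ _ _ P setT measurableT
    (fun n w => (g (Y n w))%:E) (fun w => (g (Z w))%:E) (cst 1%E).
  - by move=> n; apply/measurable_EFinP; exact: measurableT_comp.
  - by apply/measurable_EFinP; exact: measurableT_comp.
  - apply: filterS YZ => w Yw _; apply: cvg_EFin; first exact: nearW.
    exact: (continuous_cvg _ (cg _) Yw).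
  - exact: (finite_measure_integrable_cst P 1 measurableT).
  - by apply: aeW => w n _ /=; rewrite lee_fin.
  by move=> _ _.
split; apply: h.
- exact: continuous_cos.
- exact: cos_max.
- exact: measurable_cos.
- exact: continuous_sin.
- exact: sin_max.
- exact: measurable_sin.
Qed.

End CharacteristicFunction.

(** * Sums of independent variables *)

Section RintegralSum.
Context {R : realType} {d : measure_display} {T : measurableType d}.
Variable m : {measure set T -> \bar R}.

Lemma integrable_EFin_sum (D : set T) (I : Type) (s : seq I) (f : I -> T -> R) :
  measurable D ->
  (forall i, m.-integrable D (EFin \o f i)) ->
  m.-integrable D (EFin \o (fun x => \sum_(i <- s) f i x)).
Proof.
move=> mD fi.
have := @integrable_sum _ _ _ m _ mD _ s xpredT (fun i => EFin \o f i)
  (fun i _ => fi i).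
by apply: eq_integrable => // x _; rewrite /= sumEFin.
Qed.

Lemma Rintegral_sum (D : set T) (I : Type) (s : seq I) (f : I -> T -> R) :
  measurable D ->
  (forall i, m.-integrable D (EFin \o f i)) ->
  \int[m]_(x in D) (\sum_(i <- s) f i x) = \sum_(i <- s) \int[m]_(x in D) f i x.
Proof.
move=> mD fi; elim: s => [|i s ih].
  under eq_Rintegral do rewrite big_nil.
  by rewrite big_nil /Rintegral integral0_eq.
under eq_Rintegral do rewrite big_cons.
rewrite big_cons RintegralD//; first by rewrite ih.
exact: integrable_EFin_sum.
Qed.

End RintegralSum.

Section Independence.
Context {R : realType} {dO : measure_display} {Omega : measurableType dO}.
Variable P : probability Omega R.

Section Step.
Variables (W Y : Omega -> R) (F : set Omega) (K r : R).
Hypotheses (mW : measurable_fun setT W) (mY : measurable_fun setT Y).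
Hypotheses (mF : measurable F) (WK : forall w, `|W w| <= K).
Hypothesis WY : forall A, measurable A ->
  \int[P]_(w in F `&` Y @^-1` A) W w = r * fine (P (Y @^-1` A)).

Let K0 : 0 <= K. Proof. exact: le_trans (WK point). Qed.

Let mYA A : measurable A -> measurable (Y @^-1` A).
Proof. by move=> mA; rewrite -[X in measurable X]setTI; exact: mY. Qed.

Let step_sfun (s : {sfun R >-> R}) :
  \int[P]_(w in F) (W w * s (Y w)) = r * \int[P]_w s (Y w).
Proof.
have sE x : s x = \sum_(a <- fset_set (range s)) a * \1_(s @^-1` [set a]) x.
  by rewrite {1}fimfunE fsbig_finite//; exact: fimfunP.
have mI a : measurable (Y @^-1` (s @^-1` [set a])).
  by apply: mYA; exact: measurable_sfunP.
have IE a w : \1_(s @^-1` [set a]) (Y w) = \1_(Y @^-1` (s @^-1` [set a])) w :> R.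
  by rewrite !indicE.
have iI a D : measurable D ->
  P.-integrable D (EFin \o (fun w => a * \1_(Y @^-1` (s @^-1` [set a])) w)).
  move=> mD; apply: (@integrable_bounded_by _ _ _ _ _ _ `|a|) => //.
    by apply: measurable_funM => //; exact: measurable_indic.
  move=> w; rewrite normrM ler_piMr// indicE.
  by case: (_ \in _); rewrite ?normr1 ?normr0.
have iWI a D : measurable D ->
  P.-integrable D (EFin \o (fun w => W w * (a * \1_(Y @^-1` (s @^-1` [set a])) w))).
  move=> mD; apply: (@integrable_bounded_by _ _ _ _ _ _ (K * `|a|)) => //.
    apply: measurable_funM => //.
    by apply: measurable_funM => //; exact: measurable_indic.
  move=> w; rewrite normrM ler_pM// normrM ler_piMr// indicE.
  by case: (_ \in _); rewrite ?normr1 ?normr0.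
transitivity (\int[P]_(w in F) \sum_(a <- fset_set (range s))
    (W w * (a * \1_(Y @^-1` (s @^-1` [set a])) w))).
  apply: eq_Rintegral => w _; rewrite sE mulr_sumr.
  by apply: eq_bigr => a _; rewrite IE.
rewrite Rintegral_sum//; last by move=> a; exact: iWI.
have -> : \int[P]_w s (Y w) = \int[P]_w \sum_(a <- fset_set (range s))
    (a * \1_(Y @^-1` (s @^-1` [set a])) w).
  apply: eq_Rintegral => w _; rewrite sE.
  by apply: eq_bigr => a _; rewrite IE.
rewrite Rintegral_sum//; last by move=> a; exact: iI.
rewrite mulr_sumr; apply: eq_bigr => a _.
have iW D : measurable D -> P.-integrable D (EFin \o W).
  by move=> mD; exact: (@integrable_bounded_by _ _ _ _ _ _ K).
have -> : \int[P]_w (a * \1_(Y @^-1` (s @^-1` [set a])) w) =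
    a * fine (P (Y @^-1` (s @^-1` [set a]))).
  rewrite RintegralZl//; first by rewrite /Rintegral integral_indic// setIT.
  exact: integrable_indic.
rewrite mulrCA -WY; last exact: measurable_sfunP.
have -> : \int[P]_(w in F `&` Y @^-1` (s @^-1` [set a])) W w =
    \int[P]_(w in F) (W w * \1_(Y @^-1` (s @^-1` [set a])) w).
  rewrite Rintegral_mkcondr; apply: eq_Rintegral => w _; rewrite patchE indicE.
  by case: ifPn => _; rewrite ?mulr1 ?mulr0.
rewrite -RintegralZl//; first by under eq_Rintegral do rewrite mulrCA.
apply: (@integrable_bounded_by _ _ _ _ _ _ K) => //.
  by apply: measurable_funM => //; exact: measurable_indic.
move=> w; rewrite normrM (le_trans _ (WK w))// ler_piMr// indicE.
by case: (_ \in _); rewrite ?normr1 ?normr0.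
Qed.

Let Rintegral_le_subset (f : Omega -> R) :
    P.-integrable setT (EFin \o f) -> (forall w, 0 <= f w) ->
  \int[P]_(w in F) f w <= \int[P]_w f w.
Proof.
move=> intf f0; apply: fine_le.
- by apply: integrable_fin_num => //; exact: integrableS intf.
- exact: integrable_fin_num.
- apply: ge0_subset_integral => //.
    exact: measurable_int intf.
  by move=> w _; rewrite lee_fin.
Qed.

(** The factorisation passes from events to simple functions of Y by linearity;
    both sides are continuous in g for the L1 norm of the law of Y. *)
Lemma integral_factor (g : R -> R) : measurable_fun setT g ->
  (forall x, `|g x| <= 1) ->
  \int[P]_(w in F) (W w * g (Y w)) = r * \int[P]_w g (Y w).
Proof.
move=> mg g1.
pose X : {RV P >-> R} := mfun_Sub (mem_set mY).
have ig : (distribution P X).-integrable setT (EFin \o g).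
  apply: (@integrable_bounded_by _ _ _ _ _ _ 1) => //.
have [h [ih _ hg]] := approximation_sfun_integrable measurableT ig.
pose I n := \int[P]_w `|g (Y w) - h n (Y w)|.
have mdx n : measurable_fun setT (fun x => g x - h n x) by exact: measurable_funB.
have md n : measurable_fun setT (fun w => g (Y w) - h n (Y w)).
  by apply: (measurableT_comp (mdx n)).
have idist n : (\int[distribution P X]_x `|(g x)%:E - (h n x)%:E| =
    \int[P]_w `|g (Y w) - h n (Y w)|%:E)%E.
  rewrite ge0_integral_distribution//.
  by apply/measurable_EFinP; apply: measurableT_comp => //; exact: mdx.
have id n : P.-integrable setT (EFin \o (fun w => g (Y w) - h n (Y w))).
  apply/integrableP; split; first exact/measurable_EFinP.
  rewrite /= -idist.
  have := integrableB measurableT ig (ih n).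
  by move/integrableP => [].
have I0 : I n @[n --> \oo] --> 0.
  apply: fine_cvg; apply: cvg_trans hg.
  by apply: near_eq_cvg; apply: nearW => n; rewrite idist.
have b n : `|\int[P]_(w in F) (W w * g (Y w)) - r * \int[P]_w g (Y w)| <= (K + `|r|) * I n.
  have igY : P.-integrable setT (EFin \o (fun w => g (Y w))).
    apply: (@integrable_bounded_by _ _ _ _ _ _ 1) => //.
    exact: measurableT_comp mY.
  have ihY : P.-integrable setT (EFin \o (fun w => h n (Y w))).
    have := integrableB measurableT igY (id n); apply: eq_integrable => // w _ /=.
    by rewrite -EFinB; congr EFin; ring.
  have iWg : P.-integrable F (EFin \o (fun w => W w * g (Y w))).
    apply: (@integrable_bounded_by _ _ _ _ _ _ K) => //.
      by apply: measurable_funM => //; exact: measurableT_comp mY.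
    by move=> w; rewrite normrM (le_trans _ (WK w))// ler_piMr.
  have iWd : P.-integrable F (EFin \o (fun w => W w * (g (Y w) - h n (Y w)))).
    have idF : P.-integrable F (EFin \o (fun w => K * `|g (Y w) - h n (Y w)|)).
      have := integrableZl measurableT K (integrable_norm (id n)).
      by move=> /(integrableS measurableT mF (@subsetT _ _)); exact: eq_integrable.
    apply: le_integrable idF => //.
      apply/measurable_EFinP; apply: measurable_funTS.
      by apply: measurable_funM => //; exact: measurable_funTS.
    move=> w _ /=; rewrite lee_fin !normrM normr_id ler_pM//.
    by rewrite (le_trans (WK w))// ler_norm.
  have e1 : \int[P]_(w in F) (W w * g (Y w)) =
      \int[P]_(w in F) (W w * (g (Y w) - h n (Y w))) + r * \int[P]_w h n (Y w).
    rewrite -step_sfun -RintegralD//.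
      by apply: eq_Rintegral => w _; ring.
    have := integrableB mF iWg iWd; apply: eq_integrable => // w _ /=.
    by rewrite -EFinB; congr EFin; ring.
  have e2 : \int[P]_w g (Y w) = \int[P]_w (g (Y w) - h n (Y w)) + \int[P]_w h n (Y w).
    by rewrite -RintegralD//; apply: eq_Rintegral => w _; ring.
  rewrite e1 e2 mulrDr opprD addrACA subrr addr0 mulrDl.
  rewrite (le_trans (ler_normB _ _))// lerD//.
    rewrite (le_trans (le_normr_Rintegral _ _))//.
    have iK : P.-integrable setT (EFin \o (fun w => K * `|g (Y w) - h n (Y w)|)).
      by have := integrableZl measurableT K (integrable_norm (id n)); exact: eq_integrable.
    rewrite -RintegralZl//; last exact: integrable_norm.
    rewrite (le_trans _ (Rintegral_le_subset _ _))//.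
      apply: le_Rintegral => //.
      - exact: integrable_norm.
      - exact: integrableS iK.
      - by move=> w _; rewrite normrM ler_wpM2r.
    by move=> w; rewrite mulr_ge0.
  by rewrite normrM ler_wpM2l// le_normr_Rintegral.
apply/eqP; rewrite -subr_eq0 -normr_le0.
have KI0 : (K + `|r|) * I n @[n --> \oo] --> 0.
  by rewrite -(mulr0 (K + `|r|)); apply: cvgM => //; exact: cvg_cst.
by apply: (ler_cvg_to (cvg_cst _) KI0); apply: nearW.
Qed.

End Step.

Section Sum.
Variables (n : nat) (Y : 'I_n -> Omega -> R).
Hypothesis mY : forall i, measurable_fun setT (Y i).
Hypothesis indepY : forall A : 'I_n -> set R, (forall i, measurable (A i)) ->
  P (\bigcap_i (Y i @^-1` A i)) = (\prod_(i < n) P (Y i @^-1` A i))%E.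

Let Z k (w : Omega) : R := \sum_(i < n | (i < k)%N) Y i w.
Let Phi k : R[i] := \prod_(i < n | (i < k)%N) charf P (Y i).
Let cap (A : 'I_n -> set R) := \bigcap_i (Y i @^-1` A i).

Let mYA i A : measurable A -> measurable (Y i @^-1` A).
Proof. by move=> mA; rewrite -[X in measurable X]setTI; exact: mY. Qed.

Let mcap A : (forall i, measurable (A i)) -> measurable (cap A).
Proof.
move=> mA; apply: fin_bigcap_measurable => // i _; exact: mYA.
Qed.

Let mZ k : measurable_fun setT (Z k).
Proof.
rewrite /Z; under eq_fun do rewrite -big_filter.
by apply: measurable_sum => i; exact: mY.
Qed.

(** Independence speaks of events, so the induction carries an event cap A that
    constrains only the variables not yet summed; summing one more variable
    consumes its constraint through integral_factor. *)
Let partial k : (k <= n)%N -> forall A : 'I_n -> set R,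
    (forall i, measurable (A i)) -> (forall i : 'I_n, (i < k)%N -> A i = setT) ->
  \int[P]_(w in cap A) cos (Z k w) = complex.Re (Phi k) * fine (P (cap A)) /\
  \int[P]_(w in cap A) sin (Z k w) = complex.Im (Phi k) * fine (P (cap A)).
Proof.
elim: k => [_ A mA _|k ih kn A mA AT].
  have Z0 w : Z 0 w = 0 by rewrite /Z big_pred0.
  rewrite /Phi big_pred0//= mul1r mul0r.
  under eq_Rintegral do rewrite Z0 cos0.
  under [X in _ /\ X = _]eq_Rintegral do rewrite Z0 sin0.
  by rewrite !Rintegral_cst ?mul1r ?mul0r//; exact: mcap.
pose K := Ordinal kn.
have bigK (T : Type) (idx : T) (op : Monoid.com_law idx) (f : 'I_n -> T) :
    \big[op/idx]_(i < n | (i < k.+1)%N) f i =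
    op (f K) (\big[op/idx]_(i < n | (i < k)%N) f i).
  rewrite (bigD1 K)//=; congr (op _ _); apply: eq_bigl => i.
  rewrite ltnS leq_eqVlt -(inj_eq val_inj)/=.
  by case: ltngtP.
have ZS w : Z k.+1 w = Y K w + Z k w by rewrite /Z bigK.
have PS : Phi k.+1 = charf P (Y K) * Phi k by rewrite /Phi bigK.
have ATk (i : 'I_n) : (i < k)%N -> A i = setT by move=> ik; rewrite AT// ltnW.
have AK : A K = setT by rewrite AT.
pose A' B (i : 'I_n) := if i == K then B else A i.
have mA' B : measurable B -> forall i, measurable (A' B i).
  by move=> mB i; rewrite /A'; case: ifP.
have capA' B : cap A `&` Y K @^-1` B = cap (A' B).
  apply/seteqP; split => [w [wA wB] i _|w wA'].
    by rewrite /A'; case: eqP => [->|_]//; exact: wA.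
  split => [i _|]; last by have := wA' K I; rewrite /A' eqxx.
  have := wA' i I; rewrite /A'; case: eqP => [-> _|]//.
  by rewrite /= AK.
have PA' B : measurable B ->
    fine (P (cap (A' B))) = fine (P (cap A)) * fine (P (Y K @^-1` B)).
  move=> mB; rewrite /cap !indepY//; last exact: mA'.
  rewrite (bigD1 K)//= [in RHS](bigD1 K)//= AK preimage_setT probability_setT mul1e.
  rewrite {1}/A' eqxx muleC.
  have -> : (\prod_(i < n | i != K) P (Y i @^-1` A' B i) =
      \prod_(i < n | i != K) P (Y i @^-1` A i))%E.
    by apply: eq_bigr => i iK; rewrite /A' (negbTE iK).
  rewrite fineM//; last by apply: fin_num_measure; exact: mYA.
  elim/big_ind : _ => //; first by move=> x y; exact: fin_numM.
  by move=> i _; apply: fin_num_measure; exact: mYA.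
have A'T B (i : 'I_n) : (i < k)%N -> A' B i = setT.
  move=> ik; rewrite /A'; case: eqP => [iK|_]; last exact: ATk.
  by move: ik; rewrite iK/= ltnn.
have [cZ sZ] : (forall B, measurable B -> \int[P]_(w in cap A `&` Y K @^-1` B) cos (Z k w) =
      complex.Re (Phi k) * fine (P (cap A)) * fine (P (Y K @^-1` B))) /\
    (forall B, measurable B -> \int[P]_(w in cap A `&` Y K @^-1` B) sin (Z k w) =
      complex.Im (Phi k) * fine (P (cap A)) * fine (P (Y K @^-1` B))).
  split => B mB; rewrite capA' -mulrA -PA'//;
    by have [] := ih (ltnW kn) (A' B) (mA' _ mB) (A'T B).
have mc := measurable_cosf (mZ k); have ms := measurable_sinf (mZ k).
have c1 w : `|cos (Z k w)| <= 1 by exact: cos_max.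
have s1 w : `|sin (Z k w)| <= 1 by exact: sin_max.
have mcA := mcap mA.
have cc := integral_factor mc (mY K) mcA c1 cZ measurable_cos (@cos_max R).
have cs := integral_factor mc (mY K) mcA c1 cZ measurable_sin (@sin_max R).
have sc := integral_factor ms (mY K) mcA s1 sZ measurable_cos (@cos_max R).
have ss := integral_factor ms (mY K) mcA s1 sZ measurable_sin (@sin_max R).
have imul (f g : Omega -> R) : measurable_fun setT f -> measurable_fun setT g ->
    (forall w, `|f w| <= 1) -> (forall w, `|g w| <= 1) ->
    P.-integrable (cap A) (EFin \o (fun w => f w * g w)).
  move=> mf mg f1 g1; apply: (@integrable_bounded_by _ _ _ _ _ _ 1) => //.
    exact: measurable_funM.
  by move=> w; rewrite normrM (le_trans _ (f1 w))// ler_piMr.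
have mcY := measurable_cosf (mY K); have msY := measurable_sinf (mY K).
have cY1 w : `|cos (Y K w)| <= 1 by exact: cos_max.
have sY1 w : `|sin (Y K w)| <= 1 by exact: sin_max.
split.
  under eq_Rintegral do rewrite ZS addrC cosD.
  rewrite RintegralB//; [|exact: imul|exact: imul].
  by rewrite cc ss PS; case: (Phi k) => a b /=; ring.
under eq_Rintegral do rewrite ZS addrC sinD.
rewrite RintegralD//; [|exact: imul|exact: imul].
by rewrite sc cs PS; case: (Phi k) => a b /=; ring.
Qed.

Lemma charf_sum_indep :
  charf P (fun w => \sum_(i < n) Y i w) = \prod_(i < n) charf P (Y i).
Proof.
have [] := @partial n (leqnn n) (fun=> setT) (fun=> measurableT) (fun _ _ => erefl).
have -> : cap (fun=> setT) = setT by apply/seteqP; split.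
rewrite probability_setT !mulr1.
have -> : Z n = (fun w => \sum_(i < n) Y i w).
  by apply/funext => w; apply: eq_bigl => i; rewrite ltn_ord.
have -> : Phi n = \prod_(i < n) charf P (Y i).
  by apply: eq_bigl => i; rewrite ltn_ord.
by rewrite /charf => -> ->; case: (\prod_(i < n) _).
Qed.

End Sum.
End Independence.

(** * Coordinates of Levy processes *)

Section Coordinates.
Context {R : realType} {d : nat} {dO : measure_display} {Omega : measurableType dO}.
Variables (P : probability Omega R) (k : 'I_d).

Lemma coord_le_enorm (x : 'rV[R]_d) : `|x 0 k| <= enorm x.
Proof.
rewrite /enorm -sqrtr_sqr ler_wsqrtr// /inner (bigD1 k)//= -expr2 lerDl.
by apply: sumr_ge0 => i _; rewrite -expr2 sqr_ge0.
Qed.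

Lemma measurable_enorm : measurable_fun setT (@enorm R d).
Proof.
rewrite /enorm; apply: measurableT_comp => //.
  apply: continuous_measurable_fun; exact: sqrt_continuous.
rewrite /inner; apply: measurable_sum => i.
by apply: measurable_funM; exact: measurable_coord.
Qed.

Lemma measurable_scaled_coord (Y : Omega -> 'rV[R]_d) (v : R) :
  measurable_fun setT Y -> measurable_fun setT (fun w => v * Y w 0 k).
Proof.
move=> mY; apply: measurable_funM => //.
exact: (measurableT_comp (measurable_coord 0 k) mY).
Qed.

Lemma measurable_rV_sub (Y Z : Omega -> 'rV[R]_d) :
  measurable_fun setT Y -> measurable_fun setT Z ->
  measurable_fun setT (fun w => Y w - Z w).
Proof.
move=> mY mZ; apply: measurable_fun_mx => i j.
under eq_fun do rewrite !mxE.
by apply: measurable_funB;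
  [exact: (measurableT_comp (measurable_coord i j) mY)|
   exact: (measurableT_comp (measurable_coord i j) mZ)].
Qed.

Lemma charf_cvg_in_probability (I : Type) (F : set_system I) {FF : Filter F}
    (Y : I -> Omega -> 'rV[R]_d) (Z : Omega -> 'rV[R]_d) (v : R) :
  (forall i, measurable_fun setT (Y i)) -> measurable_fun setT Z ->
  cvg_in_probability P F Y Z ->
  ccvg F (fun i => charf P (fun w => v * Y i w 0 k)) (charf P (fun w => v * Z w 0 k)).
Proof.
move=> mY mZ YZ; apply: charf_cvg_prob.
- by move=> i; exact: measurable_scaled_coord.
- exact: measurable_scaled_coord.
move=> e e0; have v0 : 0 < `|v| + 1 by rewrite ltr_pwDr.
have e1 : 0 < e / (`|v| + 1) by rewrite divr_gt0.
apply: (@squeeze_cvge _ _ _ _ (cst 0%E) _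
    (fun i => P [set w | e / (`|v| + 1) < enorm (Y i w - Z w)])); last first.
- exact: YZ.
- exact: cvg_cst.
apply: nearW => i; apply/andP; split; first exact: measure_ge0.
apply: le_measure.
- rewrite inE -[X in measurable X]setTI.
  have mf : measurable_fun setT (fun w => `|v * Y i w 0 k - v * Z w 0 k|).
    apply: measurableT_comp => //.
    by apply: measurable_funB; exact: measurable_scaled_coord.
  have := mf measurableT `]e, +oo[%classic (measurable_itv _).
  by congr (measurable (_ `&` _)); apply/seteqP; split => w /=; rewrite in_itv/= andbT.
- rewrite inE -[X in measurable X]setTI.
  have mf : measurable_fun setT (fun w => enorm (Y i w - Z w)).
    by apply: (measurableT_comp measurable_enorm); exact: measurable_rV_sub.
  have := mf measurableT `](e / (`|v| + 1)), +oo[%classic (measurable_itv _).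
  by congr (measurable (_ `&` _)); apply/seteqP; split => w /=; rewrite in_itv/= andbT.
move=> w /= ew; rewrite ltr_pdivrMr//.
apply: (lt_le_trans ew); rewrite -mulrBr normrM.
have -> : Y i w 0 k - Z w 0 k = (Y i w - Z w) 0 k by rewrite !mxE.
rewrite mulrC ler_pM//; first exact: coord_le_enorm.
by rewrite lerDl.
Qed.

Lemma mutually_independent_coord n (Y : 'I_n -> Omega -> 'rV[R]_d) (v : 'I_n -> R) :
  mutually_independent P Y ->
  forall A : 'I_n -> set R, (forall i, measurable (A i)) ->
  P (\bigcap_i ((fun w => v i * Y i w 0 k) @^-1` A i)) =
  (\prod_(i < n) P ((fun w => (v i * Y i w 0 k)%R) @^-1` A i))%E.
Proof.
move=> iY A mA; pose B i := [set x : 'rV[R]_d | A i (v i * x 0 k)].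
apply: (iY B) => i; rewrite -[X in measurable X]setTI.
have mf : measurable_fun [set: 'rV[R]_d] (fun x => v i * x 0 k).
  by apply: measurable_funM => //; exact: measurable_coord.
exact: mf.
Qed.

Lemma charf_sum_coord n (Y : 'I_n -> {RV P >-> 'rV[R]_d}) (v : 'I_n -> R) :
  mutually_independent P (fun i => Y i : Omega -> _) ->
  charf P (fun w => \sum_(i < n) v i * Y i w 0 k) =
  \prod_(i < n) charf P (fun w => v i * Y i w 0 k).
Proof.
move=> iY; apply: (@charf_sum_indep _ _ _ P n (fun i w => v i * Y i w 0 k)).
  by move=> i; apply: measurable_scaled_coord.
exact: mutually_independent_coord.
Qed.

End Coordinates.

Lemma eq_law_charf {R : realType} {d1 d2 : measure_display}
    {T1 : measurableType d1} {T2 : measurableType d2}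
    (P1 : probability T1 R) (P2 : probability T2 R) (Y1 : T1 -> R) (Y2 : T2 -> R) :
  measurable_fun setT Y1 -> measurable_fun setT Y2 ->
  (forall A, measurable A -> P1 (Y1 @^-1` A) = P2 (Y2 @^-1` A)) ->
  charf P1 Y1 = charf P2 Y2.
Proof.
move=> m1 m2 h.
pose X1 : {RV P1 >-> R} := mfun_Sub (mem_set m1).
pose X2 : {RV P2 >-> R} := mfun_Sub (mem_set m2).
have e (g : R -> R) : measurable_fun setT g -> (forall x, `|g x| <= 1) ->
    \int[P1]_w g (Y1 w) = \int[P2]_w g (Y2 w).
  move=> mg g1; congr fine.
  have i1 : P1.-integrable setT (EFin \o (fun w => g (Y1 w))).
    by apply: (@integrable_bounded_by _ _ _ _ _ _ 1) => //; exact: measurableT_comp.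
  have i2 : P2.-integrable setT (EFin \o (fun w => g (Y2 w))).
    by apply: (@integrable_bounded_by _ _ _ _ _ _ 1) => //; exact: measurableT_comp.
  have mEg : measurable_fun setT (EFin \o g) by exact/measurable_EFinP.
  have <- : (\int[distribution P1 X1]_x (g x)%:E = \int[P1]_w (g (Y1 w))%:E)%E.
    exact: integral_distribution.
  have <- : (\int[distribution P2 X2]_x (g x)%:E = \int[P2]_w (g (Y2 w))%:E)%E.
    exact: integral_distribution.
  by apply: eq_measure_integral => A mA _; exact: h.
rewrite /charf !e//; [exact: measurable_sin|exact: sin_max|
  exact: measurable_cos|exact: cos_max].
Qed.

Lemma charf_continuous {R : realType} {dO : measure_display}
    {Omega : measurableType dO} (P : probability Omega R) (Y : Omega -> R) :
  measurable_fun setT Y ->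
  continuous (fun v : R => complex.Re (charf P (fun w => v * Y w))) /\
  continuous (fun v : R => complex.Im (charf P (fun w => v * Y w))).
Proof.
move=> mY.
have h (u : nat -> R) (v : R) : u n @[n --> \oo] --> v ->
    ccvg \oo (fun n => charf P (fun w => u n * Y w)) (charf P (fun w => v * Y w)).
  move=> uv; apply: charf_cvg_ae.
  - by move=> n; exact: measurable_funM.
  - exact: measurable_funM.
  - by apply: aeW => w; apply: cvgM => //; exact: cvg_cst.
by split => v; apply/(@cvg_nbhsP _ R^o) => u /h [].
Qed.

Section LevyProcess.
Context {R : realType} {d : nat} {dO : measure_display} {Omega : measurableType dO}.
Variables (P : probability Omega R) (k : 'I_d).
Variable X : R -> {RV P >-> 'rV[R]_d}.
Hypothesis levyX : is_levy_process X.
Variables a b : R -> R.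
Hypotheses (ca : continuous a) (cb : continuous b) (a0 : a 0 = 0) (b0 : b 0 = 0).
Hypothesis char1 : forall v, charf P (fun w => v * X 1 w 0 k) = cexp (a v +i* b v).

Let phi t v := charf P (fun w => v * X t w 0 k).

Let mX t : measurable_fun setT (X t).
Proof. by []. Qed.

Let phi0 v : phi 0 v = 1.
Proof.
rewrite -(charf_cst0 P); apply: ae_eq_charf => //.
  exact: measurable_scaled_coord.
have [X0 _ _ _ _] := levyX; apply: filterS X0 => w ->.
by rewrite mxE mulr0.
Qed.

Let phiD (s t v : R) : 0 <= s -> 0 <= t -> phi (s + t) v = phi s v * phi t v.
Proof.
rewrite le_eqVlt => /predU1P[<- _|s0]; first by rewrite phi0 mul1r add0r.
rewrite le_eqVlt => /predU1P[<-|t0]; first by rewrite phi0 mulr1 addr0.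
have [X0 Xi Xs _ _] := levyX.
(* increments over 0 < s < s + t; the hypothesis asks for strictly increasing
   times, whence the separate treatment of s = 0 and t = 0 *)
pose T (i : nat) := if i == 0%N then 0 else if i == 1%N then s else s + t.
have := Xi 2%N T (lexx _).
have Tlt i : (i < 2)%N -> T i < T i.+1 by case: i => [|[|]]//= _; rewrite /T/= ltrDl.
move=> /(_ Tlt) ind.
have mD i : measurable_fun setT (fun w => v * (X (T i.+1) w - X (T i) w) 0 k).
  by apply: measurable_scaled_coord; exact: measurable_rV_sub.
have := @charf_sum_indep _ _ _ P 2
  (fun i w => v * (X (T i.+1) w - X (T i) w) 0 k) (fun i => mD i)
  (mutually_independent_coord k (fun=> v) ind).
rewrite !big_ord_recl big_ord0 mulr1 => e.
transitivity (charf P (fun w => \sum_(i < 2) v * (X (T i.+1) w - X (T i) w) 0 k)).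
  apply: ae_eq_charf.
  - exact: measurable_scaled_coord.
  - by apply: measurable_sum.
  apply: filterS X0 => w X0.
  rewrite !big_ord_recl big_ord0/= /T/= X0 !mxE; ring.
rewrite e /T/=; congr (_ * _).
  apply: ae_eq_charf; [exact: (mD 0%N)|exact: measurable_scaled_coord|].
  by apply: filterS X0 => w ->; rewrite subr0.
apply: eq_law_charf; [exact: (mD 1%N)|exact: measurable_scaled_coord|].
move=> A mA; pose B := [set x : 'rV[R]_d | A (v * x 0 k)].
apply: (Xs s t (ltW s0) (ltW t0) B).
rewrite -[X in measurable X]setTI.
have mf : measurable_fun [set: 'rV[R]_d] (fun x => v * x 0 k).
  by apply: measurable_funM => //; exact: measurable_coord.
exact: mf.
Qed.

(** The exponent at time t/2 is determined by a square root, and the sign of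
    that root cannot jump as the argument v moves away from 0. *)
Let phi_half (t : R) : 0 <= t -> (forall v, phi t v = cexp ((t * a v) +i* (t * b v))) ->
  forall v, phi (t / 2) v = cexp ((t / 2 * a v) +i* (t / 2 * b v)).
Proof.
move=> t0 pt v0.
pose E v := cexp ((- (t / 2 * a v)) +i* (- (t / 2 * b v))).
pose rho v := phi (t / 2) v * E v.
have t20 : 0 <= t / 2 by rewrite divr_ge0.
(* rho is continuous with values in {1, -1} and rho 0 = 1 *)
have rho2 v : rho v ^+ 2 = 1.
  rewrite /rho exprMn !expr2 -phiD// -splitr pt /E -!cexpD -cexp0; congr cexp.
  by simpc; congr (_ +i* _); field.
have rho1 v : rho v = 1 \/ rho v = -1.
  have := rho2 v => /eqP; rewrite -subr_eq0 subr_sqr_1 mulf_eq0.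
  by rewrite subr_eq0 addr_eq0 => /orP[/eqP|/eqP]; [left|right].
have crho : continuous (fun v => complex.Re (rho v)).
  have [cR cI] := charf_continuous P (measurable_scaled_coord k 1 (@mX (t / 2))).
  move=> v.
  have h1 : ccvg (nbhs v) (phi (t / 2)) (phi (t / 2) v).
    have e u : phi (t / 2) u = charf P (fun w => u * (1 * X (t / 2) w 0 k)).
      by congr charf; apply/funext => w; rewrite mul1r.
    split; rewrite e; under eq_fun do rewrite e; [exact: cR|exact: cI].
  have h2 : ccvg (nbhs v) E (E v).
    apply: ccvg_cexp; apply: cvgN; apply: cvgM; try exact: cvg_cst.
      exact: ca.
    exact: cb.
  by have [] := ccvgM h1 h2.
have rho0 : complex.Re (rho 0) = 1.
  rewrite /rho /E a0 b0 !mulr0 oppr0 cexp0 mulr1 /phi.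
  rewrite (_ : (fun w => _) = (fun=> 0)); first by rewrite charf_cst0.
  by apply/funext => w; rewrite mul0r.
have rho_eq1 v : rho v = 1.
  have [//|rN] := rho1 v; exfalso.
  have nz u : complex.Re (rho u) != 0.
    by have [->|->] := rho1 u => /=; rewrite ?oppr_eq0 oner_eq0.
  have cw x y : {within `[x, y], continuous (fun u => complex.Re (rho u))}.
    exact: continuous_subspaceT.
  have Nv : complex.Re (rho v) = -1 by rewrite rN.
  have [v00|v00] := leP 0 v.
    have rng : Num.min (complex.Re (rho 0)) (complex.Re (rho v)) <= 0 <=
        Num.max (complex.Re (rho 0)) (complex.Re (rho v)).
      by rewrite rho0 Nv ge_min le_max lerN10 ler01 orbT.
    have [c _ c0] := IVT v00 (cw _ _) rng.
    by have := nz c; rewrite c0 eqxx.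
  have rng : Num.min (complex.Re (rho v)) (complex.Re (rho 0)) <= 0 <=
      Num.max (complex.Re (rho v)) (complex.Re (rho 0)).
    by rewrite rho0 Nv ge_min le_max lerN10 ler01 orbT.
  have [c _ c0] := IVT (ltW v00) (cw _ _) rng.
  by have := nz c; rewrite c0 eqxx.
have := rho_eq1 v0; rewrite /rho => h.
have EE : E v0 * cexp ((t / 2 * a v0) +i* (t / 2 * b v0)) = 1.
  by rewrite /E -cexpD -cexp0; congr cexp; simpc; rewrite !addNr.
by rewrite -[LHS]mulr1 -EE mulrA h mul1r.
Qed.

Let phi_dyadic m n v : phi (n%:R / 2 ^+ m) v =
  cexp ((n%:R / 2 ^+ m * a v) +i* (n%:R / 2 ^+ m * b v)).
Proof.
have h1 : forall u, phi (1 / 2 ^+ m) u =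
    cexp ((1 / 2 ^+ m * a u) +i* (1 / 2 ^+ m * b u)).
  elim: m => [|m ih] u; first by rewrite expr0 divr1 !mul1r; exact: char1.
  rewrite exprSr invfM mulrA; apply: phi_half; last exact: ih.
  by rewrite divr_ge0// exprn_ge0.
elim: n => [|n ih]; first by rewrite !mul0r phi0 cexp0.
rewrite -natr1 mulrDl phiD ?divr_ge0 ?exprn_ge0// ih h1 -cexpD; congr cexp.
by simpc; congr (_ +i* _); ring.
Qed.

(** Successive halving from time 1 reaches the dyadic times, and stochastic
    continuity all others. *)
Lemma charf_levy (t v : R) : 0 <= t ->
  charf P (fun w => v * X t w 0 k) = cexp ((t * a v) +i* (t * b v)).
Proof.
move=> t0.
pose u m : R := (Num.truncn (t * 2 ^+ m))%:R / 2 ^+ m.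
have u0 m : 0 <= u m by rewrite divr_ge0// exprn_ge0.
have ut : u m @[m --> \oo] --> t.
  apply: (@squeeze_cvgr _ _ _ _ (fun m => t - (1 / 2) ^+ m) (cst t)).
  - apply: nearW => m /=; rewrite /u.
    have p0 : 0 < 2 ^+ m :> R by rewrite exprn_gt0.
    have /andP[h1 h2] : (Num.truncn (t * 2 ^+ m))%:R <= t * 2 ^+ m < (Num.truncn (t * 2 ^+ m)).+1%:R.
      by apply: truncn_itv; rewrite mulr_ge0// ltW.
    rewrite ler_pdivrMr// h1 andbT ler_pdivlMr// mulrBl -exprMn mul1r mulVf// expr1n.
    by rewrite lerBlDr natr1 ltW.
  - rewrite -[X in _ --> X]subr0; apply: cvgB; first exact: cvg_cst.
    by apply: cvg_expr; rewrite ger0_norm; lra.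
  - exact: cvg_cst.
have [_ _ _ Xc _] := levyX.
have c1 : ccvg \oo (fun m => charf P (fun w => v * X (u m) w 0 k))
    (charf P (fun w => v * X t w 0 k)).
  apply: charf_cvg_in_probability => // e e0.
  move=> B hB; have hW := Xc t t0 e e0 B hB.
  have [N _ hN] := ut _ hW; exists N => // m Nm.
  by apply: (hN m Nm); exact: u0.
have c2 : ccvg \oo (fun m => charf P (fun w => v * X (u m) w 0 k))
    (cexp ((t * a v) +i* (t * b v))).
  apply: (@eq_ccvg _ _ _ (fun m => cexp ((u m * a v) +i* (u m * b v)))).
    by move=> m; rewrite -phi_dyadic.
  by apply: ccvg_cexp; apply: cvgM => //; exact: cvg_cst.
exact: ccvg_unique c1 c2.
Qed.

End LevyProcess.

(** * The independently scattered random measure *)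

Section BoundedBorel.
Context {R : realType}.
Implicit Types B C : set R.

Lemma bounded_borelP B : bounded_borel B <->
  measurable B /\ exists N : R, B `<=` `[0, N].
Proof.
split=> [[mB B0 [N [_ BN]]]|[mB [N BN]]].
  split => //; exists (`|N| + 1) => x Bx /=; rewrite in_itv/=.
  have := B0 x Bx; rewrite /= in_itv/= andbT => -> /=.
  apply: le_trans (BN (`|N| + 1) _ x Bx); first exact: ler_norm.
  by rewrite ltr_pwDr// ler_norm.
split => //.
  by move=> x /BN; rewrite /= !in_itv/= => /andP[-> _].
exists (`|N|); split; first exact: num_real.
move=> y Ny x /BN; rewrite /= in_itv/= => /andP[x0 xN].
by rewrite ger0_norm// (le_trans xN)// (le_trans (ler_norm N))// ltW.
Qed.

Lemma bounded_borelS B C : measurable C -> C `<=` B -> bounded_borel B -> bounded_borel C.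
Proof.
move=> mC CB /bounded_borelP[mB [N BN]]; apply/bounded_borelP; split => //.
by exists N; exact: subset_trans BN.
Qed.

Lemma bounded_borelU B C : bounded_borel B -> bounded_borel C -> bounded_borel (B `|` C).
Proof.
move=> /bounded_borelP[mB [N BN]] /bounded_borelP[mC [N' CN]].
apply/bounded_borelP; split; first exact: measurableU.
exists (Num.max N N') => x /= [/BN|/CN]; rewrite /= !in_itv/= le_max.
  by move=> /andP[-> ->].
by move=> /andP[-> ->]; rewrite orbT.
Qed.

Lemma bounded_borel0 : bounded_borel (set0 : set R).
Proof. by apply/bounded_borelP; split => //; exists 0. Qed.

Lemma bounded_borel_fin B : bounded_borel B ->
  (lebesgue_measure (B : set (measurableTypeR R)) < +oo)%E.
Proof.
move=> /bounded_borelP[mB [N BN]].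
apply: (@le_lt_trans _ _ (lebesgue_measure (`[0, N]%classic : set R))).
  by apply: le_measure; rewrite ?inE.
by rewrite lebesgue_measure_itv; case: ifP => // _; rewrite -EFinB ltry.
Qed.

Definition leb B : R := fine (lebesgue_measure B).

Lemma leb_ge0 B : 0 <= leb B.
Proof. by rewrite fine_ge0. Qed.

Lemma EFin_leb B : bounded_borel B -> (leb B)%:E = lebesgue_measure B.
Proof. by move=> bB; rewrite fineK// ge0_fin_numE// bounded_borel_fin. Qed.

Lemma lebU B C : bounded_borel B -> bounded_borel C -> B `&` C = set0 ->
  leb (B `|` C) = leb B + leb C.
Proof.
move=> bB bC BC; have [mB _ _] := bB; have [mC _ _] := bC.
apply: EFin_inj; rewrite EFinD !EFin_leb//; last exact: bounded_borelU.
by rewrite measureU.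
Qed.

Lemma leb_itvoc (s t : R) : s <= t -> leb `]s, t] = t - s.
Proof.
rewrite /leb lebesgue_measure_itv/= lte_fin le_eqVlt => /predU1P[->|st].
  by rewrite ltxx subrr.
by rewrite st.
Qed.

End BoundedBorel.

Section InducedMeasure.
Context {R : realType} {d : nat} {dO : measure_display} {Omega : measurableType dO}.
Variables (P : probability Omega R) (k : 'I_d).
Variables (X : R -> {RV P >-> 'rV[R]_d}) (M : set R -> {RV P >-> 'rV[R]_d}).
Hypothesis indM : is_induced_measure X M.

Lemma induced_sigma_additive (B : nat -> set R) :
  (forall n, bounded_borel (B n)) -> trivIset setT B ->
  bounded_borel (\bigcup_n B n) ->
  {ae P, forall w, (\sum_(i < n) M (B i) w 0 k) @[n --> \oo] -->
     M (\bigcup_n B n) w 0 k}.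
Proof.
move=> bB tB bU; have [_ h _ _] := indM.
apply: filterS (h B bB tB bU) => w /= hw.
rewrite (_ : (fun n => _) = (fun n => series (fun i => M (B i) w) n 0 k)).
  move=> A hA; have hA' := @coord_continuous R 1 d 0 k _ A hA.
  exact: (hw _ hA').
by apply/funext => n; rewrite /series/= summxE big_mkord.
Qed.

(** The sequence of empty sets is disjoint, so the series with constant term
    M set0 converges almost surely, which forces that term to vanish. *)
Lemma induced_set0 : {ae P, forall w, M set0 w 0 k = 0}.
Proof.
have := @induced_sigma_additive (fun=> set0) (fun=> bounded_borel0).
rewrite bigcup0// => /(_ (@trivIset_set0 _ _ _) bounded_borel0).
apply: filterS => w h.
pose u n : R := \sum_(i < n) M set0 w 0 k.
have uh : u n @[n --> \oo] --> M set0 w 0 k by exact: h.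
have uhS : u n.+1 @[n --> \oo] --> M set0 w 0 k by rewrite (cvg_shiftS u).
have h0 : (fun n => u n.+1 - u n) n @[n --> \oo] --> M set0 w 0 k - M set0 w 0 k.
  exact: cvgB.
have e : (fun n => u n.+1 - u n) = (fun=> M set0 w 0 k).
  by apply/funext => n; rewrite /u big_ord_recr/= addrAC subrr add0r.
rewrite e subrr in h0.
exact: (cvg_unique _ (cvg_cst _) h0).
Qed.

Lemma induced_additive (B C : set R) : bounded_borel B -> bounded_borel C ->
  B `&` C = set0 ->
  {ae P, forall w, M (B `|` C) w 0 k = M B w 0 k + M C w 0 k}.
Proof.
move=> bB bC BC; have := @induced_sigma_additive (bigcup2 B C).
rewrite bigcup2E -trivIset_bigcup2 => /(_ _ BC (bounded_borelU bB bC)) [].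
  by move=> [|[|n]]//=; exact: bounded_borel0.
move=> N1 [mN1 N10 sN1]; have [N2 [mN2 N20 sN2]] := induced_set0.
exists (N1 `|` N2); split; first exact: measurableU.
  by rewrite null_set_setU.
move=> w /= hw; apply: contrapT => nw; apply: hw.
have h0 : M set0 w 0 k = 0.
  by apply: contrapT => hh; apply: nw; right; apply: sN2.
have h1 : (\sum_(i < n) M (bigcup2 B C i) w 0 k) @[n --> \oo] --> M (B `|` C) w 0 k.
  by apply: contrapT => hh; apply: nw; left; apply: sN1.
have h2 : (\sum_(i < n) M (bigcup2 B C i) w 0 k) @[n --> \oo] --> M B w 0 k + M C w 0 k.
  rewrite -(cvg_shiftn 2) /=.
  rewrite (_ : (fun n => _) = cst (M B w 0 k + M C w 0 k)); first exact: cvg_cst.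
  apply/funext => n; rewrite addn2 !big_ord_recl/= big1 ?addr0//.
exact: cvg_unique h1 h2.
Qed.

Lemma charf_induced_prod n (B : 'I_n -> set R) (v : 'I_n -> R) :
  (forall i, bounded_borel (B i)) -> trivIset setT B ->
  charf P (fun w => \sum_(i < n) v i * M (B i) w 0 k) =
  \prod_(i < n) charf P (fun w => v i * M (B i) w 0 k).
Proof.
move=> bB tB; have [h _ _ _] := indM.
by apply: (@charf_sum_coord _ _ _ _ _ k _ (fun i => M (B i))); exact: h.
Qed.

Lemma charf_inducedU (B C : set R) v : bounded_borel B -> bounded_borel C ->
  B `&` C = set0 ->
  charf P (fun w => v * M (B `|` C) w 0 k) =
  charf P (fun w => v * M B w 0 k) * charf P (fun w => v * M C w 0 k).
Proof.
move=> bB bC BC; pose D (i : 'I_2) := if i == 0 then B else C.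
have := @charf_induced_prod 2 D (fun=> v).
rewrite !big_ord_recl big_ord0 mulr1 /D/= => <-.
- apply: ae_eq_charf.
  + exact: measurable_scaled_coord.
  + by apply: measurable_sum => i; exact: measurable_scaled_coord.
  apply: filterS (induced_additive bB bC BC) => w ->.
  by rewrite !big_ord_recl big_ord0 addr0/= mulrDr.
- by move=> i; rewrite /D; case: ifP.
- apply/trivIsetP => i j _ _; rewrite /D.
  case: (unliftP 0 i) => [i'|] ->; case: (unliftP 0 j) => [j'|] ->//=.
  + by rewrite !ord1 eqxx.
  + by rewrite setIC.
Qed.

Hypothesis levyX : is_levy_process X.
Variables a b : R -> R.
Hypotheses (ca : continuous a) (cb : continuous b) (a0 : a 0 = 0) (b0 : b 0 = 0).
Hypothesis char1 : forall v, charf P (fun w => v * X 1 w 0 k) = cexp (a v +i* b v).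

Let E (l v : R) := cexp ((l * a v) +i* (l * b v)).

Let E0 v : E 0 v = 1.
Proof. by rewrite /E !mul0r cexp0. Qed.

Let ED l l' v : E (l + l') v = E l v * E l' v.
Proof. by rewrite /E -cexpD; congr cexp; simpc; congr (_ +i* _); ring. Qed.

Let charf_set0 v : charf P (fun w => v * M set0 w 0 k) = 1.
Proof.
rewrite -(charf_cst0 P); apply: ae_eq_charf => //.
  exact: measurable_scaled_coord.
by apply: filterS induced_set0 => w ->; rewrite mulr0.
Qed.

Let charf_itv (s t v : R) : 0 <= s -> s <= t ->
  charf P (fun w => v * M `]s, t]%classic w 0 k) = E (t - s) v.
Proof.
move=> s0; rewrite le_eqVlt => /predU1P[->|st].
  by rewrite set_itvoc0 charf_set0 subrr E0.
have [_ _ h _] := indM; have [_ _ Xs _ _] := levyX.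
have ts0 : 0 <= t - s by rewrite subr_ge0 ltW.
rewrite /E -(charf_levy levyX ca cb a0 b0 char1)//.
transitivity (charf P (fun w => v * (X t w - X s w) 0 k)).
  apply: ae_eq_charf; first exact: measurable_scaled_coord.
    by apply: measurable_scaled_coord; exact: measurable_rV_sub.
  by apply: filterS (h s t s0 st) => w ->.
apply: eq_law_charf.
- by apply: measurable_scaled_coord; exact: measurable_rV_sub.
- exact: measurable_scaled_coord.
move=> A mA; pose B := [set x : 'rV[R]_d | A (v * x 0 k)].
have := Xs s (t - s) s0 ts0 B; rewrite addrC subrK; apply.
rewrite -[X in measurable X]setTI.
have mf : measurable_fun [set: 'rV[R]_d] (fun x => v * x 0 k).
  by apply: measurable_funM => //; exact: measurable_coord.
exact: mf.
Qed.

(** The half-lines ]x, +oo[ are a pi-system generating the Borel sets. Complements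
    are handled by dividing out a factor that never vanishes, disjoint unions by
    countable additivity. *)
Let charf_in_itv (N v : R) (S : set R) : 0 <= N -> measurable S ->
  charf P (fun w => v * M (S `&` `]0, N]%classic) w 0 k) =
  E (leb (S `&` `]0, N]%classic)) v.
Proof.
move=> N0 mS; pose I := `]0, N]%classic : set R.
have bI S' : measurable S' -> bounded_borel (S' `&` I).
  move=> mS'; apply/bounded_borelP; split; first exact: (measurableI _ _ mS' (measurable_itv _)).
  by exists N => x [_]; rewrite /I /= !in_itv/= => /andP[/ltW -> ->].
have mE : @measurable _ (measurableTypeR R) = <<s @RGenOInfty.G R >>.
  exact: RGenOInfty.measurableE.
have {}mS : <<s @RGenOInfty.G R >> S by rewrite -mE.
move: S mS; apply: (dynkin_induction mE).
- move=> _ _ [x ->] [y ->]; exists (Num.max x y).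
  apply/seteqP; split => z /=; rewrite !in_itv/= !andbT gt_max.
    by move=> [-> ->].
  by move=> /andP[].
- by rewrite setTI charf_itv// leb_itvoc.
- move=> _ [x ->].
  have -> : `]x, +oo[%classic `&` I = `](Num.max x 0), (Num.max N (Num.max x 0))]%classic :> set R.
    apply/seteqP; split => z; rewrite /I /= !in_itv/= ?andbT gt_max le_max.
      by move=> [-> /andP[-> ->]].
    move=> /andP[/andP[xz z0]] /orP[zN|]; first by rewrite xz z0 zN.
    by rewrite le_max !leNgt xz z0.
  have m0 : 0 <= Num.max x 0 by rewrite le_max lexx orbT.
  have mm : Num.max x 0 <= Num.max N (Num.max x 0) by rewrite le_max lexx orbT.
  by rewrite charf_itv// leb_itvoc.
- move=> S mS ih.
  have IE : I = (S `&` I) `|` (~` S `&` I) by rewrite -setIUl setUv setTI.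
  have dis : (S `&` I) `&` (~` S `&` I) = set0.
    by rewrite setIACA setICr set0I.
  have b1 := bI _ mS; have b2 := bI _ (measurableC mS).
  have := charf_inducedU v b1 b2 dis; rewrite -IE charf_itv// ih -(leb_itvoc N0).
  have -> : leb `]0, N]%classic = leb (S `&` I) + leb (~` S `&` I).
    by rewrite -lebU// -IE.
  rewrite ED => h.
  have nz : E (leb (S `&` I)) v != 0 by exact: cexp_neq0.
  by apply: (mulfI nz); rewrite -h.
- move=> F mF tF ih.
  have UE : (\bigcup_n F n) `&` I = \bigcup_n (F n `&` I) by rewrite setI_bigcupl.
  have tFI : trivIset setT (fun n => F n `&` I).
    by apply: trivIset_setIr.
  have bF n : bounded_borel (F n `&` I) by exact: (bI _ (mF n)).
  have bU : bounded_borel (\bigcup_n (F n `&` I)).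
    by rewrite -UE; exact: (bI _ (bigcup_measurable (fun n _ => mF n))).
  rewrite UE.
  have c1 : ccvg \oo (fun n => charf P (fun w => \sum_(i < n) v * M (F i `&` I) w 0 k))
      (charf P (fun w => v * M (\bigcup_n (F n `&` I)) w 0 k)).
    apply: charf_cvg_ae.
    + by move=> n; apply: measurable_sum => i; exact: measurable_scaled_coord.
    + exact: measurable_scaled_coord.
    apply: filterS (induced_sigma_additive bF tFI bU) => w h.
    rewrite (_ : (fun n => _) = (fun n => v * \sum_(i < n) M (F i `&` I) w 0 k)).
      by apply: cvgM => //; exact: cvg_cst.
    by apply/funext => n; rewrite mulr_sumr.
  have sl : (\sum_(i < n) leb (F i `&` I)) @[n --> \oo] --> leb (\bigcup_n (F n `&` I)).
    apply: (@fine_cvg R _ _ _ (fun n => (\sum_(i < n) leb (F i `&` I))%:E)).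
    rewrite EFin_leb//.
    have mFI n : measurable (F n `&` I) by have [] := bF n.
    have mU : measurable (\bigcup_n (F n `&` I)) by have [] := bU.
    have h : (\sum_(0 <= i < n) lebesgue_measure (F i `&` I))%E @[n --> \oo] -->
        lebesgue_measure (\bigcup_n (F n `&` I)).
      exact: (@measure_semi_sigma_additive _ _ _ (@lebesgue_measure R) _ mFI tFI mU).
    apply: cvg_trans h; apply: near_eq_cvg; apply: nearW => n /=.
    by rewrite big_mkord -sumEFin; apply: eq_bigr => i _; rewrite EFin_leb.
  have c2 : ccvg \oo (fun n => charf P (fun w => \sum_(i < n) v * M (F i `&` I) w 0 k))
      (E (leb (\bigcup_n (F n `&` I))) v).
    apply: (@eq_ccvg _ _ _ (fun n => E (\sum_(i < n) leb (F i `&` I)) v)).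
      move=> n; rewrite (charf_induced_prod (B := fun i => F i `&` I) (fun=> v))//.
        rewrite (eq_bigr (fun i : 'I_n => E (leb (F i `&` I)) v)) => [|i _]; last exact: ih.
        elim/big_rec2 : _ => [|i x y _ <-]; first by rewrite E0.
        by rewrite ED.
      apply/trivIsetP => i j _ _ ij; move/trivIsetP : tFI; apply => //.
    by apply: ccvg_cexp; apply: cvgM => //; exact: cvg_cst.
  exact: ccvg_unique c1 c2.
Qed.

Lemma charf_induced (B : set R) (v : R) : bounded_borel B ->
  charf P (fun w => v * M B w 0 k) = cexp ((leb B * a v) +i* (leb B * b v)).
Proof.
move=> bB; have /bounded_borelP[mB [N BN]] := bB.
(* half-open intervals miss the time 0, which carries no mass *)
pose N' := Num.max N 0; have N0 : 0 <= N' by rewrite le_max lexx orbT.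
pose B1 := B `&` `]0, N']%classic; pose B2 := B `&` [set 0].
have mB1 : measurable B1 by exact: measurableI.
have mB2 : measurable B2 by exact: measurableI.
have bB1 : bounded_borel B1 by apply: bounded_borelS bB => // x [].
have bB2 : bounded_borel B2 by apply: bounded_borelS bB => // x [].
have BE : B = B1 `|` B2.
  apply/seteqP; split => [x Bx|x [[]|[]]//].
  have := BN x Bx; rewrite /= in_itv/= le_eqVlt => /andP[/predU1P[x0 _|x0 xN]].
    by right; split.
  by left; split => //=; rewrite in_itv/= x0 le_max xN.
have dis : B1 `&` B2 = set0.
  apply/seteqP; split => // x [[_ +] [_ /= x0]].
  by rewrite x0/= in_itv/= ltxx.
have [_ _ _ M0] := indM.
have l2 : leb B2 = 0.
  rewrite /leb; have -> // : lebesgue_measure B2 = 0%E.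
  apply/eqP; rewrite -measure_le0 -(lebesgue_measure_set1 0).
  by apply: le_measure; rewrite ?inE// => x [].
have c2 : charf P (fun w => v * M B2 w 0 k) = 1.
  have [B0|B0] := pselect (B 0).
    have -> : B2 = [set 0] by apply/seteqP; split => [x []//|x /= ->]; split.
    rewrite -(charf_cst0 P); apply: ae_eq_charf => //.
      exact: measurable_scaled_coord.
    by apply: filterS M0 => w ->; rewrite mxE mulr0.
  have -> : B2 = set0; last exact: charf_set0.
  by apply/seteqP; split => // x [Bx /= x0]; apply: B0; rewrite -x0.
by rewrite BE charf_inducedU// lebU// l2 c2 mulr1 addr0; exact: charf_in_itv.
Qed.

End InducedMeasure.

(** * Integrals of simple functions *)

Section LebesgueOnBounded.
Context {R : realType}.

Lemma integrable_bounded_borel (B : set R) (f : R -> R) (K : R) :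
  bounded_borel B -> measurable_fun B f -> (forall s, B s -> `|f s| <= K) ->
  lebesgue_measure.-integrable B (EFin \o f).
Proof.
move=> bB mf fK; have [mB _ _] := bB.
apply: measurable_bounded_integrable => //; first exact: bounded_borel_fin.
exists K; split; first exact: num_real.
by move=> x Kx s Bs /=; rewrite (le_trans (fK s Bs))// ltW.
Qed.

Lemma leb_indic (B C : set R) : bounded_borel B -> measurable C ->
  \int[lebesgue_measure]_(s in B) \1_C s = leb (B `&` C).
Proof.
move=> [mB _ _] mC; rewrite /Rintegral /leb setIC; congr fine.
exact: integral_indic.
Qed.

Lemma sfun_levelE (g : {sfun R >-> R}) (F : R -> R) (s : R) :
  F (g s) = \sum_(c <- fset_set (range g)) F c * \1_(g @^-1` [set c]) s.
Proof.
have gs : g s \in fset_set (range g).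
  by rewrite in_fset_set; [rewrite inE; exists s|exact: fimfunP].
rewrite (bigD1_seq (g s)) ?finmap.fset_uniq// indicE mem_set//= mulr1 big1 ?addr0// => c cgs.
rewrite indicE memNset ?mulr0//= => gsc.
by move: cgs; rewrite gsc eqxx.
Qed.

Lemma integral_sfun_comp (B : set R) (g : {sfun R >-> R}) (F : R -> R) :
  bounded_borel B ->
  \int[lebesgue_measure]_(s in B) F (g s) =
  \sum_(c <- fset_set (range g)) leb (B `&` g @^-1` [set c]) * F c.
Proof.
move=> bB; have [mB _ _] := bB.
under eq_Rintegral do rewrite sfun_levelE.
have mg c : measurable (g @^-1` [set c]) by exact: measurable_sfunP.
have i1 c : lebesgue_measure.-integrable B (EFin \o (\1_(g @^-1` [set c]) : R -> R)).
  apply: (@integrable_bounded_borel _ _ 1) => //.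
  by move=> s _; rewrite indicE; case: (_ \in _); rewrite ?normr1 ?normr0.
rewrite Rintegral_sum//.
  by apply: eq_bigr => c _; rewrite RintegralZl// leb_indic// mulrC.
move=> c; apply: (@integrable_bounded_borel _ _ `|F c|) => //.
- by apply: measurable_funM => //; apply: measurable_funTS; exact: measurable_indic.
- move=> s _; rewrite normrM ler_piMr// indicE.
  by case: (_ \in _); rewrite ?normr1 ?normr0.
Qed.

End LebesgueOnBounded.

Section SimpleIntegral.
Context {R : realType} {d : nat} {dO : measure_display} {Omega : measurableType dO}.
Variables (P : probability Omega R) (k : 'I_d).
Variables (X : R -> {RV P >-> 'rV[R]_d}) (M : set R -> {RV P >-> 'rV[R]_d}).
Hypothesis indM : is_induced_measure X M.
Hypothesis levyX : is_levy_process X.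
Variables a b : R -> R.
Hypotheses (ca : continuous a) (cb : continuous b) (a0 : a 0 = 0) (b0 : b 0 = 0).
Hypothesis char1 : forall v, charf P (fun w => v * X 1 w 0 k) = cexp (a v +i* b v).

Lemma simple_integralE (g : {sfun R >-> R}) (B : set R) w :
  simple_integral M g B w 0 k =
  \sum_(c <- fset_set (range g)) c * M (B `&` g @^-1` [set c]) w 0 k.
Proof.
rewrite /simple_integral fsbig_finite/=; last exact: fimfunP.
by rewrite summxE; apply: eq_bigr => c _; rewrite mxE.
Qed.

Lemma measurable_simple_integral (g : {sfun R >-> R}) (B : set R) :
  measurable_fun setT (simple_integral M g B).
Proof.
apply: measurable_fun_mx => i j; rewrite (ord1 i).
have -> : (fun w => simple_integral M g B w 0 j) = fun w =>
    \sum_(c <- fset_set (range g)) c * M (B `&` g @^-1` [set c]) w 0 j.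
  apply/funext => w; rewrite /simple_integral fsbig_finite/=; last exact: fimfunP.
  by rewrite summxE; apply: eq_bigr => c _; rewrite mxE.
by apply: measurable_sum => c; exact: measurable_scaled_coord.
Qed.

(** The random measure is independent over the level sets of g, and each of them
    contributes its Lebesgue measure as an exponent. *)
Lemma charf_simple_integral (g : {sfun R >-> R}) (B : set R) (v : R) :
  bounded_borel B ->
  charf P (fun w => v * simple_integral M g B w 0 k) =
  cexp ((\int[lebesgue_measure]_(s in B) a (v * g s)) +i*
        (\int[lebesgue_measure]_(s in B) b (v * g s))).
Proof.
move=> bB; have [mB _ _] := bB.
rewrite (integral_sfun_comp g (fun c => a (v * c)) bB).
rewrite (integral_sfun_comp g (fun c => b (v * c)) bB).
set r := enum_fset (fset_set (range g)).
have ur : uniq r by exact: finmap.fset_uniq.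
pose C c := B `&` g @^-1` [set c].
have mg c : measurable (g @^-1` [set c]) by exact: measurable_sfunP.
have bC c : bounded_borel (C c).
  by apply: bounded_borelS bB => //; [exact: measurableI|move=> x []].
have -> : (fun w => v * simple_integral M g B w 0 k) =
    (fun w => \sum_(i < size r) (v * r`_i) * M (C r`_i) w 0 k).
  apply/funext => w; rewrite simple_integralE mulr_sumr -/r (big_nth 0) big_mkord.
  by apply: eq_bigr => i _; rewrite mulrA.
rewrite (charf_induced_prod (B := fun i : 'I_(size r) => C r`_i) k indM (fun i => v * r`_i))//; last first.
  apply/trivIsetP => i j _ _ ij; apply/seteqP; split => // x [[_ /= gi] [_ /= gj]].
  move/negP : ij; apply; apply/eqP/val_inj/eqP.
  by rewrite -(nth_uniq 0 (ltn_ord i) (ltn_ord j) ur) -gi -gj.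
have sE (F : R -> R) : \sum_(c <- r) F c = \sum_(i < size r) F r`_i.
  by rewrite (big_nth 0) big_mkord.
rewrite !sE.
rewrite (eq_bigr (fun i : 'I_(size r) => cexp ((leb (C r`_i) * a (v * r`_i)) +i*
    (leb (C r`_i) * b (v * r`_i))))) => [|i _]; last first.
  by rewrite (charf_induced indM levyX ca cb a0 b0 char1).
rewrite -cexp_sum; congr cexp.
elim/big_rec3 : _ => // i x y z _ ->.
by case: z.
Qed.

End SimpleIntegral.

(** * Pointwise limits of multiplicative set functions *)

Section Nikodym.
Context {R : realType}.
Local Notation normc := (@Normc.normc R).
Variables (phi : nat -> set nat -> R[i]) (psi : set nat -> R[i]) (kappa : R).
Let tail m : set nat := [set i | (m <= i)%N].
Let head m : set nat := [set i | (i < m)%N].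
Hypothesis phiU : forall n S T, S `&` T = set0 -> phi n (S `|` T) = phi n S * phi n T.
Hypothesis phi1 : forall n S, normc (phi n S) <= 1.
Hypothesis phi_tail : forall n (e : R), 0 < e ->
  exists m, forall S, S `<=` tail m -> normc (phi n S - 1) <= e.
Hypothesis phi_cvg : forall S, ccvg \oo (phi ^~ S) (psi S).
Hypothesis kappa0 : 0 < kappa.
Hypothesis psi_head : forall m S, S `<=` head m -> kappa <= normc (psi S).

Let normcB (x y z : R[i]) : normc (x - z) <= normc (x - y) + normc (y - z).
Proof.
have -> : x - z = (x - y) + (y - z) by rewrite addrA subrK.
exact: le_normcD.
Qed.

Let normcBC (x y : R[i]) : normc (x - y) = normc (y - x).
Proof. by rewrite -opprB; exact: (@normcN R). Qed.

Let nc0 (x : R[i]) : 0 <= normc x.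
Proof. by case: x => ? ?; exact: sqrtr_ge0. Qed.

Let split_set m (S : set nat) : S = (S `&` head m) `|` (S `&` tail m).
Proof.
apply/seteqP; split => [i Si|i [[]|[]]//].
by have [im|mi] := ltnP i m; [left|right].
Qed.

Let headI_tailI m (S T : set nat) : (S `&` head m) `&` (T `&` tail m) = set0.
Proof.
apply/seteqP; split => // i [[_ im] [_ mi]].
by move: im; rewrite /head/= ltnNge mi.
Qed.

(** One step of a gliding hump: only finitely many indices matter to phi n and
    phi p up to a small error, so the discrepancy between them at S `|` T is
    already present at a finite set S', and survives, halved, whatever is added
    far away. *)
Let hump (e : R) : 0 < e ->
  (forall m S p, S `<=` head m -> exists n T, [/\ (p <= n)%N, T `<=` tail m &
     e < normc (phi n (S `|` T) - phi p (S `|` T))]) ->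
  forall m S p, S `<=` head m -> exists m' S' n,
   [/\ (m < m')%N, S' `<=` head m', S' `&` head m = S, (p <= n)%N &
    forall T, T `<=` tail m' -> e / 2 < normc (phi n (S' `|` T) - phi p (S' `|` T))].
Proof.
move=> e0 H m S p Sm; have [n [T [pn Tm ne]]] := H m S p Sm.
have e8 : 0 < e / 8 by rewrite divr_gt0.
have [m1 h1] := phi_tail n e8; have [m2 h2] := phi_tail p e8.
pose m' := (maxn m.+1 (maxn m1 m2)).
have mm' : (m < m')%N by rewrite /m' leq_max leqnn.
have m1m' : (m1 <= m')%N by rewrite /m' !leq_max leqnn !orbT.
have m2m' : (m2 <= m')%N by rewrite /m' !leq_max leqnn !orbT.
pose S' := (S `|` T) `&` head m'.
exists m', S', n; split => //.
- by move=> i [].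
- apply/seteqP; split => [i [[[//|Ti] _] im]|i Si].
    by have := Tm i Ti; rewrite /tail/= leqNgt (im : (i < m)%N).
  split; last exact: Sm.
  by split; [left|exact: (leq_trans (Sm i Si) (ltnW mm'))].
move=> T' T'm'.
have close q (m3 : nat) : (m3 <= m')%N ->
    (forall S, S `<=` tail m3 -> normc (phi q S - 1) <= e / 8) ->
    normc (phi q (S `|` T) - phi q (S' `|` T')) <= e / 4.
  move=> m3m' h3.
  rewrite (split_set m' (S `|` T)) phiU ?headI_tailI// -/S'.
  have -> : phi q (S' `|` T') = phi q S' * phi q T'.
    rewrite phiU//; apply/seteqP; split => // i [[_ im] /T'm'].
    by rewrite /tail/= leqNgt (im : (i < m')%N).
  rewrite -mulrBr Normc.normcM.
  have st : tail m' `<=` tail m3 by move=> i; exact: leq_trans.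
  rewrite (@le_trans _ _ (1 * (e / 8 + e / 8)))//; last by lra.
  rewrite ler_pM//.
  rewrite (le_trans (normcB _ 1 _))// lerD//.
    by apply: h3 => i [_ /st].
  by rewrite normcBC; apply: h3 => i /T'm' /st.
have c1 := close n m1 m1m' h1; have c2 := close p m2 m2m' h2.
have := normcB (phi n (S `|` T)) (phi n (S' `|` T')) (phi p (S `|` T)).
have := normcB (phi n (S' `|` T')) (phi p (S' `|` T')) (phi p (S `|` T)).
rewrite (normcBC (phi p (S' `|` T'))).
by move: ne c1 c2; lra.
Qed.

(** If the phi n were not uniformly Cauchy above any initial segment S, iterating
    the hump would build one set at which phi n does not converge. *)
Let uniform (e : R) : 0 < e -> exists m S p, S `<=` head m /\
  forall n T, (p <= n)%N -> T `<=` tail m ->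
    normc (phi n (S `|` T) - phi p (S `|` T)) <= e.
Proof.
move=> e0; apply: contrapT => H.
have {}H m S p : S `<=` head m -> exists n T, [/\ (p <= n)%N, T `<=` tail m &
     e < normc (phi n (S `|` T) - phi p (S `|` T))].
  move=> Sm; apply: contrapT => H'; apply: H; exists m, S, p; split => // n T pn Tm.
  by rewrite leNgt; apply/negP => h; apply: H'; exists n, T.
have step := hump e0 H.
pose good (x y : nat * set nat * nat) := x.1.2 `<=` head x.1.1 ->
  [/\ (x.1.1 < y.1.1)%N, y.1.2 `<=` head y.1.1, y.1.2 `&` head x.1.1 = x.1.2,
    y.2 = x.2.+1 & exists2 n, (x.2 <= n)%N &
    forall T, T `<=` tail y.1.1 ->
      e / 2 < normc (phi n (y.1.2 `|` T) - phi x.2 (y.1.2 `|` T))].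
have /choice[next nextP] : forall x, exists y, good x y.
  move=> [[m S] p]; have [Sm|nSm] := pselect (S `<=` head m); last by exists (m, S, p).
  have [m' [S' [n [h1 h2 h3 h4 h5]]]] := step m S p Sm.
  by exists (m', S', p.+1) => _; split => //; exists n.
pose x i := iter i next (0%N, set0, 0%N).
have xS i : x i.+1 = next (x i) by [].
have inv i : (x i).1.2 `<=` head (x i).1.1.
  elim: i => [|i ih]; first by [].
  by have [] := nextP (x i) ih.
have nx i := nextP (x i) (inv i).
have x2 i : (x i).2 = i.
  by elim: i => // i ih; have [_ _ _ + _] := nx i; rewrite -xS ih.
have xm i j : (i <= j)%N -> ((x i).1.1 <= (x j).1.1)%N.
  elim: j => [|j ih]; first by rewrite leqn0 => /eqP ->.
  rewrite leq_eqVlt => /predU1P[->//|]; rewrite ltnS => /ih h.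
  by have [h' _ _ _ _] := nx j; rewrite (leq_trans h)// ltnW.
have xI i j : (i <= j)%N -> (x j).1.2 `&` head (x i).1.1 = (x i).1.2.
  elim: j => [|j ih].
    by rewrite leqn0 => /eqP ->; apply/setIidPl; exact: inv.
  rewrite leq_eqVlt => /predU1P[->|]; first by apply/setIidPl; exact: inv.
  rewrite ltnS => ij; rewrite -(ih ij); have [_ _ <- _ _] := nx j.
  rewrite -setIA; congr (_ `&` _); apply/esym/setIidPr => l.
  by rewrite /head/= => li; rewrite (leq_trans li)// xm.
pose S := \bigcup_i (x i).1.2.
have SE i : exists2 T, T `<=` tail (x i).1.1 & S = (x i).1.2 `|` T.
  exists (S `&` tail (x i).1.1); first by move=> l [].
  rewrite {1}(split_set (x i).1.1 S); congr (_ `|` _).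
  apply/seteqP; split => [l [[j _ xjl] il]|l xil]; last first.
    by split; [exists i|exact: inv].
  have [ij|/ltnW ji] := leqP i j; first by rewrite -(xI i j ij).
  by have := xI j i ji; move: xjl => /[swap] <- [].
have e8 : 0 < e / 8 by rewrite divr_gt0.
have /ccvg_normcP/(_ _ e8)[N _ hN] := phi_cvg S.
have [_ _ _ _ [n]] := nx N; rewrite x2 -xS => Nn.
have [T TN ST] := SE N.+1; move=> /(_ T TN); rewrite -ST.
have := hN n Nn; have := hN N (leqnn N) => /=.
have := normcB (phi n S) (psi S) (phi N S).
rewrite (normcBC (psi S)); lra.
Qed.

Lemma mult_limitU S T : S `&` T = set0 -> psi (S `|` T) = psi S * psi T.
Proof.
move=> ST; apply: (ccvg_unique (phi_cvg (S `|` T))).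
apply: (@eq_ccvg _ _ _ (fun n => phi n S * phi n T)).
  by move=> n; rewrite phiU.
by apply: ccvgM; exact: phi_cvg.
Qed.

(** A multiplicative Vitali-Hahn-Saks theorem: pointwise limits inherit continuity
    at the empty set. Uniformity controls psi (S `|` T) = psi S * psi T for one
    finite S only; the lower bound kappa on psi S allows to divide by it. *)
Lemma mult_limit_tail (e : R) : 0 < e ->
  exists m, forall T, T `<=` tail m -> normc (psi T - 1) <= e.
Proof.
move=> e0; pose e' := kappa * e / 5.
have e'0 : 0 < e' by rewrite divr_gt0// mulr_gt0.
have [m [S [p [Sm h]]]] := uniform e'0.
have [m2 h2] := phi_tail p e'0.
exists (maxn m m2) => T TT.
have Tm : T `<=` tail m by move=> i /TT; rewrite /tail/= geq_max => /andP[].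
have Tm2 : T `<=` tail m2 by move=> i /TT; rewrite /tail/= geq_max => /andP[].
have lim T' : T' `<=` tail m -> normc (psi (S `|` T') - phi p (S `|` T')) <= 2 * e'.
  move=> T'm; have /ccvg_normcP/(_ _ e'0)[N _ hN] := phi_cvg (S `|` T').
  have h1 := hN (maxn N p) (leq_maxl _ _).
  have h3 := h (maxn N p) T' (leq_maxr _ _) T'm.
  have := normcB (psi (S `|` T')) (phi (maxn N p) (S `|` T')) (phi p (S `|` T')).
  by move: h1 h3 => /=; rewrite (normcBC (psi _) (phi (maxn N p) _)); lra.
have dis : S `&` T = set0.
  by apply/seteqP; split => // i [/Sm + /Tm]; rewrite /head/tail/= ltnNge => /negP.
have l1 := lim T Tm; have l2 := lim set0 (@sub0set _ _).
rewrite setU0 in l2; rewrite mult_limitU// phiU// in l1.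
have l3 : normc (phi p S * (phi p T - 1)) <= e'.
  rewrite Normc.normcM -[leRHS]mul1r ler_pM//; exact: h2.
have l4 : normc (psi S * (psi T - 1)) <= 5 * e'.
  have -> : psi S * (psi T - 1) = (psi S * psi T - phi p S * phi p T) +
      (phi p S * (phi p T - 1) + (phi p S - psi S)) by ring.
  have n1 := @le_normcD R (psi S * psi T - phi p S * phi p T)
    (phi p S * (phi p T - 1) + (phi p S - psi S)).
  have n2 := @le_normcD R (phi p S * (phi p T - 1)) (phi p S - psi S).
  by move: n1 n2 l1 l2 l3; rewrite (normcBC (phi p S)); lra.
rewrite Normc.normcM in l4.
have l5 : kappa * normc (psi T - 1) <= kappa * e.
  rewrite (@le_trans _ _ (5 * e'))//; last by rewrite /e'; lra.
  apply: le_trans l4; rewrite ler_wpM2r//; exact: (psi_head Sm).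
by rewrite ler_pM2l in l5.
Qed.

End Nikodym.

(** * Integrals of bounded functions *)

Lemma cexp_near1 {R : realType} (e : R) : 0 < e -> exists2 dl : R, 0 < dl &
  forall x y, `|x| <= dl -> `|y| <= dl -> Normc.normc (cexp (x +i* y) - 1) <= e.
Proof.
move=> e0.
have h : ccvg (nbhs ((0 : R), (0 : R))) (fun p : R * R => cexp (p.1 +i* p.2)) (cexp 0).
  by apply: ccvg_cexp; [exact: cvg_fst|exact: cvg_snd].
have := (ccvg_normcP _ _).1 h e e0; rewrite cexp0 => -[[A B] /= [nA nB] AB].
move/nbhs_ballP : nA => [r r0 rA]; move/nbhs_ballP : nB => [s s0 sB].
exists (Num.min r s / 2); first by rewrite divr_gt0// lt_min r0.
have ms : Num.min r s / 2 < Num.min r s.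
  by rewrite ltr_pdivrMr// ltr_pMr ?lt_min ?r0//; lra.
move=> x y xd yd; apply: (AB (x, y)); split => /=.
  apply: rA; rewrite /ball/= sub0r normrN.
  by rewrite (le_lt_trans xd)// (lt_le_trans ms)// ge_min lexx.
apply: sB; rewrite /ball/= sub0r normrN.
by rewrite (le_lt_trans yd)// (lt_le_trans ms)// ge_min lexx orbT.
Qed.

Lemma continuous_bounded_itv {R : realType} (h : R -> R) (r : R) : continuous h ->
  exists2 K, 0 <= K & forall x, `|x| <= r -> `|h x| <= K.
Proof.
move=> ch; have [r0|r0] := leP 0 r; last first.
  exists 0 => // x xr; have := le_lt_trans xr r0.
  by rewrite ltNge normr_ge0.
have Nr : - r <= r by lra.
have [c _ cM] := EVT_max Nr (f := fun x => `|h x|) (continuous_subspaceT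
  (fun x => continuous_comp (ch x) (@norm_continuous _ R^o (h x)))).
exists `|h c| => // x xr; apply: cM; by rewrite in_itv/= -ler_norml.
Qed.

Section BoundedIntegrand.
Context {R : realType}.

Lemma ae_lebS (Q Q' : R -> Prop) : (forall s, Q s -> Q' s) ->
  {ae lebesgue_measure, forall s : R, Q s} -> {ae lebesgue_measure, forall s : R, Q' s}.
Proof.
move=> QQ' [N [mN N0 QN]]; exists N; split => //.
by apply: subset_trans QN => s /=; apply: contra_not; exact: QQ'.
Qed.

Lemma Rintegral_bounded_le (B : set R) (f : R -> R) (K : R) :
  bounded_borel B -> measurable_fun B f -> (forall s, B s -> `|f s| <= K) ->
  `|\int[lebesgue_measure]_(s in B) f s| <= K * leb B.
Proof.
move=> bB mf fK; have [mB _ _] := bB.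
have i1 := integrable_bounded_borel bB mf fK.
rewrite (le_trans (le_normr_Rintegral _ _))//.
rewrite -Rintegral_cst//; apply: le_Rintegral => //.
- exact: integrable_norm.
- by apply: (@integrable_bounded_borel _ _ _ `|K|).
Qed.

(** A continuous h is bounded on the range of v * f_n, so a bound on the f_n
    themselves gives the domination. *)
Lemma bounded_convergence (B : set R) (f_ : nat -> R -> R) (f h : R -> R) (v r : R) :
  bounded_borel B -> continuous h ->
  (forall n, measurable_fun B (f_ n)) -> measurable_fun B f ->
  (forall n s, B s -> `|f_ n s| <= r) ->
  {ae lebesgue_measure, forall s, B s -> f_ n s @[n --> \oo] --> f s} ->
  \int[lebesgue_measure]_(s in B) h (v * f_ n s) @[n --> \oo] -->
  \int[lebesgue_measure]_(s in B) h (v * f s).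
Proof.
move=> bB ch mf_ mf f_r f_f; have [mB _ _] := bB.
have [K K0 hK] : exists2 K : R, 0 <= K & forall x, `|x| <= `|v| * r -> `|h x| <= K.
  exact: continuous_bounded_itv (`|v| * r) ch.
have mh : measurable_fun setT h by exact: continuous_measurable_fun.
have mcomp g : measurable_fun B g -> measurable_fun B (fun s => h (v * g s)).
  move=> mg; apply: (measurable_comp measurableT) => //.
  exact: measurable_funM.
have iK : lebesgue_measure.-integrable B (EFin \o (fun=> K : R)).
  by apply: (@integrable_bounded_borel _ _ _ K) => // s _; rewrite ger0_norm.
have bd n s : B s -> `|h (v * f_ n s)| <= K.
  by move=> Bs; apply: hK; rewrite normrM ler_wpM2l// f_r.
have mEh : measurable_fun B (fun s => (h (v * f s))%:E).
  by apply/measurable_EFinP; exact: mcomp.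
have mEh_ n : measurable_fun B (fun s => (h (v * f_ n s))%:E).
  by apply/measurable_EFinP; exact: mcomp.
have hf : {ae lebesgue_measure, forall s, B s ->
    (h (v * f_ n s))%:E @[n --> \oo] --> (h (v * f s))%:E}.
  apply: ae_lebS f_f => s hs Bs; apply: cvg_EFin; first exact: nearW.
  have vs : v * f_ n s @[n --> \oo] --> v * f s.
    by apply: cvgM; [exact: cvg_cst|exact: hs].
  exact: (continuous_cvg _ (ch _) vs).
have hK' : {ae lebesgue_measure, forall s n, B s ->
    (`|(h (v * f_ n s))%:E| <= (EFin \o (fun=> K : R)) s)%E}.
  by apply: aeW => s n Bs /=; rewrite lee_fin; exact: bd.
have [ih _ hh] := dominated_convergence (mu := lebesgue_measure) mB mEh_ mEh hf iK hK'.
by apply: fine_cvg; rewrite fineK; [exact: hh|exact: integrable_fin_num].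
Qed.

End BoundedIntegrand.

Section StochasticIntegral.
Context {R : realType} {d : nat} {dO : measure_display} {Omega : measurableType dO}.
Variables (P : probability Omega R) (k : 'I_d).
Variables (X : R -> {RV P >-> 'rV[R]_d}) (M : set R -> {RV P >-> 'rV[R]_d}).
Hypothesis indM : is_induced_measure X M.
Hypothesis levyX : is_levy_process X.
Variables a b : R -> R.
Hypotheses (ca : continuous a) (cb : continuous b) (a0 : a 0 = 0) (b0 : b 0 = 0).
Hypothesis a_le0 : forall v, a v <= 0.
Hypothesis char1 : forall v, charf P (fun w => v * X 1 w 0 k) = cexp (a v +i* b v).
Variables (f : R -> R) (J : set R -> {RV P >-> 'rV[R]_d}) (r : R).
Hypothesis intJ : is_stochastic_integral M f J.
Hypothesis fr : forall s, `|f s| <= r.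

(** The approximating simple functions f_n need be bounded neither uniformly nor by
    an integrable function, so nothing can be dominated on B itself. Cut B into the
    disjoint pieces E i on which the f_n are uniformly bounded: on finitely many
    of them the exponents converge by dominated convergence, and what is left has
    small measure. That the limit J of the integrals is negligible there too is
    mult_limit_tail, applied to the set functions S |-> char. function of the
    integral over the union of the E i, i in S. *)
Lemma charf_stochastic_integral (B : set R) (v : R) : bounded_borel B ->
  charf P (fun w => v * J B w 0 k) =
  cexp ((\int[lebesgue_measure]_(s in B) a (v * f s)) +i*
        (\int[lebesgue_measure]_(s in B) b (v * f s))).
Proof.
move=> bB; have [mB B0 _] := bB.
have [mf0 [f_ [f_f Jlim]]] := intJ.
have mf : measurable_fun B f by exact: measurable_funS mf0.
have f_fB C : C `<=` B ->
    {ae lebesgue_measure, forall s, C s -> f_ n s @[n --> \oo] --> f s}.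
  move=> CB; apply: ae_lebS f_f => s h /CB /B0; rewrite /= in_itv/= andbT.
  exact: h.
pose A m : set R := B `&` [set s | forall n, `|f_ n s| <= m%:R].
have mA m : measurable (A m).
  apply: measurableI => //.
  have -> : [set s | forall n, `|f_ n s| <= m%:R] =
      \bigcap_n ((fun s => `|f_ n s|) @^-1` `]-oo, m%:R]%classic).
    apply/seteqP; split => [s h n _|s h n]; last by have := h n I; rewrite /= in_itv.
    by rewrite /= in_itv/=; exact: h.
  apply: bigcapT_measurable => n; rewrite -[X in measurable X]setTI.
  by apply: (measurableT_comp _ _ measurableT) => //; exact: measurable_funP.
have monoA m n : (m <= n)%N -> A m `<=` A n.
  move=> mn s [Bs h]; split => // i.
  by rewrite (le_trans (h i))// ler_nat.
have ndA : nondecreasing_seq A by move=> m n mn; apply/subsetPset; exact: monoA.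
pose E := seqD A.
have mE i : measurable (E i) by case: i => [|i]; [exact: mA|exact: measurableD].
have EA i : E i `<=` A i by case: i => [|i]// s [].
have tE : trivIset setT E by exact: trivIset_seqD.
pose U S : set R := \bigcup_(i in S) E i.
have mU S : measurable (U S) by apply: bigcup_measurable => i _.
have UB S : U S `<=` B by move=> s [i _ /EA[]].
have bU S : bounded_borel (U S) by exact: bounded_borelS bB.
have U_U S T : U (S `|` T) = U S `|` U T by rewrite /U bigcup_setU.
have UI S T : S `&` T = set0 -> U S `&` U T = set0.
  move=> ST; apply/seteqP; split => // s [[i Si Eis] [j Tj Ejs]].
  have ij : i = j by apply: (tE i j I I); exists s.
  by have : set0 i by rewrite -ST; split => //; rewrite ij.
pose C m := B `\` A m.
have mC m : measurable (C m) by exact: measurableD.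
have bC m : bounded_borel (C m) by apply: bounded_borelS bB => // s [].
have UC S m : (forall i, S i -> (m < i)%N) -> U S `<=` C m.
  move=> Sm s [i /Sm mi Eis]; split; first by have [] := EA i s Eis.
  case: i mi Eis => // i mi [_ nA] /= Ams; apply: nA.
  by rewrite ltnS in mi; exact: (monoA _ _ mi).
have UA S m : (forall i, S i -> (i <= m)%N) -> U S `<=` A m.
  move=> Sm s [i /Sm im /EA]; exact: monoA.
(* a point outside every A m has an unbounded, hence divergent, sequence f_n s *)
have lC : leb (C m) @[m --> \oo] --> 0.
  have mbC : measurable (\bigcap_m C m) by exact: bigcapT_measurable.
  have niC : nonincreasing_seq C.
    move=> m n mn; apply/subsetPset => s [Bs nA]; split => // h; apply: nA.
    exact: (monoA _ _ mn).
  have h := nonincreasing_cvg_mu (mu := lebesgue_measure)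
    (bounded_borel_fin (bC 0%N)) mC mbC niC.
  have z : lebesgue_measure (\bigcap_m C m) = 0%E.
    have [N [mN N0 sN]] := f_fB B (@subset_refl _ B).
    apply/eqP; rewrite -measure_le0 -N0; apply: le_measure; rewrite ?inE//.
    move=> s Cs; apply: sN => /= h'.
    have [Bs _] := Cs 0%N I.
    have /cvg_seq_bounded[K [_ Kb]] : cvgn (fun n => f_ n s) by apply/cvg_ex; exists (f s); exact: h'.
    pose K1 := Num.max (K + 1) 0.
    have [_] := Cs (Num.trunc K1).+1 I; apply; split => // n.
    rewrite (@le_trans _ _ K1)//.
      rewrite le_max (Kb (K + 1))//; lra.
    by apply/ltW/truncnS_gt.
  have h0 : (fun m => lebesgue_measure (C m)) @ \oo --> (0 : \bar R).
    by rewrite -[X in _ --> X]z; exact: h.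
  exact: (fine_cvg h0).
pose phi n S := charf P (fun w => v * simple_integral M (f_ n) (U S) w 0 k).
pose psi S := charf P (fun w => v * J (U S) w 0 k).
pose I (h g : R -> R) S := \int[lebesgue_measure]_(s in U S) h (v * g s).
have phiE n S : phi n S = cexp ((I a (f_ n) S) +i* (I b (f_ n) S)).
  exact: (charf_simple_integral indM levyX ca cb a0 b0 char1).
have mhv (h g : R -> R) D : continuous h -> measurable_fun D g ->
    measurable_fun D (fun s => h (v * g s)).
  move=> ch mg; apply: (measurable_comp measurableT) => //.
    exact: continuous_measurable_fun.
  exact: measurable_funM.
have hbd (h g : R -> R) (q : R) : continuous h -> (forall s, `|g s| <= q) ->
    exists2 K, 0 <= K & forall s, `|h (v * g s)| <= K.
  move=> ch gq; have [K K0 hK] := continuous_bounded_itv (`|v| * q) ch.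
  by exists K => // s; apply: hK; rewrite normrM ler_wpM2l.
have f_bd n : exists q : R, forall s, `|f_ n s| <= q.
  have [K [_ hK]] := simple_bounded (f_ n).
  by exists (K + 1) => s; apply: hK => //; rewrite ltrDl.
have mf_ n D : measurable_fun D (f_ n) by apply: measurable_funTS.
have IU h g K S T : continuous h -> measurable_fun B g ->
    (forall s, `|h (v * g s)| <= K) -> S `&` T = set0 ->
    I h g (S `|` T) = I h g S + I h g T.
  move=> ch mg gK ST; rewrite /I U_U.
  have iU : lebesgue_measure.-integrable (U S `|` U T) (EFin \o (fun s => h (v * g s))).
    rewrite -U_U; apply: (@integrable_bounded_borel _ _ _ K) => //.
    by apply: mhv => //; exact: measurable_funS (mB) (UB _) mg.
  have dST : [disjoint U S & U T]%classic by apply/disj_set2P; exact: UI.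
  by rewrite (Rintegral_setU (mu := lebesgue_measure) (mU S) (mU T) iU dST).
have Ile h g K S : continuous h -> measurable_fun B g ->
    (forall s, `|h (v * g s)| <= K) -> `|I h g S| <= K * leb (U S).
  move=> ch mg gK; apply: Rintegral_bounded_le => //.
  by apply: mhv => //; exact: measurable_funS (mB) (UB _) mg.
have lebUS D D' : bounded_borel D -> bounded_borel D' -> D `<=` D' -> leb D <= leb D'.
  move=> bD bD' DD'; rewrite -lee_fin !EFin_leb//.
  by apply: le_measure; rewrite ?inE//; [case: bD|case: bD'].
have phiU n S T : S `&` T = set0 -> phi n (S `|` T) = phi n S * phi n T.
  move=> ST; have [q fq] := f_bd n.
  have [Ka _ hKa] := hbd a _ _ ca fq; have [Kb _ hKb] := hbd b _ _ cb fq.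
  rewrite !phiE -cexpD; congr cexp.
  by rewrite (IU _ _ _ _ _ ca (mf_ n B) hKa ST) (IU _ _ _ _ _ cb (mf_ n B) hKb ST).
have Ia_le0 g K S : measurable_fun B g -> (forall s, `|a (v * g s)| <= K) -> I a g S <= 0.
  move=> mg gK; have i0 : lebesgue_measure.-integrable (U S) (EFin \o (fun=> 0 : R)).
    by apply: (@integrable_bounded_borel _ _ _ 0) => // s _; rewrite normr0.
  have ia : lebesgue_measure.-integrable (U S) (EFin \o (fun s => a (v * g s))).
    apply: (@integrable_bounded_borel _ _ _ K) => //.
    by apply: mhv => //; exact: measurable_funS (mB) (UB _) mg.
  have -> : (0 : R) = \int[lebesgue_measure]_(s in U S) 0.
    by rewrite Rintegral_cst ?mul0r//; exact: mU.
  exact: (le_Rintegral (mu := lebesgue_measure) (mU S) ia i0).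
have phi1 n S : Normc.normc (phi n S) <= 1.
  have [q fq] := f_bd n; have [Ka _ hKa] := hbd a _ _ ca fq.
  by rewrite phiE normc_cexp/= -expR0 ler_expR; exact: Ia_le0 hKa.
have small (h g : R -> R) K (e : R) : 0 < e -> continuous h -> measurable_fun B g ->
    (forall s, `|h (v * g s)| <= K) -> 0 <= K ->
    exists m0, forall m S, (m0 <= m)%N -> (forall i, S i -> (m < i)%N) -> `|I h g S| <= e.
  move=> e0 ch mg gK K0.
  have K10 : 0 < K + 1 by rewrite ltr_wpDl.
  have [m0 _ hm] := (cvgrPdist_le _ _).1 lC (e / (K + 1)) (divr_gt0 e0 K10).
  exists m0 => m S mm0 Sm; rewrite (le_trans (Ile _ _ _ S ch mg gK))//.
  have := hm m mm0; rewrite /= sub0r normrN ger0_norm ?leb_ge0// => lm.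
  have lUC : leb (U S) <= leb (C m) by apply: lebUS => //; exact: UC.
  rewrite (@le_trans _ _ ((K + 1) * (e / (K + 1))))//; last first.
    by rewrite mulrC divfK// gt_eqF.
  rewrite ler_pM// ?leb_ge0//; last exact: le_trans lUC lm.
  by rewrite lerDl.
have phi_tail n (e : R) : 0 < e ->
    exists m, forall S, S `<=` [set i | (m <= i)%N] -> Normc.normc (phi n S - 1) <= e.
  move=> e0; have [q fq] := f_bd n.
  have [Ka Ka0 hKa] := hbd a _ _ ca fq; have [Kb Kb0 hKb] := hbd b _ _ cb fq.
  have [dl dl0 hdl] := cexp_near1 e0.
  have [ma hma] := small _ _ _ _ dl0 ca (mf_ n B) hKa Ka0.
  have [mb hmb] := small _ _ _ _ dl0 cb (mf_ n B) hKb Kb0.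
  exists (maxn ma mb).+1 => S Sm; rewrite phiE; apply: hdl.
    by apply: (hma _ _ (leq_maxl ma mb)) => i /Sm.
  by apply: (hmb _ _ (leq_maxr ma mb)) => i /Sm.
have phi_cvg S : ccvg \oo (phi ^~ S) (psi S).
  apply: (@charf_cvg_in_probability _ _ _ _ _ k _ _ _ (fun n => simple_integral M (f_ n) (U S)) (J (U S))).
  - by move=> n; exact: measurable_simple_integral.
  - by [].
  - exact: Jlim.
(* on finitely many pieces the bound m dominates all the f_n *)
have psi_headE m S : (forall i, S i -> (i <= m)%N) ->
    psi S = cexp ((I a f S) +i* (I b f S)).
  move=> Sm; apply: (ccvg_unique (phi_cvg S)).
  apply: (@eq_ccvg _ _ _ (fun n => cexp ((I a (f_ n) S) +i* (I b (f_ n) S)))).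
    by move=> n; rewrite phiE.
  have USf : measurable_fun (U S) f by exact: measurable_funS mf.
  have USb n s : U S s -> `|f_ n s| <= m%:R by move=> /(UA S m Sm)[_]; exact.
  by apply: ccvg_cexp; apply: (bounded_convergence (r := m%:R)) => //; exact: f_fB.
have [Ka Ka0 hKa] := hbd a _ _ ca fr; have [Kb Kb0 hKb] := hbd b _ _ cb fr.
pose kappa := expR (- (Ka * leb B)).
have psi_head m S : S `<=` [set i | (i < m)%N] -> kappa <= Normc.normc (psi S).
  move=> Sm; rewrite (psi_headE m); last by move=> i /Sm /ltnW.
  rewrite normc_cexp/= /kappa ler_expR lerNl.
  rewrite (le_trans (ler_norm _))// normrN (le_trans (Ile _ _ _ S ca mf hKa))//.
  by rewrite ler_wpM2l//; exact: lebUS.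
have kappa0 : 0 < kappa by exact: expR_gt0.
have tailP := mult_limit_tail phiU phi1 phi_tail phi_cvg kappa0 psi_head.
have pU := mult_limitU phiU phi_cvg.
have AU m : A m `<=` U setT.
  by move=> s Ams; rewrite /U eq_bigcup_seqD; exists m.
have mD : measurable (B `\` U setT) by exact: measurableD.
have bD : bounded_borel (B `\` U setT) by apply: bounded_borelS bB => // s [].
have lD : leb (B `\` U setT) = 0.
  apply/le_anti; rewrite leb_ge0 andbT.
  apply: (ler_cvg_to (cvg_cst _) lC); apply: nearW => m; apply: lebUS => //.
  by move=> s [Bs nU]; split => // /AU.
have BE : B = U setT `|` (B `\` U setT) by rewrite setDUK.
have Iext h g K : continuous h -> measurable_fun B g ->
    (forall s, `|h (v * g s)| <= K) ->
    \int[lebesgue_measure]_(s in B) h (v * g s) = I h g setT.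
  move=> ch mg gK.
  have iB : lebesgue_measure.-integrable (U setT `|` (B `\` U setT))
      (EFin \o (fun s => h (v * g s))).
    by rewrite -BE; apply: (@integrable_bounded_borel _ _ _ K) => //; exact: mhv.
  have dD : [disjoint U setT & (B `\` U setT)]%classic.
    by apply/disj_set2P; rewrite setDIK.
  rewrite {1}BE (Rintegral_setU (mu := lebesgue_measure) (mU setT) mD iB dD).
  have : `|\int[lebesgue_measure]_(s in B `\` U setT) h (v * g s)| <=
      K * leb (B `\` U setT).
    apply: Rintegral_bounded_le => //.
    by apply: mhv => //; apply: (measurable_funS mB _ mg) => s [].
  by rewrite lD mulr0 normr_le0 => /eqP ->; rewrite addr0.
have -> : charf P (fun w => v * J B w 0 k) = psi setT.
  apply: (ccvg_unique _ (phi_cvg setT)).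
  apply: (@eq_ccvg _ _ _ (fun n => charf P (fun w => v * simple_integral M (f_ n) B w 0 k))).
    move=> n; rewrite phiE (charf_simple_integral indM levyX ca cb a0 b0 char1)//.
    have [q fq] := f_bd n.
    have [Ka1 _ hKa1] := hbd a _ _ ca fq; have [Kb1 _ hKb1] := hbd b _ _ cb fq.
    by rewrite (Iext _ _ _ ca (mf_ n B) hKa1) (Iext _ _ _ cb (mf_ n B) hKb1).
  apply: (@charf_cvg_in_probability _ _ _ _ _ k _ _ _ (fun n => simple_integral M (f_ n) B) (J B)).
  - by move=> n; exact: measurable_simple_integral.
  - by [].
  - exact: Jlim.
rewrite (Iext _ _ _ ca mf hKa) (Iext _ _ _ cb mf hKb).
(* split the pieces into a finite head, computed above, and a negligible tail *)
pose hd m : set nat := [set i | (i <= m)%N]; pose tl m : set nat := [set i | (m < i)%N].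
have hdtl m : hd m `&` tl m = set0.
  by apply/seteqP; split => // i [+ /=]; rewrite /hd/tl/= ltnNge => ->.
have hdtlU m : setT = hd m `|` tl m.
  by apply/seteqP; split => // i _; have [im|mi] := leqP i m; [left|right].
have Icvg h K : continuous h -> (forall s, `|h (v * f s)| <= K) -> 0 <= K ->
    I h f (hd m) @[m --> \oo] --> I h f setT.
  move=> ch hK K0; apply/cvgrPdist_le => e e0.
  have [m0 hm0] := small _ _ _ _ e0 ch mf hK K0.
  exists m0 => // m /= mm0.
  rewrite {1}(hdtlU m) (IU _ _ _ _ _ ch mf hK (hdtl m)) addrAC subrr add0r.
  exact: (hm0 m).
have c1 : ccvg \oo (fun m => psi (tl m)) 1.
  apply/ccvg_normcP => e e0; have [m0 hm0] := tailP e e0.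
  by exists m0 => // m /= mm0; apply: hm0 => i /ltnW; exact: leq_trans.
have c2 : ccvg \oo (fun m => psi (hd m)) (cexp ((I a f setT) +i* (I b f setT))).
  apply: (@eq_ccvg _ _ _ (fun m => cexp ((I a f (hd m)) +i* (I b f (hd m))))).
    by move=> m; rewrite (psi_headE m).
  by apply: ccvg_cexp; [exact: Icvg hKa Ka0|exact: Icvg hKb Kb0].
have c3 : ccvg \oo (fun m => psi (hd m) * psi (tl m)) (cexp ((I a f setT) +i* (I b f setT))).
  by rewrite -[X in ccvg _ _ X]mulr1; exact: ccvgM.
apply: (ccvg_unique _ c3).
apply: (@eq_ccvg _ _ _ (fun=> psi setT)); last exact: ccvg_cst.
by move=> m; rewrite {1}(hdtlU m) pU.
Qed.

End StochasticIntegral.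

(** * The Levy exponent in a coordinate direction *)

Section Inequalities.
Context {R : realType}.
Implicit Types y : R.

Lemma cosB1_le y : `|cos y - 1| <= y ^+ 2.
Proof.
have -> : cos y - 1 = - (2 * sin (y / 2) ^+ 2).
  have -> : cos y = cos (y / 2) ^+ 2 - sin (y / 2) ^+ 2.
    by rewrite {1}(splitr y) cosD -!expr2.
  by have := cos2Dsin2 (y / 2); lra.
have s0 := sqr_ge0 (sin (y / 2)).
rewrite normrN ger0_norm; last by lra.
have h : sin (y / 2) ^+ 2 <= (y / 2) ^+ 2.
  rewrite -[leLHS]real_normK ?num_real// -[leRHS]real_normK ?num_real//.
  rewrite ler_pXn2r ?nnegrE//.
  by have := sin_lipschitz (y / 2) 0; rewrite sin0 !subr0.
rewrite (@le_trans _ _ (2 * (y / 2) ^+ 2))// ?ler_wpM2l//.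
by rewrite expr_div_n; have := sqr_ge0 y; lra.
Qed.

Lemma sinB_le y : `|sin y - y| <= y ^+ 2.
Proof.
wlog y0 : y / 0 <= y.
  move=> h; have [|/ltW y0] := leP 0 y; first exact: h.
  have := h (- y); rewrite oppr_ge0 y0 sinN opprK sqrrN => /(_ isT).
  by rewrite -normrN opprD opprK.
have dg (x : R) : is_derive x 1 (fun u => sin u - u) (cos x - 1).
  exact: (@is_deriveB _ _ _ (@sin R) id x 1 (cos x) 1).
have cg : {within `[0, y], continuous (fun u => sin u - u)}.
  by apply: derivable_within_continuous => x _; have [] := dg x.
have [c] := @MVT_segment R _ _ 0 y y0 (fun u _ => dg u) cg.
rewrite in_itv/= sin0 !subr0 => /andP[c0 cy] ->.
rewrite normrM (ger0_norm y0) expr2 ler_wpM2r//.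
have := cos_lipschitz c 0; rewrite cos0 subr0 (ger0_norm c0) => h.
exact: le_trans h cy.
Qed.

(** Telescoping: the partial sums stay below 2 - 1 / N. *)
Lemma sum_inv_sq_le (N : nat) : \sum_(i < N) (i.+1%:R ^+ 2)^-1 <= 2 :> R.
Proof.
case: N => [|N]; first by rewrite big_ord0.
suff : \sum_(i < N.+1) (i.+1%:R ^+ 2)^-1 <= 2 - N.+1%:R^-1 :> R.
  by move=> h; rewrite (le_trans h)// gerBl invr_ge0.
elim: N => [|N ih]; first by rewrite big_ord_recr big_ord0/=; lra.
rewrite big_ord_recr/= (le_trans (lerD ih (lexx _)))//.
have n0 : 0 < N.+1%:R :> R by [].
have -> : N.+2%:R = N.+1%:R + 1 :> R by rewrite -natr1.
move: n0; set n := N.+1%:R => n0.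
rewrite -subr_ge0.
have -> : 2 - (n + 1)^-1 - (2 - n^-1 + ((n + 1) ^+ 2)^-1) =
    (n * (n + 1) ^+ 2)^-1.
  by field; rewrite ?gt_eqF//= ?addr_gt0.
by rewrite invr_ge0 mulr_ge0 ?sqr_ge0// ltW.
Qed.

(** The primitive of t |-> min ((y / t)^2, 1). *)
Let primitive y (t : R) : R := if t <= y then t else 2 * y - y ^+ 2 / t.

Let primitive_step (y t : R) : 0 < y -> 0 <= t ->
  Num.min ((y / (t + 1)) ^+ 2) 1 <= primitive y (t + 1) - primitive y t.
Proof.
move=> y0 t0; rewrite /primitive; have T0 : 0 < t + 1 by rewrite ltr_wpDl.
have Tn : t + 1 != 0 by rewrite gt_eqF.
case: (leP (t + 1) y) => ty1; case: (leP t y) => ty.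
- by rewrite ge_min; apply/orP; right; lra.
- by exfalso; lra.
- rewrite ge_min; apply/orP; left; rewrite -subr_ge0.
  have -> : 2 * y - y ^+ 2 / (t + 1) - t - (y / (t + 1)) ^+ 2 =
      (t + 1 - y) * ((t + 1) * (y - t) + y) / (t + 1) ^+ 2 by field.
  rewrite divr_ge0 ?sqr_ge0// mulr_ge0//; first by lra.
  by apply: addr_ge0; [apply: mulr_ge0; lra|exact: ltW].
- have tp : 0 < t by lra.
  rewrite ge_min; apply/orP; left; rewrite -subr_ge0.
  have -> : 2 * y - y ^+ 2 / (t + 1) - (2 * y - y ^+ 2 / t) - (y / (t + 1)) ^+ 2 =
      y ^+ 2 / (t * (t + 1) ^+ 2) by field; rewrite Tn gt_eqF.
  by rewrite divr_ge0 ?mulr_ge0 ?sqr_ge0// ltW.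
Qed.

(** Comparison with the integral over t > 0 of min ((y / t)^2, 1), which is 2 y. *)
Lemma sum_min_le y (N : nat) : 0 < y ->
  \sum_(i < N) Num.min ((y / i.+1%:R) ^+ 2) 1 <= 2 * y.
Proof.
move=> y0; apply: (@le_trans _ _ (primitive y N%:R)).
  elim: N => [|N ih]; first by rewrite big_ord0 /primitive (ltW y0).
  rewrite big_ord_recr/= -natr1 -(subrK (primitive y N%:R) (primitive y _)) addrC.
  by rewrite lerD// primitive_step.
rewrite /primitive; case: ifPn => [|_]; first by lra.
by rewrite gerBl divr_ge0// sqr_ge0.
Qed.

End Inequalities.

Section LevyMeasure.
Context {R : realType} {d : nat}.
Variables (nu : {measure set 'rV[R]_d -> \bar R}) (k : 'I_d).
Implicit Types x : 'rV[R]_d.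

(** The function that every Levy measure integrates. *)
Definition trunc2 x : R := Num.min (enorm x ^+ 2) 1.

Hypothesis nu_trunc : (\int[nu]_x (trunc2 x)%:E < +oo)%E.

Lemma enorm_ge0 x : 0 <= enorm x. Proof. exact: sqrtr_ge0. Qed.

Lemma trunc2_ge0 x : 0 <= trunc2 x.
Proof. by rewrite le_min sqr_ge0 ler01. Qed.

Lemma measurable_coord0 : measurable_fun setT (fun x : 'rV[R]_d => x 0 k).
Proof. exact: measurable_coord. Qed.

Lemma measurable_trunc2 : measurable_fun setT trunc2.
Proof.
apply: measurable_minr => //.
by apply: measurable_funX; exact: measurable_enorm.
Qed.

Lemma integrable_trunc2 : nu.-integrable setT (EFin \o trunc2).
Proof.
apply/integrableP; split; first by apply/measurable_EFinP; exact: measurable_trunc2.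
rewrite (eq_integral (fun x => (trunc2 x)%:E))// => x _ /=.
by rewrite ger0_norm// trunc2_ge0.
Qed.

Lemma integrable_le_trunc2 (D : set 'rV[R]_d) (g : 'rV[R]_d -> R) (C : R) :
  measurable D -> measurable_fun D g -> (forall x, D x -> `|g x| <= C * trunc2 x) ->
  nu.-integrable D (EFin \o g).
Proof.
move=> mD mg gC.
have iC : nu.-integrable D (EFin \o (fun x => C * trunc2 x)).
  have := integrableZl measurableT C integrable_trunc2.
  by move=> /(integrableS measurableT mD (@subsetT _ _)); exact: eq_integrable.
apply: le_integrable iC => //; first exact/measurable_EFinP.
by move=> x Dx /=; rewrite lee_fin (le_trans (gC x Dx))// ler_norm.
Qed.

Lemma coord2_le x : x 0 k ^+ 2 <= enorm x ^+ 2.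
Proof.
rewrite -(real_normK (num_real (x 0 k))) ler_pXn2r ?nnegrE ?enorm_ge0//.
exact: coord_le_enorm.
Qed.

Lemma cosB1_trunc2 (v : R) x : `|cos (v * x 0 k) - 1| <= (2 + v ^+ 2) * trunc2 x.
Proof.
rewrite /trunc2; case: (leP (enorm x ^+ 2) 1) => x1.
  rewrite (le_trans (cosB1_le _))// exprMn ler_pM ?sqr_ge0//.
    by rewrite lerDr.
  exact: coord2_le.
rewrite mulr1 (@le_trans _ _ 2)//; last by rewrite lerDl sqr_ge0.
rewrite (le_trans (ler_normB _ _))// normr1.
by have := cos_max (v * x 0 k); lra.
Qed.

Lemma sinB_trunc2 (v : R) x : `|sin (v * x 0 k) - v * x 0 k / (1 + enorm x ^+ 2)| <=
  (1 + `|v| + v ^+ 2) * trunc2 x.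
Proof.
have n0 := sqr_ge0 (enorm x); have n1 : 0 < 1 + enorm x ^+ 2 by rewrite ltr_pwDl.
have ck := coord_le_enorm k x; have c2 := coord2_le x; have e0 := enorm_ge0 x.
have v2 := sqr_ge0 v; have nv := normr_ge0 v.
rewrite /trunc2; case: (leP (enorm x ^+ 2) 1) => x1.
  have e1 : enorm x <= 1.
    by rewrite -(@ler_pXn2r _ 2)// ?nnegrE// expr1n.
  have -> : sin (v * x 0 k) - v * x 0 k / (1 + enorm x ^+ 2) =
      (sin (v * x 0 k) - v * x 0 k) + v * x 0 k * (enorm x ^+ 2 / (1 + enorm x ^+ 2)).
    by field; rewrite gt_eqF.
  rewrite (le_trans (ler_normD _ _))//.
  have h1 : `|sin (v * x 0 k) - v * x 0 k| <= v ^+ 2 * enorm x ^+ 2.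
    by rewrite (le_trans (sinB_le _))// exprMn ler_wpM2l.
  have h2 : `|v * x 0 k * (enorm x ^+ 2 / (1 + enorm x ^+ 2))| <= `|v| * enorm x ^+ 2.
    have t0 : 0 <= enorm x ^+ 2 / (1 + enorm x ^+ 2) by rewrite divr_ge0// ltW.
    have t1 : enorm x ^+ 2 / (1 + enorm x ^+ 2) <= enorm x ^+ 2.
      by rewrite ler_pdivrMr// ler_peMr// lerDl.
    rewrite normrM normrM (ger0_norm t0) -mulrA ler_wpM2l//.
    by rewrite -[leRHS]mul1r ler_pM// (le_trans ck).
  by have := n0; lra.
rewrite mulr1 (le_trans (ler_normB _ _))// -addrA lerD//; first exact: sin_max.
rewrite (@le_trans _ _ (`|v|))//; last by rewrite lerDl.
rewrite !normrM -mulrA -[leRHS]mulr1 ler_wpM2l// normfV (gtr0_norm n1).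
rewrite ler_pdivrMr// mul1r (le_trans ck)//.
have : 0 <= (enorm x - 1) ^+ 2 by exact: sqr_ge0.
by rewrite sqrrB expr1n mulr1; lra.
Qed.

(** Real part of the Levy exponent at v e_k, for a Gaussian part of variance qA. *)
Definition lev_re (qA v : R) : R :=
  - (2^-1 * (v ^+ 2 * qA)) + \int[nu]_x (cos (v * x 0 k) - 1).

(** Imaginary part of the Levy exponent at v e_k, for the drift g = gamma_k. *)
Definition lev_im (g v : R) : R :=
  \int[nu]_x (sin (v * x 0 k) - v * x 0 k / (1 + enorm x ^+ 2)) + v * g.

Lemma measurable_vcoord v : measurable_fun setT (fun x : 'rV[R]_d => v * x 0 k).
Proof. by apply: measurable_funM => //; exact: measurable_coord0. Qed.

Lemma measurable_cosB1 v : measurable_fun setT (fun x : 'rV[R]_d => cos (v * x 0 k) - 1).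
Proof.
apply: measurable_funB => //; apply: measurableT_comp; first exact: measurable_cos.
exact: measurable_vcoord.
Qed.

Lemma measurable_center v : measurable_fun setT
  (fun x : 'rV[R]_d => v * x 0 k / (1 + enorm x ^+ 2)).
Proof.
apply: measurable_funM; first exact: measurable_vcoord.
apply: (@measurableT_comp _ _ _ _ _ _ (fun t : R => (1 + t ^+ 2)^-1) _ (@enorm R d)).
  apply: continuous_measurable_fun => t; apply: cvgV.
    by rewrite gt_eqF// ltr_pwDl// sqr_ge0.
  by apply: cvgD; [exact: cvg_cst|exact: exprn_continuous].
exact: measurable_enorm.
Qed.

Lemma measurable_sinB v : measurable_fun setT (fun x : 'rV[R]_d =>
  sin (v * x 0 k) - v * x 0 k / (1 + enorm x ^+ 2)).
Proof.
apply: measurable_funB; last exact: measurable_center.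
apply: measurableT_comp; [exact: measurable_sin|exact: measurable_vcoord].
Qed.

Lemma lev_re0 qA : lev_re qA 0 = 0.
Proof.
rewrite /lev_re expr0n/= mul0r mulr0 oppr0 add0r /Rintegral integral0_eq// => x _.
by rewrite mul0r cos0 subrr.
Qed.

Lemma lev_im0 g : lev_im g 0 = 0.
Proof.
rewrite /lev_im mul0r addr0 /Rintegral integral0_eq// => x _.
by rewrite !mul0r sin0 subrr.
Qed.

Lemma continuous_integral_trunc2 (F : R -> 'rV[R]_d -> R) (C : R -> R) :
  (forall v, measurable_fun setT (F v)) ->
  (forall x, continuous (F ^~ x)) ->
  (forall v x, `|F v x| <= C `|v| * trunc2 x) ->
  (forall r s, 0 <= r -> r <= s -> C r <= C s) ->
  continuous (fun v => \int[nu]_x F v x).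
Proof.
move=> mF cF FC mC v; pose r : R := `|v| + 1.
have bound u : u \in `](- r), r[%classic -> forall x, `|F u x| <= C r * trunc2 x.
  rewrite inE/= in_itv/= -ltr_norml => /ltW ur x.
  by rewrite (le_trans (FC u x))// ler_wpM2r ?trunc2_ge0// mC.
have iF u : nu.-integrable setT (EFin \o F u).
  by apply: (@integrable_le_trunc2 _ _ (C `|u|)).
apply: (@continuity_under_integral R _ _ nu F setT measurableT (- r) r _ _
  (fun x => C r * trunc2 x)).
- by move=> u _; exact: iF.
- by apply: aeW => x _ u _; exact: cF.
- have := integrableZl measurableT (C r) integrable_trunc2; exact: eq_integrable.
- by move=> u ur; apply: aeW => x _; apply: bound; rewrite inE.
- rewrite inE/= in_itv/= -ltr_norml /r; lra.
Qed.

Lemma continuous_lev_re qA : continuous (lev_re qA).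
Proof.
move=> v; rewrite /lev_re; apply: cvgD.
  apply: cvgN; apply: cvgM; first exact: cvg_cst.
  by apply: cvgM; [exact: exprn_continuous|exact: cvg_cst].
apply: (continuous_integral_trunc2 (C := fun r => 2 + r ^+ 2)).
- exact: measurable_cosB1.
- move=> x u; apply: cvgB; last exact: cvg_cst.
  apply: continuous_cvg; first exact: continuous_cos.
  by apply: cvgM => //; exact: cvg_cst.
- by move=> u x; rewrite real_normK ?num_real//; exact: cosB1_trunc2.
- by move=> r s r0 rs; rewrite lerD2l ler_pXn2r// nnegrE (le_trans r0).
Qed.

Lemma continuous_lev_im g : continuous (lev_im g).
Proof.
move=> v; rewrite /lev_im; apply: cvgD; last first.
  by apply: cvgM => //; exact: cvg_cst.
apply: (continuous_integral_trunc2 (C := fun r => 1 + r + r ^+ 2)).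
- exact: measurable_sinB.
- move=> x u; apply: cvgB.
    apply: continuous_cvg; first exact: continuous_sin.
    by apply: cvgM => //; exact: cvg_cst.
  by apply: cvgM; [apply: cvgM => //; exact: cvg_cst|exact: cvg_cst].
- by move=> u x; rewrite real_normK ?num_real//; exact: sinB_trunc2.
- by move=> r s r0 rs; rewrite lerD// ?lerD2l// ler_pXn2r// nnegrE (le_trans r0).
Qed.

Lemma lev_re_le0 qA v : 0 <= qA -> lev_re qA v <= 0.
Proof.
move=> qA0; rewrite /lev_re -[leRHS]addr0 lerD//.
  by rewrite oppr_le0 mulr_ge0// mulr_ge0// sqr_ge0.
have i1 : nu.-integrable setT (EFin \o (fun x => cos (v * x 0 k) - 1)).
  by apply: (@integrable_le_trunc2 _ _ (2 + v ^+ 2)) => //;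
    [exact: measurable_cosB1|move=> x _; exact: cosB1_trunc2].
have -> : (0 : R) = \int[nu]_x 0 by rewrite /Rintegral integral0.
apply: le_Rintegral => //.
  exact: (integrable0 nu setT).
Qed.

(** Its integrability is the existence of a first moment away from 0, on top of
    what trunc2 gives. *)
Definition bigpart x : R := enorm x * \1_[set x : 'rV[R]_d | 1 < enorm x] x.
Definition dominant x : R := trunc2 x + bigpart x.

Lemma bigpart_ge0 x : 0 <= bigpart x.
Proof. by rewrite mulr_ge0 ?enorm_ge0// indicE. Qed.

Lemma measurable_enorm_gt (s : R) : measurable [set x : 'rV[R]_d | s < enorm x].
Proof.
rewrite -[X in measurable X]setTI.
have := @measurable_enorm R d measurableT `]s, +oo[%classic (measurable_itv _).
by congr (measurable (_ `&` _)); apply/seteqP; split => w /=; rewrite in_itv/= andbT.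
Qed.

Hypothesis nu_big : nu.-integrable setT (EFin \o bigpart).

Lemma integrable_le_dominant (D : set 'rV[R]_d) (g : 'rV[R]_d -> R) (C : R) :
  measurable D -> measurable_fun D g -> (forall x, D x -> `|g x| <= C * dominant x) ->
  nu.-integrable D (EFin \o g).
Proof.
move=> mD mg gC.
have iD : nu.-integrable setT (EFin \o dominant).
  have := integrableD measurableT integrable_trunc2 nu_big.
  exact: eq_integrable.
have iC : nu.-integrable D (EFin \o (fun x => C * dominant x)).
  have := integrableZl measurableT C iD.
  by move=> /(integrableS measurableT mD (@subsetT _ _)); exact: eq_integrable.
apply: le_integrable iC => //; first exact/measurable_EFinP.
by move=> x Dx /=; rewrite lee_fin (le_trans (gC x Dx))// ler_norm.
Qed.

(** The size of the second-order terms of the exponent at argument 1 / s. *)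
Definition truncs (s : R) x : R := Num.min ((enorm x / s) ^+ 2) 1.
Definition Gtail (s : R) : R := \int[nu]_x truncs s x.

Lemma truncs_ge0 s x : 0 <= truncs s x.
Proof. by rewrite le_min sqr_ge0 ler01. Qed.

Lemma measurable_truncs s : measurable_fun setT (truncs s).
Proof.
apply: measurable_minr => //; apply: measurable_funX.
by apply: measurable_funM => //; exact: measurable_enorm.
Qed.

Lemma truncs_mono (s t : R) x : 0 < s -> s <= t -> truncs t x <= truncs s x.
Proof.
move=> s0 st; have t0 := lt_le_trans s0 st.
rewrite /truncs le_min ge_min ge_min lexx orbT andbT; apply/orP; left.
have dv (u : R) : 0 < u -> 0 <= enorm x / u by move=> /ltW u0; rewrite divr_ge0 ?enorm_ge0.
rewrite ler_pXn2r ?nnegrE ?dv//.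
by rewrite ler_wpM2l ?enorm_ge0// lef_pV2.
Qed.

Lemma truncs_le (s : R) x : 1 <= s -> truncs s x <= trunc2 x.
Proof.
move=> s1; have := @truncs_mono 1 s x ltr01 s1.
by rewrite {2}/truncs divr1.
Qed.

Lemma integrable_truncs (s : R) : 1 <= s -> nu.-integrable setT (EFin \o truncs s).
Proof.
move=> s1; apply: (@integrable_le_trunc2 _ _ 1) => //; first exact: measurable_truncs.
by move=> x _; rewrite mul1r ger0_norm ?truncs_ge0// truncs_le.
Qed.

Lemma Gtail_mono (s t : R) : 1 <= s -> s <= t -> Gtail t <= Gtail s.
Proof.
move=> s1 st; apply: le_Rintegral => //.
- by apply: integrable_truncs; exact: le_trans st.
- exact: integrable_truncs.
- by move=> x _; apply: truncs_mono => //; exact: lt_le_trans s1.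
Qed.

Lemma Gtail_ge0 s : 0 <= Gtail s.
Proof. by apply: Rintegral_ge0 => x _; exact: truncs_ge0. Qed.

(** Summed over the radii 1, 2, ... the truncated square of enorm x / s costs at most
    a multiple of enorm x ^+ 2 for small x, and of enorm x for large x: this is
    where the first moment enters. *)
Lemma sum_Gtail_le (N : nat) :
  \sum_(i < N) Gtail i.+1%:R <= \int[nu]_x (2 * dominant x).
Proof.
have i1 (i : nat) : nu.-integrable setT (EFin \o truncs i.+1%:R).
  by apply: integrable_truncs; rewrite ler1n.
rewrite -(Rintegral_sum (index_enum 'I_N) measurableT (fun i : 'I_N => i1 i)).
apply: le_Rintegral => //.
- exact: (integrable_EFin_sum (index_enum 'I_N) measurableT (fun i : 'I_N => i1 i)).
- apply: (@integrable_le_dominant _ _ 2) => //.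
    apply: measurable_funM => //; apply: measurable_funD; first exact: measurable_trunc2.
    by apply: measurable_funM; [exact: measurable_enorm|apply: measurable_indic; exact: measurable_enorm_gt].
  move=> x _; rewrite ger0_norm//; apply: mulr_ge0 => //.
  by apply: addr_ge0; [exact: trunc2_ge0|exact: bigpart_ge0].
move=> x _; rewrite /dominant /bigpart indicE.
have e0 := enorm_ge0 x; have [x1|x1] := leP (enorm x) 1.
  rewrite memNset ?mulr0 ?addr0; last by rewrite /= ltNge x1.
  have -> : trunc2 x = enorm x ^+ 2.
    by rewrite /trunc2; apply/min_idPl; rewrite expr_le1.
  apply: (@le_trans _ _ (\sum_(i < N) enorm x ^+ 2 * (i.+1%:R ^+ 2)^-1)).
    by apply: ler_sum => i _; rewrite /truncs ge_min expr_div_n lexx.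
  rewrite -mulr_sumr mulrC ler_wpM2r ?sqr_ge0//; exact: sum_inv_sq_le.
rewrite mem_set// mulr1 (le_trans (sum_min_le N _))//; first exact: lt_trans x1.
by rewrite ler_wpM2l// lerDr trunc2_ge0.
Qed.

Lemma lev_re_le_Gtail (qA s : R) : 0 <= qA -> 1 <= s ->
  `|lev_re qA s^-1| <= qA * (s ^+ 2)^-1 + 2 * Gtail s.
Proof.
move=> qA0 s1; have s0 : 0 < s by exact: lt_le_trans s1.
rewrite /lev_re (le_trans (ler_normD _ _))// lerD//.
  rewrite normrN exprVn (mulrC _ qA).
  have h : 0 <= qA * (s ^+ 2)^-1 by rewrite mulr_ge0// invr_ge0 sqr_ge0.
  by rewrite ger0_norm; lra.
have i1 : nu.-integrable setT (EFin \o (fun x => cos (s^-1 * x 0 k) - 1)).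
  by apply: (@integrable_le_trunc2 _ _ (2 + s^-1 ^+ 2)) => //;
    [exact: measurable_cosB1|move=> x _; exact: cosB1_trunc2].
rewrite (le_trans (le_normr_Rintegral _ _))// -RintegralZl//; last exact: integrable_truncs.
apply: le_Rintegral => //; first exact: integrable_norm.
  by have := integrableZl measurableT 2 (integrable_truncs s1); exact: eq_integrable.
move=> x _; rewrite /truncs; case: (leP ((enorm x / s) ^+ 2) 1) => x1.
  rewrite (le_trans (cosB1_le _))// (@le_trans _ _ ((enorm x / s) ^+ 2))//.
    rewrite mulrC !expr_div_n ler_wpM2r ?invr_ge0 ?sqr_ge0//; exact: coord2_le.
  by rewrite ler_peMl ?sqr_ge0// ler1n.
rewrite mulr1 (le_trans (ler_normB _ _))// normr1.
by have := cos_max (s^-1 * x 0 k); lra.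
Qed.

Definition htail (s : R) : R := \int[nu]_(x in [set x | s < enorm x]) x 0 k.

(** Passing from the centering x / (1 + |x|^2) to the centering x moves the drift
    by this amount. *)
Definition drift : R := \int[nu]_x (x 0 k - x 0 k / (1 + enorm x ^+ 2)).

(** For |x| <= s the sine is replaced by its argument, at a quadratic cost; beyond s
    it is merely bounded, and the linear term missing there is the tail moment. *)
Lemma lev_im_le_Gtail g (s : R) : 1 <= s ->
  `|lev_im g s^-1 - (g + drift - htail s) / s| <= Gtail s.
Proof.
move=> s1; have s0 : 0 < s by exact: lt_le_trans s1.
pose D := [set x : 'rV[R]_d | s < enorm x].
have mD : measurable D by exact: measurable_enorm_gt.
have mk := measurable_coord0.
have ih : nu.-integrable setT (EFin \o (fun x => x 0 k * \1_D x)).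
  apply: (@integrable_le_dominant _ _ 1) => //.
    by apply: measurable_funM => //; exact: measurable_indic.
  move=> x _; rewrite mul1r indicE /dominant /bigpart indicE.
  have [xD|xD] := boolP (x \in D); rewrite ?mulr1 ?mulr0 ?normr0.
    move: xD; rewrite inE /D/= => sx; rewrite mem_set/= ?mulr1; last exact: le_lt_trans sx.
    by rewrite (le_trans (coord_le_enorm k x))// lerDr trunc2_ge0.
  by rewrite addr_ge0 ?trunc2_ge0//; exact: (bigpart_ge0 x).
have idr : nu.-integrable setT (EFin \o (fun x => x 0 k - x 0 k / (1 + enorm x ^+ 2))).
  apply: (@integrable_le_dominant _ _ 1) => //.
    apply: measurable_funB => //.
    have := measurable_center 1; under eq_fun do rewrite mul1r; exact.
  move=> x _; rewrite mul1r.
  have n0 := sqr_ge0 (enorm x); have n1 : 0 < 1 + enorm x ^+ 2 by rewrite ltr_pwDl.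
  have ck := coord_le_enorm k x; have e0 := enorm_ge0 x.
  have -> : x 0 k - x 0 k / (1 + enorm x ^+ 2) =
    x 0 k * (enorm x ^+ 2 / (1 + enorm x ^+ 2)) by field; rewrite gt_eqF.
  have t0 : 0 <= enorm x ^+ 2 / (1 + enorm x ^+ 2) by rewrite divr_ge0// ltW.
  rewrite normrM (ger0_norm t0) /dominant /bigpart indicE.
  have [x1|x1] := leP (enorm x) 1.
    rewrite memNset ?mulr0 ?addr0; last by rewrite /= ltNge x1.
    have -> : trunc2 x = enorm x ^+ 2.
      by rewrite /trunc2; apply/min_idPl; rewrite expr_le1.
    rewrite -[leRHS]mul1r ler_pM//; first exact: le_trans x1.
    by rewrite ler_pdivrMr// ler_peMr// lerDl.
  rewrite mem_set// mulr1 (@le_trans _ _ (enorm x * 1))//.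
    by rewrite ler_pM// ler_pdivrMr// mul1r lerDr.
  by rewrite mulr1 lerDr trunc2_ge0.
have isn : nu.-integrable setT (EFin \o (fun x =>
    sin (s^-1 * x 0 k) - s^-1 * x 0 k / (1 + enorm x ^+ 2))).
  by apply: (@integrable_le_trunc2 _ _ (1 + `|s^-1| + s^-1 ^+ 2)) => //;
    [exact: measurable_sinB|move=> x _; exact: sinB_trunc2].
have hE : htail s = \int[nu]_x (x 0 k * \1_D x).
  rewrite /htail Rintegral_mkcond; apply: eq_Rintegral => x _.
  by rewrite patchE indicE; case: ifPn => _; rewrite ?mulr1 ?mulr0.
have ih' : nu.-integrable setT (EFin \o (fun x => s^-1 * (x 0 k * \1_D x))).
  by have := integrableZl measurableT s^-1 ih; exact: eq_integrable.
have idr' : nu.-integrable setT (EFin \o (fun x => s^-1 * (x 0 k - x 0 k / (1 + enorm x ^+ 2)))).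
  by have := integrableZl measurableT s^-1 idr; exact: eq_integrable.
have isd : nu.-integrable setT (EFin \o (fun x =>
    (sin (s^-1 * x 0 k) - s^-1 * x 0 k / (1 + enorm x ^+ 2)) -
    s^-1 * (x 0 k - x 0 k / (1 + enorm x ^+ 2)))).
  by have := integrableB measurableT isn idr'; exact: eq_integrable.
have isdh : nu.-integrable setT (EFin \o (fun x =>
    (sin (s^-1 * x 0 k) - s^-1 * x 0 k / (1 + enorm x ^+ 2)) -
    s^-1 * (x 0 k - x 0 k / (1 + enorm x ^+ 2)) + s^-1 * (x 0 k * \1_D x))).
  by have := integrableD measurableT isd ih'; exact: eq_integrable.
have -> : lev_im g s^-1 - (g + drift - htail s) / s = \int[nu]_x (
    (sin (s^-1 * x 0 k) - s^-1 * x 0 k / (1 + enorm x ^+ 2)) -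
    s^-1 * (x 0 k - x 0 k / (1 + enorm x ^+ 2)) + s^-1 * (x 0 k * \1_D x)).
  rewrite RintegralD// RintegralB// RintegralZl// RintegralZl// -hE /lev_im /drift.
  by ring.
rewrite (le_trans (le_normr_Rintegral _ _))//.
apply: le_Rintegral => //; [exact: integrable_norm|exact: integrable_truncs|].
move=> x _; rewrite indicE.
have sn : s != 0 by rewrite gt_eqF.
have es0 : 0 <= enorm x / s by rewrite divr_ge0 ?enorm_ge0// ltW.
have en : 1 + enorm x ^+ 2 != 0 by rewrite gt_eqF// ltr_pwDl// sqr_ge0.
have [xD|xD] := boolP (x \in D).
  have -> : sin (s^-1 * x 0 k) - s^-1 * x 0 k / (1 + enorm x ^+ 2) -
    s^-1 * (x 0 k - x 0 k / (1 + enorm x ^+ 2)) + s^-1 * (x 0 k * true%:R) =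
    sin (s^-1 * x 0 k) by rewrite /=; field; rewrite sn en.
  move: xD; rewrite inE /D/= => sx; rewrite /truncs.
  have -> : Num.min ((enorm x / s) ^+ 2) 1 = 1.
    by apply/min_idPr; rewrite expr_ge1// ler_pdivlMr// mul1r ltW.
  exact: sin_max.
have -> : sin (s^-1 * x 0 k) - s^-1 * x 0 k / (1 + enorm x ^+ 2) -
    s^-1 * (x 0 k - x 0 k / (1 + enorm x ^+ 2)) + s^-1 * (x 0 k * false%:R) =
    sin (s^-1 * x 0 k) - s^-1 * x 0 k by rewrite /=; field; rewrite sn en.
have xs : enorm x <= s.
  by rewrite leNgt; apply/negP => h; move/negP : xD; apply; rewrite inE.
have -> : truncs s x = (enorm x / s) ^+ 2.
  by apply/min_idPl; rewrite expr_le1// ler_pdivrMr// mul1r.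
rewrite (le_trans (sinB_le _))// mulrC !expr_div_n ler_wpM2r ?invr_ge0 ?sqr_ge0//.
exact: coord2_le.
Qed.

End LevyMeasure.

(** * Characteristic functions of improper integrals *)

Section LevyKhintchine.
Context {R : realType} {d : nat}.
Variables (mu : probability 'rV[R]_d R) (k : 'I_d).
Variables (A : 'M[R]_d) (nu : {measure set 'rV[R]_d -> \bar R}) (gamma : 'rV[R]_d).
Hypothesis triplet : has_levy_triplet mu A nu gamma.

Let e_k : 'rV[R]_d := delta_mx 0 k.

(** The diagonal entry (k, k) of A. *)
Definition gauss_part : R := inner e_k (e_k *m A^T).

Lemma gauss_part_ge0 : 0 <= gauss_part.
Proof. by have [[_ +] _ _ _] := triplet; exact. Qed.

Let inner_ek (x : 'rV[R]_d) : inner e_k x = x 0 k.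
Proof.
rewrite /inner (bigD1 k)//= big1 ?addr0 => [|i ik]; first by rewrite mxE !eqxx mul1r.
by rewrite mxE (negbTE ik) andbF mul0r.
Qed.

Let innerZl (c : R) (x y : 'rV[R]_d) : inner (c *: x) y = c * inner x y.
Proof. by rewrite /inner mulr_sumr; apply: eq_bigr => i _; rewrite mxE mulrA. Qed.

Let innerC (x y : 'rV[R]_d) : inner x y = inner y x.
Proof. by rewrite /inner; apply: eq_bigr => i _; rewrite mulrC. Qed.

Let cexp_i (t : R) : cexp ('i%C * t%:C) = cos t +i* sin t.
Proof.
have -> : 'i%C * t%:C = 0 +i* t :> R[i] by simpc.
by rewrite /cexp/= expR0 mul1r.
Qed.

Lemma levy_nu_trunc : (\int[nu]_x (trunc2 x)%:E < +oo)%E.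
Proof. by have [_ _ + _] := triplet. Qed.

Lemma charf_triplet (v : R) : charf mu (fun x => v * x 0 k) =
  cexp (lev_re nu k gauss_part v +i* lev_im nu k (gamma 0 k) v).
Proof.
have [_ _ _ h] := triplet; have := h (v *: e_k).
have iv x : inner (v *: e_k) x = v * x 0 k by rewrite innerZl inner_ek.
have -> : char_fun mu (v *: e_k) = charf mu (fun x => v * x 0 k).
  rewrite /char_fun /charf /cintegral; congr (_ +i* _).
    by apply: eq_Rintegral => x _; rewrite iv cexp_i.
  by apply: eq_Rintegral => x _; rewrite iv cexp_i.
move=> ->; congr cexp; rewrite /levy_exponent /lev_re /lev_im.
have -> : inner (v *: e_k) ((v *: e_k) *m A^T) = v ^+ 2 * gauss_part.
  by rewrite -scalemxAl innerZl innerC innerZl innerC /gauss_part expr2 mulrA.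
have -> : inner gamma (v *: e_k) = v * gamma 0 k by rewrite innerC iv.
rewrite /cintegral.
have -> : \int[nu]_x complex.Re (cexp ('i%C * (inner (v *: e_k) x)%:C) - 1 -
    'i%C * (inner (v *: e_k) x / (1 + enorm x ^+ 2))%:C) = \int[nu]_x (cos (v * x 0 k) - 1).
  by apply: eq_Rintegral => x _; rewrite iv cexp_i /=; ring.
have -> : \int[nu]_x complex.Im (cexp ('i%C * (inner (v *: e_k) x)%:C) - 1 -
    'i%C * (inner (v *: e_k) x / (1 + enorm x ^+ 2))%:C) =
    \int[nu]_x (sin (v * x 0 k) - v * x 0 k / (1 + enorm x ^+ 2)).
  by apply: eq_Rintegral => x _; rewrite iv cexp_i /=; ring.
by simpc; congr (_ +i* _); ring.
Qed.

End LevyKhintchine.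

Section Shift.
Context {R : realType} {d : nat}.
Variables (mu : probability 'rV[R]_d R) (k : 'I_d).

Lemma convolution_dirac (q : 'rV[R]_d) (B : set 'rV[R]_d) : measurable B ->
  convolution mu (dirac q) B = mu [set x | B (x + q)].
Proof.
move=> mB; rewrite /convolution /distribution /pushforward/= /product_measure1.
have mS : measurable [set x | B (x + q)].
  rewrite -[X in measurable X]setTI.
  have : measurable_fun [set: 'rV[R]_d] (fun x => x + q).
    apply: measurable_fun_mx => i j; under eq_fun do rewrite mxE.
    by apply: measurable_funD => //; exact: measurable_coord.
  by apply.
transitivity (\int[mu]_x (\1_[set x | B (x + q)] x)%:E)%E; last first.
  by rewrite integral_indic// setIT.
apply: eq_integral => x _; rewrite /= diracE indicE; congr ((_ : bool)%:R%:E).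
by apply/idP/idP; rewrite /xsection !inE/= ?inE.
Qed.

Lemma charf_convolution_dirac {dO : measure_display} {Omega : measurableType dO}
    (P : probability Omega R) (X1 : {RV P >-> 'rV[R]_d}) (q : 'rV[R]_d) (v : R) :
  (forall B, measurable B -> distribution P X1 B = convolution mu (dirac q) B) ->
  charf P (fun w => v * X1 w 0 k) =
  charf mu (fun x => v * x 0 k) * cexp (0 +i* (v * q 0 k)).
Proof.
move=> law.
have mvk : measurable_fun [set: 'rV[R]_d] (fun x => v * x 0 k).
  by apply: measurable_funM => //; exact: measurable_coord.
have mvq : measurable_fun [set: 'rV[R]_d] (fun x => v * x 0 k + v * q 0 k).
  exact: measurable_funD.
have -> : charf P (fun w => v * X1 w 0 k) = charf mu (fun x => v * x 0 k + v * q 0 k).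
  apply: eq_law_charf => //; first exact: measurable_scaled_coord.
  move=> S mS; pose B := [set x : 'rV[R]_d | S (v * x 0 k)].
  have mB : measurable B.
    by rewrite /B -[X in measurable X]setTI; exact: mvk.
  have := law B mB; rewrite convolution_dirac// /distribution /pushforward => ->.
  congr (mu _); apply/seteqP; split => x; rewrite /B /= mxE mulrDr//.
rewrite /charf /cexp/= expR0 mul1r; simpc.
set c := v * q 0 k.
have i1 := integrable_cos mu measurableT mvk.
have i2 := integrable_sin mu measurableT mvk.
have i1c r : mu.-integrable setT (EFin \o (fun x : 'rV[R]_d => cos (v * x 0 k) * r)).
  by have := integrableZr measurableT r i1; exact: eq_integrable.
have i2c r : mu.-integrable setT (EFin \o (fun x : 'rV[R]_d => sin (v * x 0 k) * r)).
  by have := integrableZr measurableT r i2; exact: eq_integrable.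
under eq_Rintegral do rewrite cosD.
under [X in _ +i* X = _]eq_Rintegral do rewrite sinD.
rewrite RintegralB// RintegralD// !RintegralZr//.
by congr (_ +i* _); ring.
Qed.

End Shift.

Section Definable.
Context {R : realType} {d : nat}.
Variables (mu : probability 'rV[R]_d R) (k : 'I_d).
Variables (a b : R -> R).
Hypotheses (ca : continuous a) (cb : continuous b) (a0 : a 0 = 0) (b0 : b 0 = 0).
Hypothesis a_le0 : forall v, a v <= 0.
Hypothesis char_mu : forall v, charf mu (fun x => v * x 0 k) = cexp (a v +i* b v).

(** All that is kept of definability in the coordinate direction k. Phi is the
    characteristic function of the limit; the shift by q contributes v * f s * q_k
    to the phase. *)
Lemma definable_charf (f : R -> R) (r : R) (q : 'rV[R]_d) (mu' : probability 'rV[R]_d R) :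
  (forall B, measurable B -> mu' B = convolution mu (dirac q) B) ->
  (forall s, `|f s| <= r) -> improper_integral_definable f mu' ->
  exists Phi : R -> R[i], [/\ Phi 0 = 1, continuous (fun v => complex.Re (Phi v)) &
    forall v, ccvg (pinfty_nbhs R) (fun t =>
      cexp ((\int[lebesgue_measure]_(s in `[0, t]) a (v * f s)) +i*
            (\int[lebesgue_measure]_(s in `[0, t]) (b (v * f s) + v * f s * q 0 k))))
      (Phi v)].
Proof.
move=> mu'E fr [dO [Om [P [X [M [J [Y [levyX lawX indM intJ cvgJ]]]]]]]].
pose b' v := b v + v * q 0 k.
have cb' : continuous b'.
  move=> v; apply: cvgD; first exact: cb.
  by apply: cvgM => //; exact: cvg_cst.
have b'0 : b' 0 = 0 by rewrite /b' b0 mul0r addr0.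
have char1 v : charf P (fun w => v * X 1 w 0 k) = cexp (a v +i* b' v).
  have law B : measurable B -> distribution P (X 1) B = convolution mu (dirac q) B.
    by move=> mB; rewrite lawX// mu'E.
  by rewrite (charf_convolution_dirac k v law) char_mu -cexpD; congr cexp; simpc.
exists (fun v => charf P (fun w => v * Y w 0 k)); split.
- rewrite (_ : (fun w => _) = (fun=> 0)); first exact: charf_cst0.
  by apply/funext => w; rewrite mul0r.
- have mYk : measurable_fun setT (fun w => Y w 0 k).
    exact: (measurableT_comp (measurable_coord 0 k) (measurable_funP Y)).
  by have [] := charf_continuous P mYk.
- move=> v.
  apply: (@eq_ccvg _ _ _ (fun t => charf P (fun w => v * J `[0, t]%classic w 0 k))).
    move=> t.
    rewrite (charf_stochastic_integral indM levyX ca cb' a0 b'0 a_le0 char1 intJ fr)//.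
    by apply/bounded_borelP; split => //; exists t.
  exact: (charf_cvg_in_probability k v).
Qed.

End Definable.

(** * First moment of the Levy measure *)

Lemma ge0_integral_mfrestr {R : realType} {dT : measure_display}
    {T : measurableType dT} (nu : {measure set T -> \bar R}) (D : set T)
    (mD : measurable D) (finD : (nu D < +oo)%E) (g : T -> \bar R) :
  measurable_fun setT g -> (forall x, 0 <= g x)%E ->
  (\int[mfrestr mD finD]_x g x = \int[nu]_(x in D) g x)%E.
Proof.
move=> mg g0.
rewrite -(setUv D) ge0_integral_setU//; last 3 first.
- exact: measurableC.
- by rewrite setUv.
- by apply/disj_set2P; rewrite setICr.
rewrite [X in (_ + X)%E](_ : _ = 0%E); last first.
  rewrite (eq_measure_integral mzero); first by rewrite integral_measure_zero.
  move=> A mA AD; rewrite /= /mfrestr /mrestr.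
  suff -> : A `&` D = set0 by rewrite measure0.
  by apply/seteqP; split => // x [/AD].
rewrite adde0; apply: eq_measure_integral => A mA AD.
by rewrite /= /mfrestr /mrestr setIidl.
Qed.

Lemma f1_le1 {R : realType} (s : R) : `|f1 s| <= 1.
Proof.
rewrite /f1 indicE; have [|_] := boolP (s \in _); last by rewrite mulr0 normr0.
rewrite inE/= in_itv/= andbT mulr1 => s1.
by rewrite normfV ger0_norm ?(le_trans ler01)// invf_le1// (lt_le_trans ltr01).
Qed.

Lemma f1E {R : realType} (s : R) : 1 <= s -> f1 s = s^-1.
Proof. by move=> s1; rewrite /f1 indicE mem_set ?mulr1//= in_itv/= s1. Qed.

Lemma f1_lt1 {R : realType} (s : R) : s < 1 -> f1 s = 0.
Proof.
by move=> s1; rewrite /f1 indicE memNset ?mulr0//= in_itv/= andbT leNgt s1.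
Qed.

Lemma f1_ge0 {R : realType} (s : R) : 0 <= f1 s.
Proof.
have [s1|s1] := ltP s 1; first by rewrite f1_lt1.
by rewrite f1E// invr_ge0 (le_trans _ s1).
Qed.

Lemma measurable_inv_max1 {R : realType} :
  measurable_fun setT (fun s : R => (Num.max s 1)^-1).
Proof.
apply: continuous_measurable_fun => s; apply: cvgV.
  by rewrite gt_eqF// lt_max ltr01 orbT.
exact: (@continuous_max R R^o id (fun=> 1) s cvg_id (cvg_cst _)).
Qed.

Lemma measurable_f1 {R : realType} : measurable_fun setT (@f1 R).
Proof.
rewrite (_ : @f1 R = fun s => (Num.max s 1)^-1 * \1_(`[1, +oo[%classic) s); last first.
  apply/funext => s; rewrite /f1 indicE; have [|_] := boolP (s \in _); last by rewrite !mulr0.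
  by rewrite inE/= in_itv/= andbT => s1; rewrite max_l.
by apply: measurable_funM; [exact: measurable_inv_max1|exact: measurable_indic].
Qed.

Section MomentFromDefinability.
Context {R : realType} {d : nat}.
Variables (nu : {measure set 'rV[R]_d -> \bar R}) (k : 'I_d) (qA v K : R).
Hypothesis nu_trunc : (\int[nu]_x (trunc2 x)%:E < +oo)%E.
Hypotheses (qA0 : 0 <= qA) (v0 : 0 < v).
Let a := lev_re nu k qA.
Hypothesis aK : forall N : nat,
  - (\int[lebesgue_measure]_(s in `[0, N%:R]) a (v * f1 s)) <= K.

Let D := [set x : 'rV[R]_d | 1 < enorm x].
Let mD : measurable D. Proof. exact: measurable_enorm_gt. Qed.

Lemma levy_measure_tail_fin : (nu D < +oo)%E.
Proof.
apply: le_lt_trans nu_trunc; rewrite -[leLHS]mul1e -integral_cst//.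
apply: (@le_trans _ _ (\int[nu]_(x in D) (trunc2 x)%:E)%E).
  apply: ge0_le_integral => //.
  - by apply: measurable_funTS; apply/measurable_EFinP; exact: measurable_trunc2.
  - move=> x; rewrite /D/= lee_fin /trunc2 => x1.
    by rewrite le_min lexx andbT exprn_ege1// ltW.
apply: ge0_subset_integral => //.
  by apply/measurable_EFinP; exact: measurable_trunc2.
by move=> x _; rewrite lee_fin trunc2_ge0.
Qed.

Let nuD := mfrestr mD levy_measure_tail_fin.

(* Num.max s 1 is s on the range of integration, and keeps F measurable. *)
Let F (p : R * 'rV[R]_d) : R := 1 - cos (v * p.2 0 k * (Num.max p.1 1)^-1).

Let F0 p : 0 <= F p. Proof. by rewrite subr_ge0 cos_le1. Qed.

Let mF : measurable_fun setT F.
Proof.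
apply: measurable_funB => //; apply: measurableT_comp; first exact: measurable_cos.
apply: measurable_funM.
  apply: measurable_funM => //.
  exact: (measurableT_comp (measurable_coord0 k) measurable_snd).
exact: (measurableT_comp (@measurable_inv_max1 R) measurable_fst).
Qed.

Let E (N : nat) : set R := `[1, N%:R]%classic.
Let FE N (p : R * 'rV[R]_d) : \bar R := (F p * \1_(E N) p.1)%:E.

Let FE0 N p : (0 <= FE N p)%E.
Proof. by rewrite lee_fin mulr_ge0// indicE. Qed.

Let mFE N : measurable_fun setT (FE N).
Proof.
apply/measurable_EFinP; apply: measurable_funM => //.
have mi : measurable_fun setT (\1_(E N) : R -> R).
  by apply: measurable_indic; exact: measurable_itv.
exact: (measurableT_comp mi measurable_fst).
Qed.

(** Minus the real part of the exponent at v / s dominates the integral of F. *)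
Let bd_outer N : (\int[lebesgue_measure]_s \int[nuD]_x FE N (s, x) <= K%:E)%E.
Proof.
have ca : continuous a by exact: continuous_lev_re.
have a_le0 u : a u <= 0 by exact: lev_re_le0.
have a00 : a 0 = 0 by exact: lev_re0.
have maf : measurable_fun setT (fun s => a (v * f1 s)).
  apply: measurableT_comp; first exact: continuous_measurable_fun.
  by apply: measurable_funM => //; exact: measurable_f1.
have bN : bounded_borel (`[0, N%:R]%classic : set R).
  by apply/bounded_borelP; split => //; exists N%:R.
have [Ka _ hKa] : exists2 Ka : R, 0 <= Ka & forall x, `|x| <= v -> `|a x| <= Ka.
  exact: continuous_bounded_itv.
have iaf : lebesgue_measure.-integrable (`[0, N%:R]%classic : set R) (EFin \o (fun s => - a (v * f1 s))).
  apply: (@integrable_bounded_borel _ _ _ Ka) => //.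
    by apply: measurable_funTS; apply: measurableT_comp maf.
  move=> s _; rewrite normrN; apply: hKa.
  by rewrite normrM (gtr0_norm v0) ler_piMr ?f1_le1// ltW.
apply: (@le_trans _ _ (\int[lebesgue_measure]_(s in `[0%R, N%:R]) (- a (v * f1 s))%:E)%E); last first.
  rewrite -(@fineK _ (\int[lebesgue_measure]_(s in `[0%R, N%:R]) (- a (v * f1 s))%:E)%E); last first.
    exact: (integrable_fin_num (mu := lebesgue_measure) _ iaf).
  rewrite lee_fin; apply: le_trans (aK N).
  have iaf' : lebesgue_measure.-integrable (`[0, N%:R]%classic : set R) (EFin \o (fun s => a (v * f1 s))).
    apply: (@integrable_bounded_borel _ _ _ Ka) => //.
      by apply: measurable_funTS; exact: maf.
    move=> s _; apply: hKa.
    by rewrite normrM (gtr0_norm v0) ler_piMr ?f1_le1// ltW.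
  rewrite -[leRHS]mulN1r -(RintegralZl (mu := lebesgue_measure))//.
  by under [leRHS]eq_Rintegral do rewrite mulN1r.
rewrite [leRHS]integral_mkcond; apply: ge0_le_integral => //.
- by move=> s _; apply: integral_ge0.
- exact: (measurable_fun_fubini_tonelli_F (m2 := nuD) (FE N)).
- apply/(measurable_restrictT _ _).1 => //; apply/measurable_EFinP.
  by apply: measurable_funTS; apply: measurableT_comp maf.
move=> s _; rewrite patchE; case: ifPn => [|sN]; last first.
  rewrite integral0_eq// => x _; rewrite /FE /E indicE memNset ?mulr0//=.
  move=> h; move/negP : sN; apply; rewrite inE/=; move: h; rewrite !in_itv/=.
  by move=> /andP[s1 ->]; rewrite (le_trans ler01 s1).
rewrite inE/= in_itv/= => /andP[s0 sN].
have [s1|s1] := leP 1 s; last first.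
  rewrite f1_lt1// mulr0 a00 oppr0 integral0_eq// => x _.
  by rewrite /FE /E indicE memNset ?mulr0//= in_itv/= leNgt s1.
rewrite ge0_integral_mfrestr//; last first.
  exact: (measurableT_comp (mFE N) (pair1_measurable s)).
rewrite f1E//.
have ic : nu.-integrable setT (EFin \o (fun x : 'rV[R]_d => cos (v / s * x 0 k) - 1)).
  apply: (@integrable_le_trunc2 _ _ _ nu_trunc _ _ (2 + (v / s) ^+ 2)) => //.
    exact: measurable_cosB1.
  by move=> x _; exact: cosB1_trunc2.
have ic' : nu.-integrable setT (EFin \o (fun x : 'rV[R]_d => 1 - cos (v / s * x 0 k))).
  have := integrableN ic; apply: eq_integrable => // x _.
  by rewrite /= opprB.
apply: (@le_trans _ _ (\int[nu]_x (1 - cos (v / s * x 0 k))%:E)%E).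
  apply: (@le_trans _ _ (\int[nu]_(x in D) (1 - cos (v / s * x 0 k))%:E)%E).
    rewrite le_eqVlt; apply/orP; left; apply/eqP; apply: eq_integral => x _.
    rewrite /FE /F /E indicE mem_set/= ?mulr1; last by rewrite in_itv/= s1.
    by rewrite max_l// mulrAC.
  by apply: ge0_subset_integral => //; exact: measurable_int ic'.
rewrite -(@fineK _ (\int[nu]_x _)%E); last exact: integrable_fin_num.
rewrite lee_fin /a /lev_re opprD opprK.
have -> : - (\int[nu]_x (cos (v / s * x 0 k) - 1)) = \int[nu]_x (1 - cos (v / s * x 0 k)).
  rewrite -[LHS]mulN1r -RintegralZl//.
  by apply: eq_Rintegral => x _; rewrite mulN1r opprB.
by rewrite lerDr mulr_ge0// mulr_ge0// sqr_ge0.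
Qed.

(** Lower bound of 1 - cos on the phases between 1/2 and 1. *)
Let c0 : R := 1 - cos 2^-1.

Let c0_gt0 : 0 < c0.
Proof.
have p2 := @pi_ge2 R.
have h : cos 2^-1 < cos 0 :> R.
  by rewrite ltr_cos ?in_itv/=; lra.
by rewrite /c0 subr_gt0 -[ltRHS]cos0.
Qed.

Let DN (N : nat) := [set x : 'rV[R]_d | 1 <= `|v * x 0 k| /\ 2 * `|v * x 0 k| <= N%:R].
Let g (N : nat) (x : 'rV[R]_d) : \bar R := (c0 * `|v * x 0 k| * \1_(DN N) x)%:E.

Let mvk : measurable_fun setT (fun x : 'rV[R]_d => `|v * x 0 k|).
Proof. by apply: measurableT_comp => //; exact: measurable_vcoord. Qed.

Let mDN N : measurable (DN N).
Proof.
rewrite -[X in measurable X]setTI.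
have := mvk measurableT (measurable_itv `[1, N%:R / 2]).
congr (measurable (_ `&` _)); apply/seteqP; split => x /=; rewrite in_itv/=.
  by move=> /andP[h1 h2]; split => //; lra.
by move=> [h1 h2]; apply/andP; split => //; lra.
Qed.

Let g0 N x : (0 <= g N x)%E.
Proof. by rewrite lee_fin mulr_ge0 ?indicE// mulr_ge0// ltW. Qed.

Let mg N : measurable_fun setT (g N).
Proof.
apply/measurable_EFinP; apply: measurable_funM; last by apply: measurable_indic.
exact: measurable_funM.
Qed.

(** Put y = |v x_k|. For y <= s <= 2 y the phase y / s lies between 1/2 and 1, which
    contributes c0 over an interval of length y. *)
Let inner_ge N x : (g N x <= \int[lebesgue_measure]_s FE N (s, x))%E.
Proof.
rewrite /g indicE; have [xN|_] := boolP (x \in DN N); last first.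
  by rewrite mulr0; apply: integral_ge0.
rewrite mulr1; move: xN; rewrite inE /DN/=; set y := `|v * x 0 k| => -[y1 yN].
have y0 : 0 < y by exact: lt_le_trans y1.
have le1 : ((c0 * y)%:E <= \int[lebesgue_measure]_(s in `[y, (2 * y)%R]) FE N (s, x))%E.
  have -> : ((c0 * y)%:E = \int[lebesgue_measure]_(s in `[y, (2 * y)%R]) (cst c0%:E) s)%E.
    rewrite integral_cst//= lebesgue_measure_itv/= lte_fin ifT; last by lra.
    by rewrite -EFinB -EFinM; congr EFin; ring.
  apply: ge0_le_integral => //.
  - by move=> s _; rewrite lee_fin ltW.
  - by apply: measurable_funTS; exact: (measurableT_comp (mFE N) (pair2_measurable x)).
  move=> s /=; rewrite in_itv/= => /andP[ys s2y].
  have s1 : 1 <= s by exact: le_trans ys.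
  have s0 : 0 < s by exact: lt_le_trans s1.
  rewrite lee_fin /F/= indicE mem_set/= ?mulr1; last first.
    by rewrite /E/= in_itv/= s1 (le_trans s2y).
  rewrite (max_l s1) /c0 lerD2l lerN2 -[leLHS]cos_norm normrM -/y normfV (gtr0_norm s0).
  have p2 := @pi_ge2 R.
  have h1 : 2^-1 <= y / s by rewrite ler_pdivlMr//; lra.
  have h2 : y / s <= 1 by rewrite ler_pdivrMr// mul1r.
  rewrite leNgt ltr_cos ?in_itv/=; first by rewrite -leNgt.
    by apply/andP; split; lra.
  by apply/andP; split; lra.
apply: (le_trans le1); apply: ge0_subset_integral => //.
exact: (measurableT_comp (mFE N) (pair2_measurable x)).
Qed.

Let bd_g N : (\int[nu]_(x in D) g N x <= K%:E)%E.
Proof.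
rewrite -(ge0_integral_mfrestr mD levy_measure_tail_fin (mg N) (g0 N)).
apply: le_trans (bd_outer N).
rewrite (fubini_tonelli (m1 := lebesgue_measure) (m2 := nuD) (FE N) (mFE N) (FE0 N)).
apply: ge0_le_integral => //.
exact: (measurable_fun_fubini_tonelli_G (m1 := lebesgue_measure) (FE N) (mFE N) (FE0 N)).
Qed.

(** By Tonelli, the bound K on the integrated exponent bounds the nu-integral of
    |v x_k| where |v x_k| >= 1; elsewhere |v x_k| is bounded and
    nu is finite on the tail. *)
Lemma integrable_coord_tail : nu.-integrable D (EFin \o (fun x => x 0 k)).
Proof.
pose G (x : 'rV[R]_d) : \bar R := (c0 * `|v * x 0 k| * \1_[set x | 1 <= `|v * x 0 k|] x)%:E.
have mS : measurable [set x : 'rV[R]_d | 1 <= `|v * x 0 k|].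
  rewrite -[X in measurable X]setTI.
  have := mvk measurableT (measurable_itv `[1, +oo[).
  by congr (measurable (_ `&` _)); apply/seteqP; split => x /=; rewrite in_itv/= andbT.
have G0 x : (0 <= G x)%E.
  by rewrite lee_fin mulr_ge0 ?indicE// mulr_ge0// ltW.
have mG : measurable_fun setT G.
  apply/measurable_EFinP; apply: measurable_funM; last by apply: measurable_indic.
  exact: measurable_funM.
have nd x : {homo g ^~ x : m n / (m <= n)%N >-> (m <= n)%E}.
  move=> m n mn; rewrite lee_fin ler_wpM2l//; first by rewrite mulr_ge0// ltW.
  rewrite !indicE ler_nat; case: (boolP (x \in DN m)) => // xm.
  rewrite mem_set//; move: xm; rewrite inE => -[h1 h2]; split => //.
  by rewrite (le_trans h2)// ler_nat.
have limG x : limn (g ^~ x) = G x.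
  apply/cvg_lim => //; apply: cvg_near_cst.
  exists (Num.trunc (2 * `|v * x 0 k|)).+1 => // n /= hn.
  have h : 2 * `|v * x 0 k| <= n%:R.
    by rewrite (le_trans (ltW (truncnS_gt _)))// ler_nat.
  rewrite /g /G; congr (_ * _)%:E; rewrite !indicE; congr ((_ : bool)%:R).
  apply/idP/idP; rewrite !inE /DN/=; first by case.
  by move=> h1; split.
have iG : (\int[nu]_(x in D) G x <= K%:E)%E.
  have := @cvg_monotone_convergence _ _ _ nu D mD g
    (fun n => measurable_funTS (mg n)) (fun n x _ => g0 n x) (fun x _ => nd x).
  rewrite (eq_integral G); last by move=> x _; rewrite limG.
  move=> /cvg_lim <-//; apply: lime_le; last by apply: nearW => N; exact: bd_g.
  apply: ereal_nondecreasing_is_cvgn => m n mn.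
  apply: ge0_le_integral => //; [exact: measurable_funTS|exact: measurable_funTS|].
  by move=> x _; exact: nd.
have intG : nu.-integrable D G.
  apply/integrableP; split; first exact: measurable_funTS.
  rewrite (eq_integral G); first exact: le_lt_trans iG (ltry _).
  by move=> x _; rewrite gee0_abs.
have intc : nu.-integrable D (EFin \o (fun=> v^-1 : R)).
  apply: measurable_bounded_integrable => //; first exact: levy_measure_tail_fin.
  exists `|v^-1|; split; first exact: num_real.
  by move=> z zv x _ /=; exact: ltW.
have intG' : nu.-integrable D (fun x => ((c0 * v)^-1)%:E * G x)%E.
  exact: integrableZl.
have := integrableD mD intG' intc; apply: le_integrable => //.
  by apply: measurable_funTS; apply/measurable_EFinP; exact: measurable_coord0.
move=> x _; rewrite /G /= lee_fin.
have v0' : v != 0 by rewrite gt_eqF.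
have c0' : c0 != 0 by rewrite gt_eqF.
have -> : (c0 * v)^-1 * (c0 * `|v * x 0 k| * \1_[set x | 1 <= `|v * x 0 k|] x) =
    `|x 0 k| * \1_[set x | 1 <= `|v * x 0 k|] x.
  by rewrite normrM (gtr0_norm v0); field; rewrite v0' c0'.
have vi0 : 0 <= v^-1 by rewrite invr_ge0 ltW.
rewrite indicE; have [h|h] := leP 1 `|v * x 0 k|.
  rewrite mem_set// mulr1 [leRHS]ger0_norm; first by rewrite lerDl.
  by rewrite addr_ge0.
rewrite memNset; last by rewrite /= leNgt h.
rewrite mulr0 add0r [leRHS]ger0_norm//.
move: h; rewrite normrM (gtr0_norm v0) mulrC => h.
by rewrite -[leRHS]mul1r ler_pdivlMr// ltW.
Qed.

End MomentFromDefinability.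

Section FirstMoment.
Context {R : realType} {d : nat}.
Variables (mu : probability 'rV[R]_d R).
Variables (A : 'M[R]_d) (nu : {measure set 'rV[R]_d -> \bar R}) (gamma : 'rV[R]_d).
Hypothesis triplet : has_levy_triplet mu A nu gamma.
Hypothesis definable : improper_integral_definable f1 mu.

Let convolution_dirac0 B : measurable B -> mu B = convolution mu (dirac (0 : 'rV[R]_d)) B.
Proof.
by move=> mB; rewrite convolution_dirac//; congr (mu _); apply/seteqP; split => x /=;
  rewrite addr0.
Qed.

(** The limiting characteristic function is continuous and 1 at 0, so it stays away
    from 0 at some v > 0. This bounds the real part of the exponents, which decrease
    in time, at that v. *)
Lemma integrable_coord_tail_f1 (k : 'I_d) :
  nu.-integrable [set x : 'rV[R]_d | 1 < enorm x] (EFin \o (fun x => x 0 k)).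
Proof.
have nt := levy_nu_trunc triplet.
have qA0 := gauss_part_ge0 k triplet.
set qA := gauss_part k A in qA0.
pose a := lev_re nu k qA; pose b := lev_im nu k (gamma 0 k).
have ca : continuous a by exact: continuous_lev_re.
have cb : continuous b by exact: continuous_lev_im.
have a0 : a 0 = 0 by exact: lev_re0.
have b0 : b 0 = 0 by exact: lev_im0.
have ale0 u : a u <= 0 by exact: lev_re_le0.
have cmu u := charf_triplet k triplet u.
have [Phi [Phi0 cPhi PhiP]] := definable_charf ca cb a0 b0 ale0 cmu
  convolution_dirac0 f1_le1 definable.
have [v v0 v12] : exists2 v, 0 < v & 1 / 2 <= complex.Re (Phi v).
  have h := cPhi 0; move/cvgrPdist_le : h => /(_ (1 / 2)).
  rewrite Phi0/= => /(_ ltac:(lra)) /nbhs_ballP[e /= e0 he].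
  exists (e / 2); first by rewrite divr_gt0.
  have := he (e / 2); rewrite /ball/= sub0r normrN gtr0_norm ?divr_gt0//.
  by move=> /(_ ltac:(lra)); rewrite ler_norml => /andP[_]; lra.
have [hRe _] := PhiP v.
have : \forall t \near +oo, 1 / 4 <= complex.Re (cexp
    ((\int[lebesgue_measure]_(s in `[0, t]) a (v * f1 s)) +i*
     (\int[lebesgue_measure]_(s in `[0, t]) (b (v * f1 s) + v * f1 s * (0 : 'rV[R]_d) 0 k)))).
  by move/cvgr_ge : hRe; apply; lra.
move=> [t0 [_ ht0]].
apply: (@integrable_coord_tail _ _ nu k qA v (- ln (1 / 4)) nt qA0 v0) => N.
(* the bound known at late times M holds at N as well, by monotonicity *)
pose M := Num.max (N%:R) (t0 + 1).
have Mt : t0 < M by rewrite /M lt_max ltrDl ltr01 orbT.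
have := ht0 M Mt.
set AM := \int[lebesgue_measure]_(s in `[0, M]) a (v * f1 s).
have ReE x y : complex.Re (cexp (x +i* y)) = expR x * cos y :> R.
  by rewrite /cexp/= mul0r subr0.
rewrite ReE => h.
have hA : 1 / 4 <= expR AM.
  apply: (le_trans h); rewrite -[leRHS]mulr1 ler_wpM2l ?expR_ge0//; exact: cos_le1.
have hA' : ln (1 / 4) <= AM.
  by rewrite -(expRK AM) ler_ln ?posrE ?expR_gt0//; lra.
rewrite lerN2; apply: (le_trans hA').
have maf : measurable_fun setT (fun s => a (v * f1 s)).
  apply: measurableT_comp; first exact: continuous_measurable_fun.
  by apply: measurable_funM => //; exact: measurable_f1.
have [Ka Ka0 hKa] : exists2 Ka : R, 0 <= Ka & forall x, `|x| <= v -> `|a x| <= Ka.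
  exact: continuous_bounded_itv.
have bd s : `|a (v * f1 s)| <= Ka.
  by apply: hKa; rewrite normrM (gtr0_norm v0) ler_piMr ?f1_le1// ltW.
have NM : N%:R <= M by rewrite le_max lexx.
have split : (`[0, M]%classic : set R) = `[0, N%:R] `|` `]N%:R, M].
  apply/seteqP; split => s /=; rewrite !in_itv/=.
    by move=> /andP[s0 sM]; have [sN|Ns] := leP s N%:R; [left|right]; rewrite ?s0.
  move=> [/andP[-> sN]|/andP[Ns ->]]; first exact: le_trans NM.
  by rewrite andbT ltW// (le_lt_trans _ Ns).
have iM : lebesgue_measure.-integrable (`[0, N%:R] `|` `]N%:R, M] : set R)
    (EFin \o (fun s => a (v * f1 s))).
  rewrite -split; apply: (@integrable_bounded_borel _ _ _ Ka) => //.
    by apply/bounded_borelP; split => //; exists M.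
  exact: measurable_funTS.
have dis : [disjoint (`[0, N%:R]%classic : set R) & `]N%:R, M]]%classic.
  apply/disj_set2P/seteqP; split => // s [] /=; rewrite !in_itv/=.
  by move=> /andP[_ sN] /andP[Ns _]; move: sN; rewrite leNgt Ns.
rewrite /AM split (Rintegral_setU (mu := lebesgue_measure) _ _ iM dis)//.
rewrite gerDl.
have i0 : lebesgue_measure.-integrable (`]N%:R, M]%classic : set R) (EFin \o (fun=> 0 : R)).
  apply: (@integrable_bounded_borel _ _ _ 0) => //; last by move=> s _; rewrite normr0.
  apply/bounded_borelP; split => //; exists M => s /=; rewrite !in_itv/= => /andP[Ns ->].
  by rewrite andbT ltW// (le_lt_trans _ Ns).
have iNM : lebesgue_measure.-integrable (`]N%:R, M]%classic : set R)
    (EFin \o (fun s => a (v * f1 s))).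
  by apply: (integrableS (mu := lebesgue_measure) _ _ _ iM) => //; exact: measurableU.
apply: (le_trans (le_Rintegral (mu := lebesgue_measure) _ iNM i0 _)) => //.
by rewrite Rintegral_cst// mul0r.
Qed.

Lemma integrable_bigpart_f1 : nu.-integrable setT (EFin \o bigpart (R := R) (d := d)).
Proof.
pose D := [set x : 'rV[R]_d | 1 < enorm x].
have mD : measurable D by exact: measurable_enorm_gt.
have iD : nu.-integrable D (EFin \o (fun x => \sum_(i < d) `|x 0 i|)).
  apply: (@integrable_EFin_sum _ _ _ nu D _ _ (fun i (x : 'rV[R]_d) => `|x 0 i|)) => // i.
  exact: (integrable_norm (integrable_coord_tail_f1 i)).
have iDT : nu.-integrable setT (EFin \o ((fun x : 'rV[R]_d => \sum_(i < d) `|x 0 i|) \_ D)).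
  rewrite -restrict_EFin.
  exact/(integrable_mkcond _ mD).
apply: le_integrable iDT => //.
  apply/measurable_EFinP; apply: measurable_funM; first exact: measurable_enorm.
  exact: measurable_indic.
move=> x _ /=; rewrite lee_fin (ger0_norm (bigpart_ge0 x)) /bigpart indicE patchE -/D.
case: ifPn => _; rewrite ?mulr1 ?mulr0//.
rewrite ger0_norm ?sumr_ge0//.
(* the Euclidean norm is at most the sum of the absolute coordinates *)
rewrite -(@ler_pXn2r _ 2)// ?nnegrE ?enorm_ge0 ?sumr_ge0//.
rewrite /enorm sqr_sqrtr; last first.
  by apply: sumr_ge0 => i _; rewrite -expr2 sqr_ge0.
rewrite expr2 mulr_suml /inner; apply: ler_sum => i _.
rewrite -expr2 -(real_normK (num_real (x 0 i))) expr2 ler_wpM2l//.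
by rewrite (bigD1 i)//= lerDl sumr_ge0.
Qed.

End FirstMoment.

(** * Bounded modulus and diverging phase *)

Section Oscillation.
Context {R : realType}.

(** The phase B is continuous and runs to infinity, so it crosses multiples of
    2 pi and odd multiples of pi beyond every time; there the real part is at
    least exp (- K), respectively at most - exp (- K). *)
Lemma phase_divergence (A phi : R -> R) (K : R) (L : R[i]) :
  (forall t, `|A t| <= K) ->
  (forall t, lebesgue_measure.-integrable `[0, t] (EFin \o phi)) ->
  let B t := \int[lebesgue_measure]_(s in `[0, t]) phi s in
  (forall H, exists T, forall t, T <= t -> H <= B t) \/
  (forall H, exists T, forall t, T <= t -> B t <= H) ->
  ~ ccvg (pinfty_nbhs R) (fun t => cexp (A t +i* B t)) L.
Proof.
move=> AK iphi B div [/= hRe _].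
have K0 : 0 < expR (- K) by exact: expR_gt0.
have := hRe; move/cvgrPdist_lt => /(_ _ K0) [T0 [_ hT0]].
pose T := Num.max (T0 + 1) 0.
have TT0 t : T <= t -> T0 < t.
  by rewrite /T ge_max => /andP[h _]; rewrite (lt_le_trans _ h)// ltrDl.
have T00 : 0 <= T by rewrite le_max lexx orbT.
have p0 := @pi_gt0 R.
have eA t : expR (- K) <= expR (A t).
  by rewrite ler_expR; have := AK t; rewrite ler_norml => /andP[].
have [n hn] : exists n : nat, `|B T| <= n%:R * (2 * pi).
  exists (Num.trunc (`|B T| / (2 * pi))).+1; rewrite -ler_pdivrMr; last by rewrite mulr_gt0.
  exact: ltW (truncnS_gt _).
have cosn : cos (n%:R * (2 * pi)) = 1 :> R.
  elim: (n) => [|m ih]; first by rewrite mul0r cos0.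
  by rewrite -natr1 mulrDl mul1r [2 * pi]mulr_natl cosD2pi -[pi *+ 2]mulr_natl.
have cosn' : cos (n%:R * (2 * pi) + pi) = -1 :> R by rewrite cosDpi cosn.
(* from T on, the intermediate value theorem gives every value beyond B T on the
   side to which B diverges *)
have reach (sg : bool) : (if sg then (forall H, exists T, forall t, T <= t -> H <= B t) else
   (forall H, exists T, forall t, T <= t -> B t <= H)) ->
   exists t1 t2, [/\ T <= t1, T <= t2, B t1 = (-1) ^+ (~~ sg) * (n%:R * (2 * pi)) &
     B t2 = (-1) ^+ (~~ sg) * (n%:R * (2 * pi) + pi)].
  move=> dv.
  have [T' T'T bT'] : exists2 T', T <= T' &
      if sg then n%:R * (2 * pi) + pi <= B T' else B T' <= - (n%:R * (2 * pi) + pi).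
    case: sg dv => dv.
      have [T1 h1] := dv (n%:R * (2 * pi) + pi).
      by exists (Num.max T T1); [rewrite le_max lexx|apply: h1; rewrite le_max lexx orbT].
    have [T1 h1] := dv (- (n%:R * (2 * pi) + pi)).
    by exists (Num.max T T1); [rewrite le_max lexx|apply: h1; rewrite le_max lexx orbT].
  have T'0 : 0 <= T' by exact: le_trans T'T.
  have cB : {within `[T, T'], continuous B}.
    apply: continuous_subspaceW (parameterized_integral_continuous T'0 (iphi T')).
    by move=> s /=; rewrite !in_itv/= => /andP[Ts ->]; rewrite (le_trans T00 Ts).
  have hn1 : - (n%:R * (2 * pi)) <= B T <= n%:R * (2 * pi) by rewrite -ler_norml.
  have ivt x : Num.min (B T) (B T') <= x <= Num.max (B T) (B T') ->
      exists2 t, T <= t & B t = x.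
    move=> hx; have [t] := IVT T'T cB hx; rewrite in_itv/= => /andP[Tt _] Bt.
    by exists t.
  move/andP : hn1 => [hl hr].
  case: sg dv bT' => _ bT' /=; rewrite ?expr0 ?expr1 ?mul1r ?mulN1r.
    have [t1 Tt1 B1] := ivt (n%:R * (2 * pi)) ltac:(apply/andP; split; [rewrite ge_min hr|rewrite le_max]; first done; apply/orP; right; lra).
    have [t2 Tt2 B2] := ivt (n%:R * (2 * pi) + pi) ltac:(apply/andP; split; [rewrite ge_min|rewrite le_max bT' orbT //]; apply/orP; left; lra).
    by exists t1, t2.
  have [t1 Tt1 B1] := ivt (- (n%:R * (2 * pi))) ltac:(apply/andP; split; [rewrite ge_min|rewrite le_max hl //]; apply/orP; right; lra).
  have [t2 Tt2 B2] := ivt (- (n%:R * (2 * pi) + pi)) ltac:(apply/andP; split; [rewrite ge_min bT' orbT //|rewrite le_max]; apply/orP; left; lra).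
  by exists t1, t2.
have [t1 [t2 [Tt1 Tt2 c1 c2]]] : exists t1 t2, [/\ T <= t1, T <= t2, cos (B t1) = 1 & cos (B t2) = -1].
  case: div => div.
    have [t1 [t2 [? ? B1 B2]]] := reach true div; exists t1, t2; split => //.
      by rewrite B1 expr0 mul1r.
    by rewrite B2 expr0 mul1r.
  have [t1 [t2 [? ? B1 B2]]] := reach false div; exists t1, t2; split => //.
    by rewrite B1 expr1 mulN1r cosN.
  by rewrite B2 expr1 mulN1r cosN.
have := hT0 t1 (TT0 _ Tt1); have := hT0 t2 (TT0 _ Tt2).
rewrite /= c1 c2 !mul0r !subr0 mulr1 mulrN1 !ltr_norml => /andP[h1 h2] /andP[h3 h4].
by have := eA t1; have := eA t2; lra.
Qed.

End Oscillation.

Section StepBound.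
Context {R : realType}.

Lemma step_bound (r : R -> R) (g : nat -> R) (G : R) :
  measurable_fun setT r ->
  (forall s, s < 1 -> r s = 0) ->
  (forall (n : nat) s, (0 < n)%N -> n%:R <= s -> `|r s| <= g n) ->
  (forall N : nat, \sum_(i < N) g i.+1 <= G) ->
  forall t, `|\int[lebesgue_measure]_(s in `[0, t]) r s| <= G.
Proof.
move=> mr r0 rg gG t.
have rK s : `|r s| <= g 1.
  have [s1|s1] := ltP s 1; last exact: rg.
  by rewrite r0// normr0 (le_trans _ (rg 1%N 1 _ _)).
have bt : bounded_borel (`[0, t]%classic : set R).
  by apply/bounded_borelP; split => //; exists t.
have ir : lebesgue_measure.-integrable `[0, t] (EFin \o r).
  by apply: (@integrable_bounded_borel _ _ _ (g 1)) => //; exact: measurable_funTS.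
pose N := (Num.trunc t).+1.
pose J (i : nat) : set R := `[i.+1%:R, i.+2%:R[%classic.
have mJ i : measurable (J i) by exact: measurable_itv.
have g0 i : 0 <= g i.+1 by rewrite (le_trans _ (rg i.+1 i.+1%:R _ _)).
have iJ (i : 'I_N) : lebesgue_measure.-integrable `[0, t] (EFin \o (fun s => g i.+1 * \1_(J i) s)).
  apply: (@integrable_bounded_borel _ _ _ (g i.+1)) => //.
    by apply: measurable_funTS; apply: measurable_funM => //; exact: (measurable_indic (mJ i)).
  by move=> s _; rewrite normrM (ger0_norm (g0 i)) ler_piMr// indicE; case: (_ \in _); rewrite ?normr1 ?normr0.
rewrite (le_trans (le_normr_Rintegral _ _))//.
apply: (@le_trans _ _ (\int[lebesgue_measure]_(s in `[0, t]) \sum_(i < N) g i.+1 * \1_(J i) s)).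
  apply: (le_Rintegral (mu := lebesgue_measure)) => //; first exact: integrable_norm.
    exact: (integrable_EFin_sum (index_enum 'I_N) _ iJ).
  move=> s /=; rewrite in_itv/= => /andP[s0 st].
  have [s1|s1] := ltP s 1.
    by rewrite r0// normr0 sumr_ge0// => i _; rewrite mulr_ge0 ?g0// indicE.
  have /andP[h1 h2] := truncn_itv s0.
  have tr : (0 < Num.trunc s)%N by rewrite truncn_gt0.
  have trN : ((Num.trunc s).-1 < N)%N.
    by rewrite /N ltnS (leq_trans (leq_pred _))// le_truncn.
  rewrite (bigD1 (Ordinal trN))//= prednK// indicE mem_set/=; last first.
    by rewrite /J prednK//= in_itv/= h1 h2.
  rewrite mulr1 -[leLHS]addr0 lerD//; first exact: rg.
  by rewrite sumr_ge0// => i _; rewrite mulr_ge0 ?g0// indicE.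
rewrite (Rintegral_sum (index_enum 'I_N) _ iJ)//; apply: le_trans (gG N).
apply: ler_sum => i _; rewrite RintegralZl//; last first.
  apply: (@integrable_bounded_borel _ _ _ 1) => //.
  by move=> s _; rewrite indicE; case: (_ \in _); rewrite ?normr1 ?normr0.
rewrite ler_piMr ?g0// leb_indic//.
rewrite -lee_fin EFin_leb; last by apply: bounded_borelS bt => //; exact: measurableI.
apply: (@le_trans _ _ (lebesgue_measure (J i : set R))).
  by apply: le_measure; rewrite ?inE//; [exact: (measurableI _ _ _ (mJ i))|exact: mJ].
by rewrite lebesgue_measure_itv/= lte_fin ltr_nat ltnSn -EFinB lee_fin -natr1; lra.
Qed.

End StepBound.

(** * The choice of the open set *)

Section OpenCover.
Context {R : realType}.

(** Q may have infinite measure, so outer regularity is used on each [n, n + 1[ with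
    error 2 ^ -(n + 1). *)
Lemma open_superset_measure_le1 (Q : set R) (s0 : R) :
  measurable Q -> 0 <= s0 -> Q `<=` `]s0, +oo[ ->
  exists U : set R, [/\ open U, Q `<=` U, U `<=` `]s0, +oo[ &
    (lebesgue_measure (U `\` Q) <= 1)%E].
Proof.
move=> mQ s00 Qs0.
pose I (n : nat) : set R := `[n%:R, n.+1%:R[%classic.
have mI n : measurable (I n) by exact: measurable_itv.
have mQI n : measurable (Q `&` I n) by exact: (measurableI _ _ mQ (mI n)).
have finQI n : (lebesgue_measure (Q `&` I n) < +oo)%E.
  apply: (@le_lt_trans _ _ (lebesgue_measure (I n))).
    by apply: le_measure; rewrite ?inE//; [exact: mQI|exact: mI].
  by rewrite lebesgue_measure_itv/= lte_fin ltr_nat ltnSn -EFinB ltry.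
have /choice[V hV] n : exists V : set R, [/\ open V, Q `&` I n `<=` V &
    (lebesgue_measure (V `\` (Q `&` I n)) < (1 / (2 ^ n.+1)%:R)%:E)%E].
  have e0 : 0 < 1 / (2 ^ n.+1)%:R :> R by rewrite divr_gt0// ltr0n expn_gt0.
  exact: (lebesgue_regularity_outer (mQI n) (finQI n) e0).
pose U := (\bigcup_n V n) `&` `]s0, +oo[%classic.
have oV n : open (V n) by have [] := hV n.
have oU : open U.
  by apply: openI; [apply: bigcup_open => n _; exact: oV|exact: interval_open].
exists U; split => //.
- move=> s Qs; split; last exact: Qs0.
  have s0' : 0 <= s by move: (Qs0 _ Qs); rewrite /= in_itv/= andbT => /ltW; exact: le_trans.
  have [_ QV _] := hV (Num.trunc s); exists (Num.trunc s) => //; apply: QV; split => //.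
  by rewrite /I/= in_itv/= truncn_itv.
- by move=> s [].
apply: (@le_trans _ _ (\sum_(n <oo) lebesgue_measure (V n `\` (Q `&` I n)))%E).
  apply: measure_sigma_subadditive.
  - move=> n; apply: measurableD; [exact: (open_measurable (oV n))|exact: mQI].
  - by apply: measurableD; [exact: (open_measurable oU)|exact: mQ].
  move=> s [[[n _ Vs] _] nQs]; exists n => //; split => //.
  by case.
apply: le_trans (epsilon_trick0 xpredT (@ler01 R)).
by apply: lee_nneseries => [n _ _|n _]; [exact: measure_ge0|have [_ _ /ltW] := hV n].
Qed.

End OpenCover.

Section LogLog.
Context {R : realType}.

Lemma continuous_inv_xlnx (s0 T : R) : 1 < s0 ->
  {within `[s0, T], continuous (fun s => (s * ln s)^-1)}.
Proof.
move=> s01; apply: continuous_in_subspaceT => s; rewrite inE/= in_itv/= => /andP[s0s _].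
have s1 : 1 < s by exact: lt_le_trans s0s.
have sp : 0 < s by exact: lt_trans s1.
apply: cvgV; first by rewrite gt_eqF// mulr_gt0// ln_gt0.
by apply: cvgM => //; exact: continuous_ln.
Qed.

Lemma loglog_divergence (s0 H : R) : 1 < s0 ->
  exists2 T, s0 < T & H <= \int[lebesgue_measure]_(s in `[s0, T]) (s * ln s)^-1.
Proof.
move=> s01; pose X := ln (ln s0) + `|H| + 1; pose T := expR (expR X).
have l0 : 0 < ln s0 by rewrite ln_gt0.
have s00 : 0 < s0 by exact: lt_trans s01.
have s0T : s0 < T.
  rewrite /T -[ltLHS]lnK ?posrE// ltr_expR -[ltLHS]lnK ?posrE// ltr_expR /X.
  by have := normr_ge0 H; lra.
exists T => //.
have pos s : s0 <= s -> 0 < s /\ 0 < ln s.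
  by move=> h; split; [exact: lt_le_trans h|rewrite ln_gt0// (lt_le_trans s01)].
have dF s : s0 <= s -> is_derive s 1 (fun u => ln (ln u)) (s * ln s)^-1.
  move=> /pos[sp lp].
  have d1 := is_derive1_ln sp; have d2 := is_derive1_ln lp.
  have := @is_derive1_comp R (@ln R) (@ln R) s _ _ d2 d1.
  by rewrite mulrC invfM.
have cf := @continuous_inv_xlnx s0 T s01.
have := @continuous_FTC2 R _ (fun u => ln (ln u)) s0 T s0T cf.
rewrite /Rintegral => ->.
- rewrite -EFinB/= /T !expRK /X; have := ler_norm H; lra.
- have cF s : s0 <= s -> {for s, continuous (fun u => ln (ln u))}.
    by move=> /dF[h _]; apply: differentiable_continuous; apply/derivable1_diffP.
  split.
  + by move=> s; rewrite in_itv/= => /andP[/ltW /dF[]].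
  + by apply: cvg_at_right_filter; exact: cF.
  + by apply: cvg_at_left_filter; apply: cF; exact: ltW.
- by move=> s; rewrite in_itv/= => /andP[/ltW /dF h _]; rewrite derive1E derive_val.
Qed.

End LogLog.

Section ChoiceOfSet.
Context {R : realType}.

Implicit Types (h : R -> R) (Q U : set R).

(** The kernel 1 / s is written f1 s, which is bounded on the whole line. *)
Let cut U (f : R -> R) (s : R) : R := \1_U s * (f s * f1 s).

Let measurable_cut U (f : R -> R) : measurable U -> measurable_fun setT f ->
  measurable_fun setT (cut U f).
Proof.
move=> mU mf; apply: measurable_funM; first exact: measurable_indic.
by apply: measurable_funM => //; exact: measurable_f1.
Qed.

Let cut_le U (s0 : R) (f : R -> R) (K : R) : 1 <= s0 -> U `<=` `]s0, +oo[ -> 0 <= K ->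
  (forall s, s0 < s -> `|f s| <= K) -> forall s, `|cut U f s| <= K.
Proof.
move=> s01 Us0 K0 fK s; rewrite /cut indicE; case: (boolP (s \in U)); last first.
  by rewrite mul0r normr0.
rewrite inE => /Us0; rewrite /= in_itv/= andbT => ss0; rewrite mul1r.
by rewrite normrM -[leRHS]mulr1 ler_pM// ?fK// f1_le1.
Qed.

Let bt (t : R) : bounded_borel (`[0, t]%classic : set R).
Proof. by apply/bounded_borelP; split => //; exists t. Qed.

Let integrable_cut U (s0 : R) (f : R -> R) (K t : R) : measurable U -> measurable_fun setT f ->
  1 <= s0 -> U `<=` `]s0, +oo[ -> 0 <= K -> (forall s, s0 < s -> `|f s| <= K) ->
  lebesgue_measure.-integrable `[0, t] (EFin \o cut U f).
Proof.
move=> mU mf s01 Us0 K0 fK; apply: (@integrable_bounded_borel _ _ _ K) => //.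
  by apply: measurable_funTS; exact: measurable_cut.
by move=> s _; exact: (cut_le s01).
Qed.

Lemma Rintegral_subset_le (f : R -> R) (K : R) (A B : set R) : measurable_fun setT f ->
  (forall s, 0 <= f s) -> (forall s, `|f s| <= K) ->
  bounded_borel B -> measurable A -> A `<=` B ->
  \int[lebesgue_measure]_(s in A) f s <= \int[lebesgue_measure]_(s in B) f s.
Proof.
move=> mf f0 fK bB mA AB; have [mB _ _] := bB.
have ii D : bounded_borel D -> lebesgue_measure.-integrable D (EFin \o f).
  by move=> bD; apply: (@integrable_bounded_borel _ _ _ K) => //; exact: measurable_funTS.
have iA := ii _ (bounded_borelS mA AB bB); have iB := ii _ bB.
rewrite /Rintegral; apply: fine_le.
- exact: (integrable_fin_num (mu := lebesgue_measure) _ iA).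
- exact: (integrable_fin_num (mu := lebesgue_measure) _ iB).
apply: ge0_subset_integral => //.
- by apply/measurable_EFinP; exact: measurable_funTS.
- by move=> s _; rewrite lee_fin.
Qed.

Let Rintegral_mono0 (f : R -> R) (K : R) (t t' : R) : measurable_fun setT f ->
  (forall s, 0 <= f s) -> (forall s, `|f s| <= K) -> t <= t' ->
  \int[lebesgue_measure]_(s in `[0, t]) f s <= \int[lebesgue_measure]_(s in `[0, t']) f s.
Proof.
move=> mf f0 fK tt'; apply: (Rintegral_subset_le mf f0 fK (bt t')) => //.
by move=> s /=; rewrite !in_itv/= => /andP[-> h]; exact: le_trans tt'.
Qed.

(** An open U around Q with an excess of measure at most 1 changes the integral of
    h / s by at most 1, as |h| <= 1. So it diverges to +oo over U; for b <= 0 both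
    terms of (b - h) / s push down, and for b > 0 the term b / s, whose integral
    over U diverges as well, wins because h tends to 0. *)
Lemma one_sided_choice h Q (s0 : R) : measurable_fun setT h -> measurable Q ->
  1 <= s0 -> Q `<=` `]s0, +oo[ -> (forall s, Q s -> 0 <= h s) ->
  (forall s, s0 < s -> `|h s| <= 1) ->
  (forall e, 0 < e -> exists s1, forall s, s1 < s -> `|h s| <= e) ->
  (forall H, exists T, H <= \int[lebesgue_measure]_(s in `[0, T]) cut Q h s) ->
  exists U : set R, [/\ open U, U `<=` `]s0, +oo[ & forall b,
    let B t := \int[lebesgue_measure]_(s in `[0, t]) cut U (fun s => b - h s) s in
    (forall H, exists T, forall t, T <= t -> H <= B t) \/
    (forall H, exists T, forall t, T <= t -> B t <= H)].
Proof.
move=> mh mQ s01 Qs0 Qh h1 h0 div.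
have s00 : 0 <= s0 by exact: le_trans s01.
have [U [oU QU Us0 UQ]] := open_superset_measure_le1 mQ s00 Qs0.
exists U; split => // b B.
have mU : measurable U by exact: open_measurable.
have mUQ : measurable (U `\` Q) by exact: measurableD.
have iU (f : R -> R) K t mf K0 fK := @integrable_cut U s0 f K t mU mf s01 Us0 K0 fK.
pose E t := \int[lebesgue_measure]_(s in `[0, t]) cut U h s.
have iE t : lebesgue_measure.-integrable `[0, t] (EFin \o cut U h) by exact: (iU _ 1).
have iQ t : lebesgue_measure.-integrable `[0, t] (EFin \o cut Q h).
  exact: (@integrable_cut Q s0 h 1 t).
have iI t D : measurable D -> lebesgue_measure.-integrable `[0, t] (EFin \o (\1_D : R -> R)).
  move=> mD; apply: (@integrable_bounded_borel _ _ _ 1) => //.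
  by move=> s _; rewrite indicE; case: (_ \in _); rewrite ?normr1 ?normr0.
have EQ t : \int[lebesgue_measure]_(s in `[0, t]) cut Q h s - 1 <= E t.
  apply: (@le_trans _ _ (\int[lebesgue_measure]_(s in `[0, t]) (cut Q h s - \1_(U `\` Q) s))).
    rewrite (RintegralB (mu := lebesgue_measure) _ (iQ t) (iI t _ mUQ))// lerD2l lerN2.
    rewrite leb_indic// -lee_fin EFin_leb; last first.
      by apply: bounded_borelS (bt t) => //; exact: (measurableI _ _ _ mUQ).
    apply: le_trans UQ; apply: le_measure; rewrite ?inE//; exact: (measurableI _ _ _ mUQ).
  apply: (le_Rintegral (mu := lebesgue_measure)) => //.
    by have := integrableB _ (iQ t) (iI t _ mUQ); apply.
  move=> s _; rewrite /cut !indicE in_setD.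
  have [sU|sU] := boolP (s \in U); have [sQ|sQ] := boolP (s \in Q) => /=; rewrite ?mul1r ?mul0r ?subr0//.
    rewrite sub0r; have := cut_le s01 Us0 ler01 h1 s.
    by rewrite /cut indicE sU mul1r ler_norml => /andP[].
  by exfalso; move/negP : sU; apply; move: sQ; rewrite !inE; exact: QU.
have QM t t' : t <= t' -> \int[lebesgue_measure]_(s in `[0, t]) cut Q h s <=
    \int[lebesgue_measure]_(s in `[0, t']) cut Q h s.
  apply: (@Rintegral_mono0 _ 1) => //; first exact: measurable_cut.
    move=> s; rewrite /cut indicE; have [sQ|sQ] := boolP (s \in Q); rewrite ?mul0r// mul1r.
    by move: sQ; rewrite inE => sQ; rewrite mulr_ge0 ?Qh// f1_ge0.
  exact: (cut_le s01).
have Einf H : exists T, forall t, T <= t -> H <= E t.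
  have [T hT] := div (H + 1); exists T => t Tt.
  by have := EQ t; have := QM _ _ Tt; lra.
have mb : measurable_fun setT (fun s => b - h s) by exact: measurable_funB.
have bh s : s0 < s -> `|b - h s| <= `|b| + 1.
  by move=> ss0; rewrite (le_trans (ler_normB _ _))// lerD2l h1.
have iB t : lebesgue_measure.-integrable `[0, t] (EFin \o cut U (fun s => b - h s)).
  by apply: (iU _ (`|b| + 1)) => //; rewrite addr_ge0.
have Ugt s : U s -> s0 < s by move=> /Us0; rewrite /= in_itv/= andbT.
have [b0|b0] := leP b 0.
  right => H; have [T hT] := Einf (- H); exists T => t /hT hE.
  suff : B t <= - E t by lra.
  rewrite /E -mulN1r -(RintegralZl (mu := lebesgue_measure) (-1) _ (iE t))//.
  apply: (le_Rintegral (mu := lebesgue_measure)) => //.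
    exact: (integrableZl (mu := lebesgue_measure) _ (-1) (iE t)).
  move=> s _; rewrite /cut !indicE; have [sU|sU] := boolP (s \in U); rewrite ?mul0r ?mulr0// !mul1r mulN1r -mulNr.
  by rewrite ler_wpM2r ?f1_ge0//; lra.
left => H; have b20 : 0 < b / 2 by rewrite divr_gt0.
have [s1 hs1] := h0 _ b20.
pose S := Num.max s1 0; have S0 : 0 <= S by rewrite le_max lexx orbT.
have [T hT] := Einf ((H + S) / (b / 2)); exists T => t /hT hE.
have hE' : H + S <= b / 2 * E t by rewrite mulrC -ler_pdivrMr.
have mS : measurable (`[0, S]%classic : set R) by exact: measurable_itv.
have iE' : lebesgue_measure.-integrable `[0, t] (EFin \o (fun s => b / 2 * cut U h s)).
  exact: (integrableZl (mu := lebesgue_measure) _ (b / 2) (iE t)).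
suff : b / 2 * E t - S <= B t by lra.
apply: (@le_trans _ _ (\int[lebesgue_measure]_(s in `[0, t]) (b / 2 * cut U h s - \1_(`[0, S]) s))).
  rewrite (RintegralB (mu := lebesgue_measure) _ iE' (iI t _ mS))//.
  rewrite (RintegralZl (mu := lebesgue_measure) (b / 2) _ (iE t))// lerD2l lerN2.
  rewrite leb_indic// -lee_fin EFin_leb; last first.
    by apply: bounded_borelS (bt t) => //; exact: (measurableI _ _ _ mS).
  apply: (@le_trans _ _ (lebesgue_measure (`[0, S]%classic : set R))).
    by apply: le_measure; rewrite ?inE//; exact: (measurableI _ _ _ mS).
  by rewrite lebesgue_measure_itv/= lte_fin; case: ltP; rewrite ?oppr0 ?adde0 ?sube0// lee_fin.
apply: (le_Rintegral (mu := lebesgue_measure)) => //.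
  by have := integrableB _ iE' (iI t _ mS); apply.
move=> s _; rewrite /cut !indicE; have [sU|sU] := boolP (s \in U); last first.
  by rewrite !mul0r mulr0 sub0r oppr_le0.
rewrite !mul1r; move: sU; rewrite inE => /Ugt ss0.
have f0 := f1_ge0 s; have f1' : f1 s <= 1 by have := f1_le1 s; rewrite ger0_norm.
have hf : h s * f1 s <= f1 s.
  by rewrite -[leRHS]mul1r ler_wpM2r// (le_trans (ler_norm _))// h1.
have bhs : b / 2 * (h s * f1 s) <= b / 2 * f1 s by rewrite ler_wpM2l// ltW.
have [sS|Ss] := leP s S.
  rewrite mem_set/=; last by rewrite in_itv/= sS (le_trans s00)// ltW.
  have : 0 <= b / 2 * f1 s by rewrite mulr_ge0// ltW.
  by lra.
rewrite memNset/=; last by rewrite in_itv/= [s <= S]leNgt Ss andbF.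
rewrite subr0 (le_trans bhs)// ler_wpM2r//.
have : `|h s| <= b / 2 by apply: hs1; apply: le_lt_trans Ss; rewrite le_max lexx.
by rewrite ler_norml => /andP[]; lra.
Qed.

(** h may change sign wildly, so neither { h >= 0 } nor { h < 0 } need carry a full
    share of the integral of |h| / s; but that integral diverges like log log, so
    over one of the two sets it is infinite. *)
Lemma choice_of_set h (s0 c : R) : measurable_fun setT h -> 1 < s0 -> 0 < c ->
  (forall s, s0 < s -> c / ln s <= `|h s| <= 1) ->
  (forall e, 0 < e -> exists s1, forall s, s1 < s -> `|h s| <= e) ->
  exists U : set R, [/\ open U, U `<=` `]s0, +oo[ & forall b,
    let B t := \int[lebesgue_measure]_(s in `[0, t]) (\1_U s * ((b - h s) * f1 s)) in
    (forall H, exists T, forall t, T <= t -> H <= B t) \/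
    (forall H, exists T, forall t, T <= t -> B t <= H)].
Proof.
move=> mh s01 c0 hc h0; have s01' := ltW s01.
pose Q1 := `]s0, +oo[%classic `&` [set s | 0 <= h s].
pose Q2 := `]s0, +oo[%classic `&` [set s | h s < 0].
have mQ1 : measurable Q1.
  have := mh measurableT _ (measurable_itv `[0, +oo[); rewrite setTI.
  move=> /(measurableI _ _ (measurable_itv `]s0, +oo[)).
  by congr (measurable (_ `&` _)); apply/seteqP; split => s /=; rewrite in_itv/= andbT.
have mQ2 : measurable Q2.
  have := mh measurableT _ (measurable_itv `]-oo, 0[); rewrite setTI.
  by move=> /(measurableI _ _ (measurable_itv `]s0, +oo[)).
have mNh : measurable_fun setT (fun s => - h s) by exact: measurable_funN.
have h1 s : s0 < s -> `|h s| <= 1 by move=> /hc /andP[].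
have Nh1 s : s0 < s -> `|- h s| <= 1 by rewrite normrN; exact: h1.
have Q1s : Q1 `<=` `]s0, +oo[ by move=> s [].
have Q2s : Q2 `<=` `]s0, +oo[ by move=> s [].
pose p t := \int[lebesgue_measure]_(s in `[0, t]) cut Q1 h s.
pose n t := \int[lebesgue_measure]_(s in `[0, t]) cut Q2 (fun s => - h s) s.
have ip t : lebesgue_measure.-integrable `[0, t] (EFin \o cut Q1 h).
  exact: (@integrable_cut Q1 s0 h 1 t).
have in_ t : lebesgue_measure.-integrable `[0, t] (EFin \o cut Q2 (fun s => - h s)).
  exact: (@integrable_cut Q2 s0 (fun s => - h s) 1 t).
have cutp s : 0 <= cut Q1 h s.
  rewrite /cut indicE; have [sQ|sQ] := boolP (s \in Q1); rewrite ?mul0r// mul1r.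
  by move: sQ; rewrite inE => -[_ /= hs]; rewrite mulr_ge0// f1_ge0.
have cutn s : 0 <= cut Q2 (fun s => - h s) s.
  rewrite /cut indicE; have [sQ|sQ] := boolP (s \in Q2); rewrite ?mul0r// mul1r.
  by move: sQ; rewrite inE => -[_ /= hs]; rewrite mulr_ge0 ?f1_ge0// oppr_ge0 ltW.
have pn H : exists T, H <= p T + n T.
  have s02 : 1 < s0 + 1 by lra.
  have [T s0T hT] := @loglog_divergence R (s0 + 1) (H / c) s02; exists T.
  have hT' : H <= c * \int[lebesgue_measure]_(s in `[s0 + 1, T]) (s * ln s)^-1.
    by rewrite mulrC -ler_pdivrMr.
  have mF : measurable_fun setT (fun s => cut Q1 h s + cut Q2 (fun s => - h s) s).
    by apply: measurable_funD; exact: measurable_cut.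
  have F0 s : 0 <= cut Q1 h s + cut Q2 (fun s => - h s) s by rewrite addr_ge0.
  have FK s : `|cut Q1 h s + cut Q2 (fun s => - h s) s| <= 2.
    have -> : 2 = 1 + 1 :> R by rewrite -[2]natr1.
    by rewrite (le_trans (ler_normD _ _))// lerD//; exact: (cut_le s01').
  have FE s : s0 < s -> cut Q1 h s + cut Q2 (fun s => - h s) s = `|h s| * f1 s.
    move=> ss0; rewrite /cut !indicE; have [h0s|h0s] := leP 0 (h s).
      rewrite mem_set/=; last by split => //; rewrite /= in_itv/= ss0.
      rewrite memNset/=; last by move=> [_ /=]; rewrite ltNge h0s.
      by rewrite mul1r mul0r addr0 (ger0_norm h0s).
    rewrite memNset/=; last by move=> [_ /=]; rewrite leNgt h0s.
    rewrite mem_set/=; last by split => //; rewrite /= in_itv/= ss0.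
    by rewrite mul1r mul0r add0r (ltr0_norm h0s).
  have sub : `[s0 + 1, T] `<=` `[0, T].
    by move=> s /=; rewrite !in_itv/= => /andP[ss0 ->]; rewrite andbT; lra.
  have bs : bounded_borel (`[s0 + 1, T]%classic : set R) by exact: bounded_borelS (bt T).
  apply: (le_trans hT').
  rewrite /p /n -(RintegralD (mu := lebesgue_measure) _ (ip T) (in_ T))//.
  apply: le_trans (Rintegral_subset_le mF F0 FK (bt T) _ sub) => //.
  have llE s : s0 + 1 <= s -> c * (s * ln s)^-1 <= cut Q1 h s + cut Q2 (fun s => - h s) s.
    move=> ss0; have ss0' : s0 < s by lra.
    rewrite FE// f1E; last by lra.
    rewrite invfM mulrCA mulrC ler_wpM2r// ?invr_ge0; first by lra.
    by have /andP[] := hc s ss0'.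
  have lpos s : s0 + 1 <= s -> 0 <= (s * ln s)^-1.
    by move=> ss0; rewrite invr_ge0 mulr_ge0 ?ln_ge0//; lra.
  have ill : lebesgue_measure.-integrable `[s0 + 1, T] (EFin \o (fun s => (s * ln s)^-1)).
    apply: continuous_compact_integrable; first exact: segment_compact.
    exact: continuous_inv_xlnx.
  rewrite -(RintegralZl (mu := lebesgue_measure) c _ ill)//.
  apply: (le_Rintegral (mu := lebesgue_measure)) => //.
  - exact: (integrableZl (mu := lebesgue_measure) _ c ill).
  - by apply: (@integrable_bounded_borel _ _ _ 2) => //; exact: measurable_funTS.
  - by move=> s /=; rewrite in_itv/= => /andP[ss0 _]; exact: llE.
have pM t t' : t <= t' -> p t <= p t'.
  by apply: (@Rintegral_mono0 _ 1) => //; [exact: measurable_cut|exact: (cut_le s01')].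
have nM t t' : t <= t' -> n t <= n t'.
  by apply: (@Rintegral_mono0 _ 1) => //; [exact: measurable_cut|exact: (cut_le s01')].
have [pinf|/existsNP[H1 /forallNP hH1]] := pselect (forall H, exists T, H <= p T).
  by have [] := @one_sided_choice h Q1 s0 => //; [move=> s []|move=> U hU; exists U].
have ninf H : exists T, H <= n T.
  have [T hT] := pn (H + H1); exists T.
  by have /negP := hH1 T; rewrite -ltNge; lra.
have [] := @one_sided_choice (fun s => - h s) Q2 s0 => //.
- by move=> s [_ /= hs]; rewrite oppr_ge0 ltW.
- by move=> e /h0[s1 hs1]; exists s1 => s /hs1; rewrite normrN.
move=> U [oU Us0 hU]; exists U; split => // b B.
have BE t : B t = - \int[lebesgue_measure]_(s in `[0, t]) cut U (fun s => - b - - h s) s.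
  have iB : lebesgue_measure.-integrable `[0, t] (EFin \o cut U (fun s => - b - - h s)).
    apply: (@integrable_cut U s0 _ (`|b| + 1) t) => //; first exact: open_measurable.
    - exact: measurable_funB.
    - by move=> s ss0; rewrite (le_trans (ler_normB _ _))// normrN lerD2l Nh1.
  rewrite -mulN1r -(RintegralZl (mu := lebesgue_measure) (-1) _ iB)//.
  by apply: eq_Rintegral => s _; rewrite /cut; ring.
have [hb|hb] := hU (- b).
  by right => H; have [T hT] := hb (- H); exists T => t /hT; rewrite BE lerNl.
by left => H; have [T hT] := hb (- H); exists T => t /hT; rewrite BE lerNr.
Qed.

End ChoiceOfSet.

(** * The truncated integrand *)

Section TailMoment.
Context {R : realType} {d : nat}.
Variables (nu : {measure set 'rV[R]_d -> \bar R}) (k : 'I_d).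
Hypothesis nu_trunc : (\int[nu]_x (trunc2 x)%:E < +oo)%E.
Hypothesis nu_big : nu.-integrable setT (EFin \o bigpart (R := R) (d := d)).

Let tail (s : R) := [set x : 'rV[R]_d | Num.max s 1 < enorm x].

Let mtail s : measurable (tail s).
Proof. exact: measurable_enorm_gt. Qed.

Let integrable_part (w : 'rV[R]_d -> R) (s : R) : measurable_fun setT w ->
  (forall x, 0 <= w x <= enorm x) -> nu.-integrable setT (EFin \o (fun x => w x * \1_(tail s) x)).
Proof.
move=> mw wx; apply: (@integrable_le_dominant _ _ _ nu_trunc nu_big _ _ 1) => //.
  by apply: measurable_funM => //; exact: measurable_indic.
move=> x _; have /andP[w0 we] := wx x; rewrite mul1r indicE /dominant.
have [xt|xt] := boolP (x \in tail s); rewrite ?mulr1 ?mulr0 ?normr0; last first.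
  by rewrite addr_ge0 ?trunc2_ge0// bigpart_ge0.
rewrite (ger0_norm w0) (le_trans we)// /bigpart indicE mem_set ?mulr1 ?lerDr ?trunc2_ge0//=.
by move: xt; rewrite inE /tail/= gt_max => /andP[].
Qed.

Let measurable_part (w : 'rV[R]_d -> R) : measurable_fun setT w ->
  (forall x, 0 <= w x <= enorm x) ->
  measurable_fun setT (fun s => \int[nu]_x (w x * \1_(tail s) x)).
Proof.
move=> mw wx; apply: nonincreasing_measurable => // s t st.
apply: le_Rintegral => //; [exact: integrable_part|exact: integrable_part|].
move=> x _; have /andP[w0 _] := wx x; rewrite ler_wpM2l// !indicE ler_nat.
case: (boolP (x \in tail t)) => // xt; rewrite mem_set//.
move: xt; rewrite inE /tail/= !gt_max => /andP[tx ->].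
by rewrite (le_lt_trans st).
Qed.

(** The tail moments of the positive and of the negative part of the coordinate
    are monotone in the radius. *)
Lemma measurable_htail : measurable_fun setT (fun s : R => htail nu k (Num.max s 1)).
Proof.
have mk : measurable_fun setT (fun x : 'rV[R]_d => x 0 k) by exact: measurable_coord.
have ck (x : 'rV[R]_d) : `|x 0 k| <= enorm x := coord_le_enorm k x.
pose wp (x : 'rV[R]_d) := Num.max (x 0 k) 0; pose wn (x : 'rV[R]_d) := Num.max (- x 0 k) 0.
have mwp : measurable_fun setT wp by exact: measurable_maxr.
have mwn : measurable_fun setT wn by apply: measurable_maxr => //; exact: measurable_funN.
have hp (x : 'rV[R]_d) : 0 <= wp x <= enorm x.
  by rewrite /wp le_max lexx orbT/= ge_max enorm_ge0 andbT (le_trans (ler_norm _))// ck.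
have hn (x : 'rV[R]_d) : 0 <= wn x <= enorm x.
  by rewrite /wn le_max lexx orbT/= ge_max enorm_ge0 andbT (le_trans (ler_norm _))// normrN ck.
rewrite (_ : (fun s => _) = (fun s => \int[nu]_x (wp x * \1_(tail s) x) -
    \int[nu]_x (wn x * \1_(tail s) x))).
  by apply: measurable_funB; exact: measurable_part.
apply/funext => s; rewrite -RintegralB//; [|exact: integrable_part|exact: integrable_part].
rewrite /htail Rintegral_mkcond; apply: eq_Rintegral => x _.
rewrite patchE indicE -/(tail s); case: ifPn => _; rewrite ?mulr1 ?mulr0 ?subr0//.
rewrite /wp /wn; case: (leP (x 0 k) 0) => h; case: (leP (- x 0 k) 0) => h'; lra.
Qed.

End TailMoment.

Section CutIntegrand.
Context {R : realType} {d : nat}.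
Variables (mu : probability 'rV[R]_d R) (j : 'I_d).
Variables (A : 'M[R]_d) (nu : {measure set 'rV[R]_d -> \bar R}) (gamma : 'rV[R]_d).
Hypothesis triplet : has_levy_triplet mu A nu gamma.
Hypothesis nu_big : nu.-integrable setT (EFin \o bigpart (R := R) (d := d)).

(** Up to a bounded error, the shift by q only changes the constant b in the phase,
    and the phase diverges for every b. *)
Lemma not_definable_cut (U : set R) (q : 'rV[R]_d) :
  measurable U -> U `<=` `[1, +oo[ ->
  (forall s, U s -> `|htail nu j s| <= 1) ->
  (forall b : R,
    let B t := \int[lebesgue_measure]_(s in `[0, t])
      (\1_U s * ((b - htail nu j (Num.max s 1)) * f1 s)) in
    (forall H, exists T, forall t, T <= t -> H <= B t) \/
    (forall H, exists T, forall t, T <= t -> B t <= H)) ->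
  ~ improper_integral_definable (fun s => f1 s * \1_U s) (convolution mu (dirac q)).
Proof.
move=> mU U1 hU div def.
have nt := levy_nu_trunc triplet.
have qA0 := gauss_part_ge0 j triplet.
set qA := gauss_part j A in qA0.
pose a := lev_re nu j qA; pose b := lev_im nu j (gamma 0 j).
have ca : continuous a by exact: continuous_lev_re.
have cb : continuous b by exact: continuous_lev_im.
have a0 : a 0 = 0 by exact: lev_re0.
have b0 : b 0 = 0 by exact: lev_im0.
have ale0 u : a u <= 0 by exact: lev_re_le0.
have cmu u := charf_triplet j triplet u.
pose f2 := fun s : R => f1 s * \1_U s.
have f2le s : `|f2 s| <= 1.
  rewrite /f2 normrM -[leRHS]mulr1 ler_pM ?f1_le1//.
  by rewrite indicE; case: (_ \in _); rewrite ?normr1 ?normr0.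
have f2E s : U s -> f2 s = s^-1 /\ 1 <= s.
  move=> Us; have := U1 _ Us; rewrite /= in_itv/= andbT => s1.
  by rewrite /f2 indicE mem_set// mulr1 f1E.
have f2N s : ~ U s -> f2 s = 0 by move=> Us; rewrite /f2 indicE memNset// mulr0.
have f2lt1 s : s < 1 -> ~ U s.
  by move=> s1 /U1; rewrite /= in_itv/= andbT leNgt s1.
have mf2 : measurable_fun setT f2.
  by apply: measurable_funM; [exact: measurable_f1|exact: measurable_indic].
have [Phi [_ _ PhiP]] := definable_charf ca cb a0 b0 ale0 cmu
  (fun B _ => erefl (convolution mu (dirac q) B)) f2le def.
have := PhiP 1.
pose phi s := b (1 * f2 s) + 1 * f2 s * q 0 j.
have ma : measurable_fun setT (fun s => a (1 * f2 s)).
  apply: measurableT_comp; first exact: continuous_measurable_fun.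
  exact: measurable_funM.
have mphi : measurable_fun setT phi.
  apply: measurable_funD; last by apply: measurable_funM => //; exact: measurable_funM.
  apply: measurableT_comp; first exact: continuous_measurable_fun.
  exact: measurable_funM.
have bt (t : R) : bounded_borel (`[0, t]%classic : set R).
  by apply/bounded_borelP; split => //; exists t.
have [Kb Kb0 hKb] : exists2 Kb : R, 0 <= Kb & forall x, `|x| <= 1 -> `|b x| <= Kb.
  exact: continuous_bounded_itv.
have iphi t : lebesgue_measure.-integrable `[0, t] (EFin \o phi).
  apply: (@integrable_bounded_borel _ _ _ (Kb + `|q 0 j|)) => //.
    exact: measurable_funTS.
  move=> s _; rewrite /phi mul1r (le_trans (ler_normD _ _))// lerD ?hKb//.
  by rewrite normrM ler_piMl.
have n1 (n : nat) : (0 < n)%N -> 1 <= n%:R :> R by rewrite ler1n.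
have decr (n : nat) (s : R) : (0 < n)%N -> n%:R <= s -> Gtail nu s <= Gtail nu n%:R.
  by move=> /n1 n0 ns; exact: Gtail_mono.
pose G := \int[nu]_x (2 * dominant x).
have GG N : \sum_(i < N) Gtail nu i.+1%:R <= G by exact: sum_Gtail_le.
have boundA t : `|\int[lebesgue_measure]_(s in `[0, t]) a (1 * f2 s)| <= qA * 2 + 2 * G.
  apply: (@step_bound _ _ (fun n => qA * (n%:R ^+ 2)^-1 + 2 * Gtail nu n%:R)) => //.
  - by move=> s /f2lt1 /f2N ->; rewrite mulr0.
  - move=> n s n0 ns; have [Us|Us] := pselect (U s); last first.
      rewrite f2N// mulr0 a0 normr0 addr_ge0 ?mulr_ge0 ?invr_ge0 ?sqr_ge0//.
      exact: Gtail_ge0.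
    have [-> s1] := f2E s Us; rewrite mul1r (le_trans (lev_re_le_Gtail j nt qA0 s1))//.
    rewrite lerD ?ler_wpM2l ?decr//.
    have n0' : 0 < n%:R :> R by rewrite ltr0n.
    rewrite lef_pV2 ?posrE ?exprn_gt0//; last exact: lt_le_trans s1.
    by rewrite ler_pXn2r ?nnegrE ?(ltW n0')// (le_trans _ s1).
  - move=> N; rewrite big_split/= -!mulr_sumr; apply: lerD; apply: ler_wpM2l => //.
      exact: sum_inv_sq_le.
    exact: GG.
pose h s := htail nu j (Num.max s 1).
have mh : measurable_fun setT h by exact: measurable_htail.
(* the constant towards which the drift of the shifted exponent at 1 / s settles *)
pose beta := gamma 0 j + drift nu j + q 0 j.
pose e s := \1_U s * ((beta - h s) * f1 s).
have me : measurable_fun setT e.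
  apply: measurable_funM; first exact: measurable_indic.
  by apply: measurable_funM; [exact: measurable_funB|exact: measurable_f1].
have ie t : lebesgue_measure.-integrable `[0, t] (EFin \o e).
  apply: (@integrable_bounded_borel _ _ _ (`|beta| + 1)) => //.
    exact: measurable_funTS.
  move=> s _; rewrite /e indicE; have [|_] := boolP (s \in U); last first.
    by rewrite mul0r normr0 addr_ge0.
  rewrite inE mul1r => Us; have [_ s1] := f2E s Us.
  rewrite normrM -[leRHS]mulr1 ler_pM ?f1_le1//.
  by rewrite (le_trans (ler_normB _ _))// lerD2l /h max_l// hU.
have boundE t : `|\int[lebesgue_measure]_(s in `[0, t]) (phi s - e s)| <= G.
  apply: (@step_bound _ _ (fun n => Gtail nu n%:R)) => //.
  - exact: measurable_funB.
  - move=> s /f2lt1 Us; rewrite /phi f2N// /e indicE memNset// mul0r mulr0 b0 mul0r.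
    by rewrite addr0 subr0.
  - move=> n s n0 ns; have [Us|Us] := pselect (U s); last first.
      rewrite /phi f2N// /e indicE memNset// mul0r mulr0 b0 mul0r addr0 subr0 normr0.
      exact: Gtail_ge0.
    have [fs s1] := f2E s Us.
    apply: le_trans (decr n s n0 ns); apply: le_trans (lev_im_le_Gtail j nt nu_big (gamma 0 j) s1).
    rewrite /phi fs /e indicE mem_set// !mul1r f1E// /h max_l// /b /beta.
    rewrite le_eqVlt; apply/orP; left; apply/eqP; congr `|_|; ring.
apply: (phase_divergence boundA iphi).
have BE t : \int[lebesgue_measure]_(s in `[0, t]) phi s =
    \int[lebesgue_measure]_(s in `[0, t]) e s +
    \int[lebesgue_measure]_(s in `[0, t]) (phi s - e s).
  rewrite (RintegralB (mu := lebesgue_measure) _ (iphi t) (ie t))//; lra.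
have [up|down] := div beta; [left|right] => H.
  have [T hT] := up (H + G); exists T => t /hT; rewrite -/(e _) BE.
  by have := boundE t; rewrite ler_norml => /andP[]; lra.
have [T hT] := down (H - G); exists T => t /hT; rewrite BE.
by have := boundE t; rewrite ler_norml => /andP[]; lra.
Qed.

End CutIntegrand.

Local Close Scope complex_scope.

Theorem theorem1p6 (R : realType) (d : nat) (mu : probability 'rV[R]_d R)
    (nu : {measure set 'rV[R]_d -> \bar R}) (j : 'I_d) (c : R)
    (mu_ID : infinitely_divisible mu)
    (mu_dom : dom_Phi f1 mu)
    (nu_levy : is_levy_measure mu nu)
    (c_gt0 : 0 < c)
    (nu_tail : `|\int[nu]_(x in [set x | s < enorm x]) x 0 j| / (c / ln s)
                 @[s --> +oo] --> (1 : R)) :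
  exists D : set R,
    [/\ D `<=` `[1, +oo[,
        exists2 U : set R, open U & D = U `&` `[1, +oo[
      & ~ dom_Phi_c (fun s => f1 s * \1_D s) mu].
Proof.
have [A [gamma triplet]] := nu_levy; have [_ def1] := mu_dom.
have nu_big := integrable_bigpart_f1 triplet def1.
have nt := levy_nu_trunc triplet.
pose h s := htail nu j (Num.max s 1).
have [t0 [_ ht0]] : \forall s \near +oo, `|1 - `|htail nu j s| / (c / ln s)| < 1 / 2.
  by move/cvgrPdist_lt : nu_tail; apply; lra.
have tail s : t0 < s -> 1 < s -> c / 2 / ln s <= `|htail nu j s| <= 2 * c / ln s.
  move=> /ht0 hs s1; have l0 : 0 < ln s by rewrite ln_gt0.
  have cl : 0 < c / ln s by rewrite divr_gt0.
  move: hs; set y := `|htail nu j s| => hs.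
  have -> : y = y / (c / ln s) * (c / ln s) by rewrite divfK// gt_eqF.
  move: hs; rewrite ltr_norml => /andP[h1 h2].
  have -> : c / 2 / ln s = 1 / 2 * (c / ln s) by ring.
  have -> : 2 * c / ln s = 2 * (c / ln s) by ring.
  by rewrite !ler_wpM2r ?(ltW cl)//; lra.
have small e : 0 < e -> exists s1, forall s, s1 < s -> `|h s| <= e.
  move=> e0; exists (Num.max (Num.max t0 1) (expR (2 * c / e))) => s.
  rewrite !gt_max => /andP[/andP[s0 s1] se].
  rewrite /h max_l; last exact: ltW.
  have /andP[_ h2] := tail s s0 s1; rewrite (le_trans h2)//.
  have l0 : 0 < ln s by rewrite ln_gt0.
  have : 2 * c / e <= ln s.
    by rewrite -[leLHS]expRK ler_ln ?posrE ?expR_gt0 ?(ltW se)// (lt_trans _ s1).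
  by rewrite !ler_pdivrMr// (mulrC e).
have [s1 hs1] := small 1 ltr01.
pose s0 := Num.max (Num.max t0 2) s1.
have s01 : 1 < s0 by rewrite !lt_max; apply/orP; left; apply/orP; right; lra.
have gt0 s : s0 < s -> [/\ t0 < s, 1 < s & s1 < s].
  by rewrite /s0 !gt_max => /andP[/andP[-> h2] ->]; split => //; lra.
have hbound s : s0 < s -> c / 2 / ln s <= `|h s| <= 1.
  move=> /gt0[ts s1' ss]; rewrite hs1// andbT /h max_l; last exact: ltW.
  by have /andP[] := tail s ts s1'.
have c20 : 0 < c / 2 by rewrite divr_gt0.
have [U [oU Us0 hU]] := choice_of_set (measurable_htail j nt nu_big) s01 c20 hbound small.
have U1 : U `<=` `[1, +oo[.
  by move=> s /Us0; rewrite /= !in_itv/= !andbT => ss; rewrite ltW// (lt_trans s01).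
exists U; split => //; first by exists U => //; rewrite setIidl.
move=> [_ _ [q]]; apply: (not_definable_cut triplet nu_big _ U1 _ hU).
  exact: open_measurable.
move=> s /Us0; rewrite /= in_itv/= andbT => ss.
have [_ s1' ss1] := gt0 s ss; have := hs1 s ss1; rewrite /h max_l//; exact: ltW.
Qed.
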